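(* Let $\mathfrak g$ be a complex finite-dimensional non-abelian Lie algebra. Then there exists an injective Lie algebra homomorphism $\mathfrak g\to A_1$ (i.e. $A_1^{\mathfrak g}\neq\emptyset$) if and only if $\mathfrak g$ is isomorphic to one of the following Lie algebras: 1) $\mathfrak{sl}(2)$; 2) $\mathfrak{sl}(2)\times\mathbb C$; 3) $\mathfrak{sl}(2)\ltimes\mathcal H_3$; 4) $\mathcal L_n$ for some $n\ge 2$; 5) $\tilde{\mathcal L}_n$ for some $n\ge 2$; 6) $\mathfrak r(i_1,\dots,i_n)$ for some $n\geq 1$ and some non-negative integers $i_1<\dots<i_n$, not all zero.
   Context: The Weyl algebra $A_1$ is the complex associative unital algebra generated by $p,q$ subject to $pq-qp=1$; it is regarded as a Lie algebra with bracket $[a,b]=ab-ba$. For a complex Lie algebra $\mathfrak g$, $A_1^{\mathfrak g}$ is the set of injective (linear) Lie algebra homomorphisms $\mathfrak g\to A_1$. $\mathfrak{sl}(2)=\mathfrak{sl}(2,\mathbb C)$. $\mathcal H_3$ is the three-dimensional Heisenberg algebra, with basis $P,Q,C$, $C$ central and $[P,Q]=C$. $\mathfrak{sl}(2)\ltimes\mathcal H_3$ is the semi-direct product in which $\mathfrak{sl}(2)$ acts on $\langle P,Q\rangle\cong\mathbb C^2$ by the standard representation and trivially on $C$; equivalently it is the Lie subalgebra of $A_1$ spanned by $1,p,q,p^2,q^2,pq+qp$. $\mathcal L_n$ is the Lie algebra with basis $X_0,X_1,\dots,X_n$ whose only non-zero commutation relations are (up to antisymmetry) $[X_0,X_k]=X_{k+1}$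 for $k=1,\dots,n-1$. $\tilde{\mathcal L}_n$ is the Lie algebra with basis $h,X_0,X_1,\dots,X_n$ whose only non-zero commutation relations are $[h,X_0]=X_0$, $[h,X_k]=-(n-k)X_k$ for $k=1,\dots,n$, and $[X_0,X_k]=X_{k+1}$ for $k=1,\dots,n-1$. $\mathfrak r(i_1,\dots,i_n)$ is the Lie algebra with basis $h,X_1,\dots,X_n$ whose only non-zero commutation relations are $[h,X_k]=-i_kX_k$ for $k=1,\dots,n$. *)

(* Defs.v *)
From HB Require Import structures.
From mathcomp Require Import all_boot all_order all_algebra.
From mathcomp Require Import ring ssrAC.
From mathcomp Require Import boolp reals.
From mathcomp Require Export complex.
From mathcomp.finmap Require Import finmap.
From mathcomp.multinomials Require Import monalg.

Set Implicit Arguments.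
Unset Strict Implicit.
Unset Printing Implicit Defensive.

Import GRing.Theory.
Local Open Scope ring_scope.
Local Open Scope quotient_scope.

HB.mixin Record Lmodule_isLie (K : fieldType) (g : Type)
    of GRing.Lmodule K g := {
  lie : g -> g -> g;
  lie_linearl : forall (a : K) x y z,
    lie (a *: x + y) z = a *: lie x z + lie y z;
  lie_linearr : forall (a : K) x y z,
    lie x (a *: y + z) = a *: lie x y + lie x z;
  liexx : forall x, lie x x = 0;
  lie_jacobi : forall x y z,
    lie x (lie y z) + lie y (lie z x) + lie z (lie x y) = 0
}.

#[short(type="lieAlgType")]
HB.structure Definition LieAlg (K : fieldType) :=
  {g of GRing.Lmodule K g & Lmodule_isLie K g}.

#[short(type="finLieAlgType")]
HB.structure Definition FinLieAlg (K : fieldType) :=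
  {g of LieAlg K g & Vector K g}.

Definition lie_abelian (K : fieldType) (g : lieAlgType K) : Prop :=
  forall x y : g, lie x y = 0.

Definition lie_embeds (K : fieldType) (g h : lieAlgType K) : Prop :=
  exists f : {linear g -> h}, injective f /\ {morph f : x y / lie x y}.

Definition lie_isomorphic (K : fieldType) (g h : lieAlgType K) : Prop :=
  exists f : {linear g -> h}, bijective f /\ {morph f : x y / lie x y}.

Definition commutator_lie (K : fieldType) (A : algType K) : Type := A.

Section CommutatorLie.
Variables (K : fieldType) (A : algType K).
HB.instance Definition _ := GRing.Lmodule.on (commutator_lie A).

Definition commutator (a b : commutator_lie A) : commutator_lie A :=
  (a : A) * b - (b : A) * a.

Fact commutator_linearl (a : K) x y z :
  commutator (a *: x + y) z = a *: commutator x z + commutator y z.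
Proof.
rewrite /commutator mulrDl mulrDr -scalerAl -scalerAr opprD addrACA.
by rewrite -scalerBr.
Qed.

Fact commutatorxx x : commutator x x = 0.
Proof. exact: subrr. Qed.

Fact commutator_linearr (a : K) x y z :
  commutator x (a *: y + z) = a *: commutator x y + commutator x z.
Proof.
rewrite /commutator mulrDl mulrDr -scalerAl -scalerAr opprD addrACA.
by rewrite -scalerBr.
Qed.

Fact commutator_jacobi x y z :
  commutator x (commutator y z) + commutator y (commutator z x)
  + commutator z (commutator x y) = 0.
Proof.
rewrite /commutator !(mulrBl, mulrBr) !mulrA !opprB.
rewrite (AC ((2*2)*(2*2)*(2*2))
  ((1*12)*(2*7)*(3*10)*(4*5)*(6*11)*(8*9)))%AC.
by rewrite /= !(subrr, addNr) !addr0.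
Qed.

HB.instance Definition _ := Lmodule_isLie.Build K (commutator_lie A)
  commutator_linearl commutator_linearr commutatorxx commutator_jacobi.
End CommutatorLie.

Section Weyl.
Variable K : fieldType.
Local Notation F := {malg K[{fmonom bool}]}.

Definition free_p : F := << fmu true >>.
Definition free_q : F := << fmu false >>.
(* Two-sided ideal of the free algebra generated by p q - q p - 1. *)
Definition weyl_rel : F := free_p * free_q - free_q * free_p - 1.

Definition weyl_ideal : {pred F} := fun u =>
  `[< exists s : seq (F * F),
        u = \sum_(ab <- s) ab.1 * weyl_rel * ab.2 >].

Fact weyl_ideal_zmod_closed : zmod_closed weyl_ideal.
Proof.
split=> [|u v]; first by apply/asboolP; exists [::]; rewrite big_nil.
move=> /asboolP[s ->] /asboolP[t ->]; apply/asboolP.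
exists (s ++ [seq (- ab.1, ab.2) | ab <- t]).
rewrite big_cat big_map -sumrN; congr (_ + _); apply: eq_bigr => ab _ /=.
by rewrite !mulNr.
Qed.

HB.instance Definition _ :=
  GRing.isZmodClosed.Build F weyl_ideal weyl_ideal_zmod_closed.

Fact weyl_idealMl u v : v \in weyl_ideal -> u * v \in weyl_ideal.
Proof.
move=> /asboolP[s ->]; apply/asboolP; exists [seq (u * ab.1, ab.2) | ab <- s].
by rewrite big_map mulr_sumr; apply: eq_bigr => ab _; rewrite !mulrA.
Qed.

Fact weyl_idealMr u v : u \in weyl_ideal -> u * v \in weyl_ideal.
Proof.
move=> /asboolP[s ->]; apply/asboolP; exists [seq (ab.1, ab.2 * v) | ab <- s].
by rewrite big_map mulr_suml; apply: eq_bigr => ab _; rewrite !mulrA.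
Qed.

(* [weyl_ideal] is proper: [free_p] and [free_q] act on polynomials as
   differentiation and multiplication by ['X], and the ideal acts as zero. *)
Definition word_act (w : {fmonom bool}) (f : {poly K}) : {poly K} :=
  foldr (fun (b : bool) h => if b then h^`() else 'X * h) f w.

Definition free_act (u : F) (f : {poly K}) : {poly K} :=
  mmap polyC (fun w => word_act w f) u.

Fact word_act_is_linear w : linear (word_act w).
Proof.
rewrite /word_act => a f h; elim: (w : seq bool) => //= b s ->.
by case: b; rewrite ?derivD ?derivZ // mulrDr -scalerAr.
Qed.

HB.instance Definition _ w :=
  GRing.isLinear.Build K {poly K} {poly K} _ (word_act w)
    (word_act_is_linear w).

Fact free_actB u v f : free_act (u - v) f = free_act u f - free_act v f.
Proof. exact: (raddfB (mmap polyC (fun w => word_act w f))). Qed.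

Fact free_actE u f :
  free_act u f = \sum_(k <- msupp u) u@_k *: word_act k f.
Proof.
by rewrite /free_act mmapE; apply: eq_bigr => k _; rewrite mul_polyC.
Qed.

Fact free_actU c w f : free_act << c *g w >> f = c *: word_act w f.
Proof. by rewrite /free_act mmapU mul_polyC. Qed.

Fact free_actM u v f : free_act (u * v) f = free_act u (free_act v f).
Proof.
rewrite malgME {1}/free_act raddf_sum [RHS]free_actE; apply: eq_bigr => k _.
rewrite raddf_sum (free_actE v).
rewrite linear_sum scaler_sumr; apply: eq_bigr => l _; rewrite linearZ scalerA. rewrite /= -/(free_act _ _) free_actU.
by rewrite /word_act fmM foldr_cat.
Qed.

Fact free_act1 f : free_act 1 f = f.
Proof. by rewrite /free_act mmapU mul1r /word_act fm1. Qed.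

Fact free_act_rel f : free_act weyl_rel f = 0.
Proof.
rewrite !free_actB !free_actM free_act1 !free_actU /word_act !fmU /=.
by rewrite !scale1r derivM derivX mul1r addrK subrr.
Qed.

Fact free_act0 f : free_act 0 f = 0.
Proof. exact: (raddf0 (mmap polyC (fun w => word_act w f))). Qed.

Fact free_actr0 u : free_act u 0 = 0.
Proof.
by rewrite free_actE big1 // => k _; rewrite linear0 scaler0.
Qed.

Fact free_act_ideal u f : u \in weyl_ideal -> free_act u f = 0.
Proof.
move=> /asboolP[s ->].
rewrite /free_act raddf_sum big1 //= => ab _.
by rewrite -/(free_act _ _) !free_actM free_act_rel free_actr0.
Qed.

Fact weyl_ideal_proper : 1 \notin weyl_ideal.
Proof.
apply/negP => /(free_act_ideal 1); rewrite free_act1.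
by apply/eqP; rewrite oner_eq0.
Qed.

Definition weyl : Type := Quotient.quot weyl_ideal.

HB.instance Definition _ := GRing.Zmodule.on weyl.
HB.instance Definition _ := EqQuotient.on weyl.

Definition weyl_one : weyl := lift_cst weyl 1.
Definition weyl_mul : weyl -> weyl -> weyl := lift_op2 weyl *%R.
Definition weyl_scale (a : K) : weyl -> weyl :=
  lift_op1 weyl (fun u : F => a *: u).

Canonical pi_weyl_one_morph := PiConst weyl_one.

Fact weyl_eqP (u v : F) :
  reflect (u = v %[mod weyl]) (u - v \in weyl_ideal).
Proof. exact: (@eqmodP _ (Quotient.equiv_equiv weyl_ideal)). Qed.

Fact pi_weyl_mul : {morph \pi_weyl : u v / u * v >-> weyl_mul u v}.
Proof.
move=> u v; unlock weyl_mul; apply/weyl_eqP.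
set u' := repr _; set v' := repr _.
have hu : u - u' \in weyl_ideal by apply/weyl_eqP; rewrite reprK.
have hv : v - v' \in weyl_ideal by apply/weyl_eqP; rewrite reprK.
rewrite -[u * v](subrK (u' * v)) -mulrBl -addrA -mulrBr.
by apply: rpredD; [exact: weyl_idealMr | exact: weyl_idealMl].
Qed.
Canonical pi_weyl_mul_morph := PiMorph2 pi_weyl_mul.

Fact pi_weyl_scale a : {morph \pi_weyl : u / a *: u >-> weyl_scale a u}.
Proof.
move=> u; unlock weyl_scale; apply/weyl_eqP.
rewrite -scalerBr -[X in _ *: X]mul1r scalerAl; apply: weyl_idealMl.
by apply/weyl_eqP; rewrite reprK.
Qed.
Canonical pi_weyl_scale_morph a := PiMorph1 (pi_weyl_scale a).

Fact weyl_mulA : associative weyl_mul.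
Proof.
move=> x y z; rewrite -[x]reprK -[y]reprK -[z]reprK.
by rewrite -!pi_weyl_mul mulrA.
Qed.

Fact weyl_mul1l : left_id weyl_one weyl_mul.
Proof. by move=> x; rewrite -[x]reprK !piE mul1r. Qed.

Fact weyl_mul1r : right_id weyl_one weyl_mul.
Proof. by move=> x; rewrite -[x]reprK !piE mulr1. Qed.

Fact weyl_mulDl : left_distributive weyl_mul +%R.
Proof.
by move=> x y z; rewrite -[x]reprK -[y]reprK -[z]reprK !piE mulrDl.
Qed.

Fact weyl_mulDr : right_distributive weyl_mul +%R.
Proof.
by move=> x y z; rewrite -[x]reprK -[y]reprK -[z]reprK !piE mulrDr.
Qed.

Fact weyl_oner_neq0 : weyl_one != 0.
Proof.
by rewrite !piE /Quotient.equiv subr0; exact: weyl_ideal_proper.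
Qed.

HB.instance Definition _ := GRing.Zmodule_isNzRing.Build weyl
  weyl_mulA weyl_mul1l weyl_mul1r weyl_mulDl weyl_mulDr weyl_oner_neq0.

Fact weyl_scaleA a b x : weyl_scale a (weyl_scale b x) = weyl_scale (a * b) x.
Proof. by rewrite -[x]reprK !piE scalerA. Qed.

Fact weyl_scale1 : left_id 1 weyl_scale.
Proof. by move=> x; rewrite -[x]reprK !piE scale1r. Qed.

Fact weyl_scaleDr : right_distributive weyl_scale +%R.
Proof. by move=> a x y; rewrite -[x]reprK -[y]reprK !piE scalerDr. Qed.

Fact weyl_scaleDl x : {morph weyl_scale^~ x : a b / a + b}.
Proof. by move=> a b; rewrite -[x]reprK !piE scalerDl. Qed.

HB.instance Definition _ := GRing.Zmodule_isLmodule.Build K weyl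
  weyl_scaleA weyl_scale1 weyl_scaleDr weyl_scaleDl.

Fact weyl_scaleAl (a : K) (x y : weyl) : a *: (x * y) = (a *: x) * y.
Proof.
rewrite -[x]reprK -[y]reprK.
rewrite -[_ * _]pi_weyl_mul -[a *: _]pi_weyl_scale scalerAl.
by rewrite pi_weyl_mul pi_weyl_scale.
Qed.

HB.instance Definition _ := GRing.Lmodule_isLalgebra.Build K weyl
  weyl_scaleAl.

Fact free_scalerAr (a : K) (u v : F) : a *: (u * v) = u * (a *: v).
Proof.
rewrite -[in LHS]mul_malgC -[in RHS]mul_malgC !mulrA; congr (_ * v).
rewrite !malgM_def fgmulgU fgmulUg; apply: eq_bigr => k _.
by rewrite mul1m mulm1 mulrC.
Qed.

Fact weyl_scaleAr (a : K) (x y : weyl) : a *: (x * y) = x * (a *: y).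
Proof.
rewrite -[x]reprK -[y]reprK.
rewrite -[_ * _]pi_weyl_mul -[a *: _]pi_weyl_scale free_scalerAr.
by rewrite pi_weyl_mul pi_weyl_scale.
Qed.

HB.instance Definition _ := GRing.Lalgebra_isAlgebra.Build K weyl
  weyl_scaleAr.

Definition weyl_p : weyl := \pi_weyl free_p.
Definition weyl_q : weyl := \pi_weyl free_q.

Lemma weyl_pq : weyl_p * weyl_q - weyl_q * weyl_p = 1.
Proof.
apply/eqP; rewrite -subr_eq0; apply/eqP.
rewrite -[_ * weyl_q]pi_weyl_mul -[_ * weyl_p]pi_weyl_mul.
rewrite -[1]/(weyl_one) -[0]/(0 : weyl) !piE.
apply/weyl_eqP; rewrite subr0; apply/asboolP; exists [:: (1, 1)].
by rewrite big_seq1 mul1r mulr1.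
Qed.
End Weyl.

Section SpecialLinear.
Variable K : fieldType.

Definition traceless : {pred 'M[K]_2} := fun A => \tr A == 0.

Fact traceless_submod_closed : submod_closed traceless.
Proof.
split=> [|a A B]; first by rewrite unfold_in mxtrace0.
by rewrite !unfold_in mxtraceD mxtraceZ => /eqP-> /eqP->; rewrite mulr0 addr0.
Qed.

HB.instance Definition _ :=
  GRing.isSubmodClosed.Build K 'M[K]_2 traceless traceless_submod_closed.

Record sl2 : Type := Sl2 { sl2_mx :> 'M[K]_2; _ : sl2_mx \in traceless }.

HB.instance Definition _ := [isSub for sl2_mx].
HB.instance Definition _ := [Choice of sl2 by <:].
HB.instance Definition _ := [SubChoice_isSubLmodule of sl2 by <:].

Fact sl2_lie_subproof (A B : sl2) : A *m B - B *m A \in traceless.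
Proof. by rewrite unfold_in raddfB /= mxtrace_mulC subrr. Qed.

Definition sl2_lie (A B : sl2) : sl2 := Sl2 (sl2_lie_subproof A B).

Fact sl2_linearl (a : K) x y z :
  sl2_lie (a *: x + y) z = a *: sl2_lie x z + sl2_lie y z.
Proof. apply: val_inj; exact: (@commutator_linearl K 'M[K]_2). Qed.

Fact sl2_linearr (a : K) x y z :
  sl2_lie x (a *: y + z) = a *: sl2_lie x y + sl2_lie x z.
Proof. apply: val_inj; exact: (@commutator_linearr K 'M[K]_2). Qed.

Fact sl2_liexx x : sl2_lie x x = 0.
Proof. apply: val_inj; exact: (@commutatorxx K 'M[K]_2). Qed.

Fact sl2_jacobi x y z :
  sl2_lie x (sl2_lie y z) + sl2_lie y (sl2_lie z x)
  + sl2_lie z (sl2_lie x y) = 0.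
Proof. apply: val_inj; exact: (@commutator_jacobi K 'M[K]_2). Qed.

HB.instance Definition _ := Lmodule_isLie.Build K sl2
  sl2_linearl sl2_linearr sl2_liexx sl2_jacobi.
End SpecialLinear.

Definition abelian_lie (K : fieldType) (V : lmodType K) : Type := V.

Section AbelianLie.
Variables (K : fieldType) (V : lmodType K).
HB.instance Definition _ := GRing.Lmodule.on (abelian_lie V).

Definition zero_lie (x y : abelian_lie V) : abelian_lie V := 0.

Fact zero_lie_linearl (a : K) x y z :
  zero_lie (a *: x + y) z = a *: zero_lie x z + zero_lie y z.
Proof. by rewrite /zero_lie scaler0 addr0. Qed.

Fact zero_lie_linearr (a : K) x y z :
  zero_lie x (a *: y + z) = a *: zero_lie x y + zero_lie x z.
Proof. by rewrite /zero_lie scaler0 addr0. Qed.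

Fact zero_liexx x : zero_lie x x = 0.
Proof. by []. Qed.

Fact zero_lie_jacobi x y z :
  zero_lie x (zero_lie y z) + zero_lie y (zero_lie z x)
  + zero_lie z (zero_lie x y) = 0.
Proof. by rewrite /zero_lie !addr0. Qed.

HB.instance Definition _ := Lmodule_isLie.Build K (abelian_lie V)
  zero_lie_linearl zero_lie_linearr zero_liexx zero_lie_jacobi.
End AbelianLie.

Section LieTheory.
Variables (K : fieldType) (g : lieAlgType K).
Implicit Types x y z : g.

Lemma lieDl x y z : lie (x + y) z = lie x z + lie y z.
Proof. by rewrite -[x]scale1r lie_linearl !scale1r. Qed.

Lemma lieDr x y z : lie x (y + z) = lie x y + lie x z.
Proof. by rewrite -[y]scale1r lie_linearr !scale1r. Qed.

Lemma lie0l y : lie 0 y = 0 :> g.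
Proof. by apply: (addrI (lie 0 y)); rewrite -lieDl !addr0. Qed.

Lemma lie0r x : lie x 0 = 0 :> g.
Proof. by apply: (addrI (lie x 0)); rewrite -lieDr !addr0. Qed.

Lemma lieZl (a : K) x y : lie (a *: x) y = a *: lie x y.
Proof. by rewrite -[a *: x]addr0 lie_linearl lie0l addr0. Qed.

Lemma lieZr (a : K) x y : lie x (a *: y) = a *: lie x y.
Proof. by rewrite -[a *: y]addr0 lie_linearr lie0r addr0. Qed.

Lemma lieNl x y : lie (- x) y = - lie x y.
Proof. by rewrite -!scaleN1r lieZl. Qed.

Lemma lieNr x y : lie x (- y) = - lie x y.
Proof. by rewrite -!scaleN1r lieZr. Qed.

Lemma lieC x y : lie x y = - lie y x.
Proof.
apply/eqP; rewrite -addr_eq0; apply/eqP.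
by have := liexx (x + y); rewrite lieDl !lieDr !liexx add0r addr0.
Qed.
End LieTheory.

Record lie_action (K : fieldType) (g h : lieAlgType K) := LieAction {
  act :> g -> h -> h;
  act_linearl : forall (a : K) x y u,
    act (a *: x + y) u = a *: act x u + act y u;
  act_linearr : forall (a : K) x u v,
    act x (a *: u + v) = a *: act x u + act x v;
  act_lie : forall x y u,
    act (lie x y) u = act x (act y u) - act y (act x u);
  act_derivation : forall x u v,
    act x (lie u v) = lie (act x u) v + lie u (act x v)
}.

Definition semidirect (K : fieldType) (g h : lieAlgType K)
  (rho : lie_action g h) : Type := (g * h)%type.

Section Semidirect.
Variables (K : fieldType) (g h : lieAlgType K) (rho : lie_action g h).
HB.instance Definition _ := GRing.Lmodule.on (semidirect rho).

Definition semidirect_lie (s t : semidirect rho) : semidirect rho :=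
  (lie s.1 t.1, lie s.2 t.2 + rho s.1 t.2 - rho t.1 s.2).

Fact semidirect_linearl (a : K) x y z :
  semidirect_lie (a *: x + y) z =
  a *: semidirect_lie x z + semidirect_lie y z.
Proof.
congr (_, _) => /=; first by rewrite lie_linearl.
rewrite lie_linearl act_linearl act_linearr !scalerDr scalerN opprD.
by rewrite [in RHS]addrACA (addrACA _ _ (a *: _)).
Qed.

Fact semidirect_linearr (a : K) x y z :
  semidirect_lie x (a *: y + z) =
  a *: semidirect_lie x y + semidirect_lie x z.
Proof.
congr (_, _) => /=; first by rewrite lie_linearr.
rewrite lie_linearr act_linearl act_linearr !scalerDr scalerN opprD.
by rewrite [in RHS]addrACA (addrACA _ _ (a *: _)).
Qed.

Fact semidirectxx x : semidirect_lie x x = 0.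
Proof. by congr (_, _); rewrite !liexx // add0r subrr. Qed.

Fact semidirect_jacobi x y z :
  semidirect_lie x (semidirect_lie y z) + semidirect_lie y (semidirect_lie z x)
  + semidirect_lie z (semidirect_lie x y) = 0.
Proof.
case: x y z => [x u] [y v] [z w].
congr (_, _) => /=; first exact: lie_jacobi.
have actD t a b : rho t (a + b) = rho t a + rho t b.
  by rewrite -[a]scale1r act_linearr !scale1r.
have actN t a : rho t (- a) = - rho t a.
  have a0 : rho t 0 = 0 by apply: (addrI (rho t 0)); rewrite -actD !addr0.
  by rewrite -scaleN1r -[-1 *: a]addr0 act_linearr a0 addr0 scaleN1r.
rewrite !(actD, actN, lieDr, lieNr, act_lie, act_derivation) !opprB.
rewrite [lie (rho x v) w]lieC [lie (rho y w) u]lieC [lie (rho z u) v]lieC.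
rewrite (AC (((3*4)*2)*((3*4)*2)*((3*4)*2))
  ((1*10*19)*(2*13)*(3*23)*(4*20)*(5*12)*(6*27)*(7*17)*(8*25)*(9*15)
   *(11*22)*(14*21)*(16*26)*(18*24)))%AC.
by rewrite /= lie_jacobi !(subrr, addNr) !addr0.
Qed.

HB.instance Definition _ := Lmodule_isLie.Build K (semidirect rho)
  semidirect_linearl semidirect_linearr semidirectxx semidirect_jacobi.
End Semidirect.

Definition direct_product (K : fieldType) (g h : lieAlgType K) : Type :=
  (g * h)%type.

Section DirectProduct.
Variables (K : fieldType) (g h : lieAlgType K).
HB.instance Definition _ := GRing.Lmodule.on (direct_product g h).

Definition direct_lie (s t : direct_product g h) : direct_product g h :=
  (lie s.1 t.1, lie s.2 t.2).

Fact direct_linearl (a : K) x y z :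
  direct_lie (a *: x + y) z = a *: direct_lie x z + direct_lie y z.
Proof. by congr (_, _); rewrite /= lie_linearl. Qed.

Fact direct_linearr (a : K) x y z :
  direct_lie x (a *: y + z) = a *: direct_lie x y + direct_lie x z.
Proof. by congr (_, _); rewrite /= lie_linearr. Qed.

Fact directxx x : direct_lie x x = 0.
Proof. by congr (_, _); rewrite liexx. Qed.

Fact direct_jacobi x y z :
  direct_lie x (direct_lie y z) + direct_lie y (direct_lie z x)
  + direct_lie z (direct_lie x y) = 0.
Proof. by congr (_, _); apply: lie_jacobi. Qed.

HB.instance Definition _ := Lmodule_isLie.Build K (direct_product g h)
  direct_linearl direct_linearr directxx direct_jacobi.
End DirectProduct.

Section LieOfRelations.
Variables (K : fieldType) (I : finType).
Local Notation V := {ffun I -> K^o}.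

Definition bvec (i : I) : V := [ffun j => (j == i)%:R].

(* The alternating bilinear bracket on the space with basis [bvec i] given by
   a list of relations [bvec i, bvec j] = [r i j], in which each unordered pair
   {i, j} is listed at most once: unlisted pairs have [r i j = 0], and
   antisymmetry is built in. *)
Definition rel_lie (r : I -> I -> V) (x y : V) : V :=
  \sum_i \sum_j (x i * y j) *: (r i j - r j i).

Fact rel_lie_linearl r (a : K) x y z :
  rel_lie r (a *: x + y) z = a *: rel_lie r x z + rel_lie r y z.
Proof.
rewrite /rel_lie scaler_sumr -big_split; apply: eq_bigr => i _ /=.
rewrite scaler_sumr -big_split; apply: eq_bigr => j _ /=.
by rewrite !ffunE scalerA -scalerDl mulrDl mulrA.
Qed.

Fact rel_lieC r x y : rel_lie r x y = - rel_lie r y x.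
Proof.
rewrite /rel_lie exchange_big -sumrN; apply: eq_bigr => i _ /=.
rewrite -sumrN; apply: eq_bigr => j _ /=.
by rewrite mulrC -scalerN opprB.
Qed.

Fact rel_lie_linearr r (a : K) x y z :
  rel_lie r x (a *: y + z) = a *: rel_lie r x y + rel_lie r x z.
Proof.
by rewrite rel_lieC rel_lie_linearl opprD -scalerN -!(rel_lieC r x).
Qed.

Fact rel_lie_bvec r i j : rel_lie r (bvec i) (bvec j) = r i j - r j i.
Proof.
rewrite /rel_lie (bigD1 i) //= (bigD1 j) //= !ffunE !eqxx mulr1 scale1r.
rewrite [X in _ + X + _]big1 => [|l lj]; last first.
  by rewrite !ffunE (negPf lj) mulr0 scale0r.
rewrite [X in _ + X]big1 => [|k ki]; last first.
  by rewrite big1 // => l _; rewrite !ffunE (negPf ki) mul0r scale0r.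
by rewrite !addr0.
Qed.

Fact rel_liexx r x : rel_lie r x x = 0.
Proof.
rewrite /rel_lie.
under eq_bigr => i _ do under eq_bigr => j _ do rewrite scalerBr.
under eq_bigr => i _ do rewrite sumrB.
rewrite sumrB [X in _ - X]exchange_big /=.
apply/eqP; rewrite subr_eq0; apply/eqP.
by do 2!apply: eq_bigr => ? _; rewrite mulrC.
Qed.

Definition jacobiator r (x y z : V) : V :=
  rel_lie r x (rel_lie r y z) + rel_lie r y (rel_lie r z x)
  + rel_lie r z (rel_lie r x y).

Record lie_relations := LieRelations {
  rels :> I -> I -> V;
  rels_jacobi : forall i j k, jacobiator rels (bvec i) (bvec j) (bvec k) = 0
}.

Fact jacobiator_linearl r (a : K) x x' y z :
  jacobiator r (a *: x + x') y z = a *: jacobiator r x y z + jacobiator r x' y z.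
Proof.
rewrite /jacobiator !(rel_lie_linearl, rel_lie_linearr) !scalerDr.
by rewrite (AC (2*2*2) ((1*3*5)*(2*4*6)))%AC.
Qed.

Fact jacobiator_rot r x y z : jacobiator r x y z = jacobiator r y z x.
Proof. by rewrite /jacobiator -addrA addrC. Qed.

Fact bvec_sum (x : V) : x = \sum_i x i *: bvec i.
Proof.
apply/ffunP => j; rewrite sum_ffunE (bigD1 j) //= !ffunE eqxx.
rewrite big1 => [|i ij]; last by rewrite !ffunE eq_sym (negPf ij) scaler0.
by rewrite addr0 [RHS]mulr1.
Qed.

Fact jacobiator_eq0l r y z :
  (forall i, jacobiator r (bvec i) y z = 0) -> forall x, jacobiator r x y z = 0.
Proof.
move=> h x; rewrite [x]bvec_sum.
apply: (big_ind (fun x => jacobiator r x y z = 0)) => [|u v hu hv|i _].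
- by have := jacobiator_linearl r (-1) 0 0 y z;
    rewrite scaler0 addr0 scaleN1r addNr.
- by rewrite -[u]scale1r jacobiator_linearl hu hv scaler0 addr0.
have h0 : jacobiator r 0 y z = 0.
  by have := jacobiator_linearl r (-1) 0 0 y z;
    rewrite scaler0 addr0 scaleN1r addNr.
by rewrite -[_ *: _]addr0 jacobiator_linearl h h0 scaler0 addr0.
Qed.

Definition lie_of (r : lie_relations) : Type := V.

Variable r : lie_relations.
HB.instance Definition _ := GRing.Lmodule.on (lie_of r).

Fact rel_lie_jacobi (x y z : V) : jacobiator r x y z = 0.
Proof.
apply: jacobiator_eq0l => i; rewrite jacobiator_rot.
apply: jacobiator_eq0l => j; rewrite jacobiator_rot.
by apply: jacobiator_eq0l => k; rewrite jacobiator_rot; apply: rels_jacobi.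
Qed.

HB.instance Definition _ := Lmodule_isLie.Build K (lie_of r)
  (rel_lie_linearl r) (rel_lie_linearr r) (rel_liexx r) rel_lie_jacobi.
End LieOfRelations.

Section RelLieTheory.
Variables (K : fieldType) (I : finType) (r : I -> I -> {ffun I -> K^o}).

Fact rel_lie0r x : rel_lie r x 0 = 0.
Proof.
by have := rel_lie_linearr r (-1) x 0 0; rewrite scaler0 addr0 scaleN1r addNr.
Qed.

Fact rel_lieZr (a : K) x y : rel_lie r x (a *: y) = a *: rel_lie r x y.
Proof. by rewrite -[a *: y]addr0 rel_lie_linearr rel_lie0r addr0. Qed.

Fact rel_lieNr x y : rel_lie r x (- y) = - rel_lie r x y.
Proof. by rewrite -scaleN1r rel_lieZr scaleN1r. Qed.

Fact rel_lieBr x y z : rel_lie r x (y - z) = rel_lie r x y - rel_lie r x z.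
Proof. by rewrite addrC -scaleN1r rel_lie_linearr scaleN1r addrC. Qed.
End RelLieTheory.

Section Models.
Variable K : fieldType.

(* Basis: P = bvec 0, Q = bvec 1, C = bvec 2. *)
Definition heis_rels (i j : 'I_3) : {ffun 'I_3 -> K^o} :=
  if (i == 0) && (j == 1) then bvec K 2%:R else 0.

Fact heis_jacobi i j k :
  jacobiator heis_rels (bvec K i) (bvec K j) (bvec K k) = 0.
Proof.
have h2 (a b c : 'I_3) : rel_lie heis_rels (bvec K a) (heis_rels b c) = 0.
  rewrite /heis_rels; case: ifP => _; last exact: rel_lie0r.
  by rewrite rel_lie_bvec /heis_rels /= andbF subrr.
by rewrite /jacobiator !rel_lie_bvec !rel_lieBr !h2 !(subrr, addr0).
Qed.

Definition heisenberg : lieAlgType K := lie_of (LieRelations heis_jacobi).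

(* Basis: X_k = bvec k for 0 <= k <= n. *)
Definition L_rels (n : nat) (i j : 'I_n.+1) : {ffun 'I_n.+1 -> K^o} :=
  if (i == 0%N :> nat) && (1 <= j < n)%N then bvec K (inord j.+1) else 0.

Fact L_rels_double n (i j k : 'I_n.+1) :
  rel_lie (@L_rels n) (bvec K i) (@L_rels n j k) =
  if (i == 0%N :> nat) && (j == 0%N :> nat) && (1 <= k)%N && (k.+1 < n)%N
  then bvec K (inord k.+2) else 0.
Proof.
rewrite {2}/L_rels; case: (j == 0%N :> nat) => /=; last first.
  by rewrite rel_lie0r andbF.
rewrite andbT; case: ifP => [/andP[k0 kn]|/negP kn]; last first.
  rewrite rel_lie0r; case: ifP => // /andP[/andP[_ k0] kn'].
  by case: kn; rewrite k0 ltnW.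
by rewrite rel_lie_bvec /L_rels inordK //= subr0 k0 andbT.
Qed.

Fact L_jacobi n i j k :
  jacobiator (@L_rels n) (bvec K i) (bvec K j) (bvec K k) = 0.
Proof.
rewrite /jacobiator !rel_lie_bvec !rel_lieBr !L_rels_double.
case: (i == 0%N :> nat) / eqP => [->|_];
  case: (j == 0%N :> nat) / eqP => [->|_];
  case: (k == 0%N :> nat) / eqP => [->|_] //=;
  rewrite ?(subr0, sub0r, addr0, add0r, subrr, addNr) //.
Qed.

Definition calL (n : nat) : lieAlgType K := lie_of (LieRelations (@L_jacobi n)).

(* Basis: h = bvec None, X_k = bvec (Some k) for 0 <= k <= n. *)
Definition Lt_rels (n : nat) (a b : option 'I_n.+1) :
    {ffun option 'I_n.+1 -> K^o} :=
  match a, b with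
  | None, Some k =>
      if k == 0%N :> nat then bvec K (Some k)
      else - ((n - k)%:R *: bvec K (Some k))
  | Some i, Some k =>
      if (i == 0%N :> nat) && (1 <= k < n)%N
      then bvec K (Some (inord k.+1)) else 0
  | _, None => 0
  end.

Let wt n (k : 'I_n.+1) : K := if k == 0%N :> nat then 1 else - (n - k)%:R.

Fact Lt_relsN n (k : 'I_n.+1) :
  Lt_rels None (Some k) = wt k *: bvec K (Some k).
Proof. by rewrite /wt /=; case: ifP; rewrite ?scale1r ?scaleNr. Qed.

Fact Lt_double n (i j k : 'I_n.+1) :
  rel_lie (@Lt_rels n) (bvec K (Some i)) (Lt_rels (Some j) (Some k)) =
  if (i == 0%N :> nat) && (j == 0%N :> nat) && (1 <= k)%N && (k.+1 < n)%N
  then bvec K (Some (inord k.+2)) else 0.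
Proof.
rewrite [Lt_rels (Some j) _]/=; case: (j == 0%N :> nat) => /=; last first.
  by rewrite rel_lie0r andbF.
rewrite andbT; case: ifP => [/andP[k0 kn]|/negP kn]; last first.
  rewrite rel_lie0r; case: ifP => // /andP[/andP[_ k0] kn'].
  by case: kn; rewrite k0 ltnW.
by rewrite rel_lie_bvec /Lt_rels inordK //= subr0 k0 andbT.
Qed.

Fact Lt_wt n (i j : 'I_n.+1) :
  rel_lie (@Lt_rels n) (bvec K None) (Lt_rels (Some i) (Some j)) =
  (wt i + wt j) *: Lt_rels (Some i) (Some j).
Proof.
rewrite [Lt_rels (Some i) _]/=; case: ifP => [/and3P[i0 j0 jn]|_]; last first.
  by rewrite rel_lie0r scaler0.
rewrite rel_lie_bvec [Lt_rels (Some _) None]/= subr0 Lt_relsN; congr (_ *: _).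
rewrite /wt inordK ?ltnS // i0 /= eqn0Ngt j0 /=.
by rewrite -(subnSK jn) -natr1 opprD addrC subrK.
Qed.

Fact Lt_jacobi n i j k :
  jacobiator (@Lt_rels n) (bvec K i) (bvec K j) (bvec K k) = 0.
Proof.
have N0 a : @Lt_rels n a None = 0 by case: a.
have SN a b : rel_lie (@Lt_rels n) (bvec K (Some a)) (Lt_rels None (Some b))
   = wt b *: (Lt_rels (Some a) (Some b) - Lt_rels (Some b) (Some a)).
  by rewrite Lt_relsN rel_lieZr rel_lie_bvec.
have NN b : rel_lie (@Lt_rels n) (bvec K None) (Lt_rels None (Some b))
   = wt b *: Lt_rels None (Some b).
  by rewrite Lt_relsN rel_lieZr rel_lie_bvec N0 subr0 Lt_relsN.
have NSS a b : jacobiator (@Lt_rels n) (bvec K None) (bvec K (Some a))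
    (bvec K (Some b)) = 0.
  rewrite /jacobiator !rel_lie_bvec !N0 ?(subr0, sub0r) rel_lieBr rel_lieNr.
  rewrite !Lt_wt !SN -[Lt_rels (Some b) _ - _]opprB scalerN.
  rewrite [wt b + _]addrC -scalerBr scalerDl -addrA.
  by rewrite (AC (2*2) ((1*4)*(2*3)))%AC /= !addrN addr0.
have NNS b : jacobiator (@Lt_rels n) (bvec K None) (bvec K None)
    (bvec K (Some b)) = 0.
  rewrite /jacobiator !rel_lie_bvec !N0 ?(subr0, sub0r) rel_lie0r rel_lieNr.
  by rewrite addr0 subrr.
case: i j k => [i|] [j|] [k|].
- rewrite /jacobiator !rel_lie_bvec !rel_lieBr !Lt_double.
  case: (i == 0%N :> nat) / eqP => [->|_];
    case: (j == 0%N :> nat) / eqP => [->|_];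
    case: (k == 0%N :> nat) / eqP => [->|_] //=;
    by rewrite ?(subr0, sub0r, addr0, add0r, subrr, addNr).
- by rewrite -jacobiator_rot NSS.
- by rewrite jacobiator_rot NSS.
- by rewrite jacobiator_rot NNS.
- exact: NSS.
- by rewrite -jacobiator_rot NNS.
- exact: NNS.
- by rewrite /jacobiator !rel_lie_bvec subrr !rel_lie0r !addr0.
Qed.

Definition calLt (n : nat) : lieAlgType K :=
  lie_of (LieRelations (@Lt_jacobi n)).

(* Basis: h = bvec None, X_(k+1) = bvec (Some k) for 0 <= k < n. *)
Definition r_rels (n : nat) (i : 'I_n -> nat) (a b : option 'I_n) :
    {ffun option 'I_n -> K^o} :=
  match a, b with
  | None, Some k => - ((i k)%:R *: bvec K (Some k))
  | _, _ => 0
  end.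

Fact r_jacobi n (i : 'I_n -> nat) a b c :
  jacobiator (r_rels i) (bvec K a) (bvec K b) (bvec K c) = 0.
Proof.
rewrite /jacobiator.
case: a b c => [a|] [b|] [c|]; rewrite !rel_lie_bvec /= ?(subr0, sub0r, opprK);
  rewrite ?(rel_lie0r, rel_lieNr, rel_lieZr) ?rel_lie_bvec /=;
  rewrite ?(subr0, sub0r, subrr, add0r, addr0, oppr0, scaler0, opprK) //;
  rewrite ?(scalerN, scalerA, opprK) ?(subrr, addNr) //.
all: by rewrite mulrC ?(subrr, addNr).
Qed.

Definition calr (n : nat) (i : 'I_n -> nat) : lieAlgType K :=
  lie_of (LieRelations (r_jacobi i)).

Definition heis_coord (u : heisenberg) : 'I_3 -> K := u : {ffun 'I_3 -> K^o}.

(* The standard representation on <P, Q>, and zero on C. *)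
Definition sl2_heis (A : sl2 K) (u : heisenberg) : heisenberg :=
  (A 0 0 * heis_coord u 0 + A 0 1 * heis_coord u 1) *: bvec K 0 +
  (A 1 0 * heis_coord u 0 + A 1 1 * heis_coord u 1) *: bvec K 1.

Fact heis_coordP u v : heis_coord u =1 heis_coord v -> u = v.
Proof. by move=> uv; apply/ffunP. Qed.

Fact heis_coordD u v k : heis_coord (u + v) k = heis_coord u k + heis_coord v k.
Proof. by rewrite /heis_coord ffunE. Qed.

Fact heis_coordB u v k : heis_coord (u - v) k = heis_coord u k - heis_coord v k.
Proof. by rewrite /heis_coord !ffunE. Qed.

Fact heis_coordZ a u k : heis_coord (a *: u) k = a * heis_coord u k.
Proof. by rewrite /heis_coord ffunE. Qed.

Fact heis_lieE (u v : heisenberg) k : heis_coord (lie u v) k =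
  if k == 2%:R then
    heis_coord u 0 * heis_coord v 1 - heis_coord u 1 * heis_coord v 0
  else 0.
Proof.
have r0 i j : (i, j) != (0, 1) -> heis_rels i j = 0.
  by rewrite /heis_rels xpair_eqE; case: andP.
have lift0 : lift ord0 ord0 = 1 :> 'I_3 by apply: val_inj.
have lift1 : lift ord0 (lift ord0 ord0) = 2%:R :> 'I_3 by apply: val_inj.
rewrite /lie /= /rel_lie /heis_coord !big_ord_recl !big_ord0 !lift0 !lift1.
rewrite -[ord0]/(0 : 'I_3) !(r0 0 0, r0 0 2%:R, r0 1 0, r0 1 1, r0 1 2%:R, r0 2%:R _) //.
rewrite /heis_rels /= !ffunE; case: ifP => _ /=.
  by rewrite /GRing.scale /=; ring.
by rewrite /GRing.scale /=; ring.
Qed.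

Fact sl2_heisE A u k : heis_coord (sl2_heis A u) k =
  if k == 0 then A 0 0 * heis_coord u 0 + A 0 1 * heis_coord u 1
  else if k == 1 then A 1 0 * heis_coord u 0 + A 1 1 * heis_coord u 1 else 0.
Proof.
rewrite {1}/heis_coord /sl2_heis !ffunE /GRing.scale /=.
by case: eqP => [->|_]; [|case: eqP => _] => /=; ring.
Qed.

Fact sl2_tr (A : sl2 K) : A 1 1 = - A 0 0.
Proof.
have /eqP : \tr (sl2_mx A) == 0 by case: A.
rewrite /mxtrace big_ord_recl big_ord1 => /eqP.
have -> : lift ord0 ord0 = 1 :> 'I_2 by apply: val_inj.
by rewrite addrC addr_eq0 => /eqP.
Qed.

Fact sl2_heis_linearl (a : K) x y u :
  sl2_heis (a *: x + y) u = a *: sl2_heis x u + sl2_heis y u.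
Proof.
apply: heis_coordP => k; rewrite [RHS]heis_coordD heis_coordZ !sl2_heisE /= !mxE.
by do 2?case: ifP => _; ring.
Qed.

Fact sl2_heis_linearr (a : K) x u v :
  sl2_heis x (a *: u + v) = a *: sl2_heis x u + sl2_heis x v.
Proof.
apply: heis_coordP => k; rewrite [RHS]heis_coordD heis_coordZ !sl2_heisE.
rewrite !heis_coordD !heis_coordZ.
by do 2?case: ifP => _; ring.
Qed.

Fact sl2_heis_lie x y u :
  sl2_heis (lie x y) u =
  sl2_heis x (sl2_heis y u) - sl2_heis y (sl2_heis x u).
Proof.
apply: heis_coordP => k; rewrite [RHS]heis_coordB !sl2_heisE /= !mxE.
have l1 : lift ord0 ord0 = 1 :> 'I_2 by apply: val_inj.
rewrite !big_ord_recl !big_ord0 l1 -[ord0]/(0 : 'I_2).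
by do 2?case: ifP => _; ring.
Qed.

Fact sl2_heis_derivation x u v :
  sl2_heis x (lie u v) = lie (sl2_heis x u) v + lie u (sl2_heis x v).
Proof.
apply: heis_coordP => k; rewrite [RHS]heis_coordD sl2_heisE !heis_lieE !sl2_heisE /=.
rewrite sl2_tr; case: eqP => [->|_] /=; first by ring.
by do 2?case: ifP => _; ring.
Qed.

Definition sl2_heis_action : lie_action (sl2 K) heisenberg :=
  LieAction sl2_heis_linearl sl2_heis_linearr sl2_heis_lie
    sl2_heis_derivation.

Definition sl2_heisenberg : lieAlgType K := semidirect sl2_heis_action.

Definition sl2_C : lieAlgType K := direct_product (sl2 K) (abelian_lie K^o).

Definition weyl_lie : lieAlgType K := commutator_lie (weyl K).
End Models.

(* Main.v *)
From HB Require Import structures.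
Require Import Defs.
From mathcomp Require Import all_boot all_order all_algebra.
From mathcomp Require Import reals complex boolp.
From mathcomp.finmap Require Import finmap.
From mathcomp.multinomials Require Import monalg.
From mathcomp Require Import zify ring ssrAC.

Set Implicit Arguments.
Unset Strict Implicit.
Unset Printing Implicit Defensive.

Import Order.TTheory GRing.Theory Num.Theory.
Local Open Scope ring_scope.
Local Open Scope quotient_scope.

(** The Weyl algebra A enters through three facts: it has no zero divisors
([weyl_dom]), its units are central ([weyl_unit_central]), and it has
Gelfand-Kirillov dimension two, in the form that the ordered monomials in any
three elements are linearly dependent ([weyl_gk], a count of dimensions). The
last fact is used by exhibiting triples whose monomials would be independent.
This excludes a nonzero eigenvalue of an inner derivation next to a nontrivial
Jordan block ([semisimple_ad]), incommensurable eigenvalues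
([eigenvalues_commensurable]), commuting eigenvectors of the same nonzero weight
that are not proportional ([commuting_eigenvectors]), and a nonscalar element
commuting with u and v when [u, v] is nonzero and commutes with u
([commutes_with_nilpotent_pair]).

Let g be a nonabelian finite-dimensional Lie subalgebra of A. Suppose first that
some [ad x] has a nonzero eigenvalue on g. Then [ad x] is diagonalizable on g and,
after rescaling, has integral eigenvalues ([graded_exists]). Vectors of positive
weight commute with a vector of top weight, hence with each other
([positive_commute]); so every nonzero weight has multiplicity one, and the
vectors of weight zero are combinations of x and 1 ([weight_zero]). If all nonzero
weights have the same sign, g is one of the algebras r(i_1,...,i_n)
([one_sided_classification]). If both signs occur, brackets of vectors of opposite
signs never vanish, since otherwise A would have a noncentral unit
([opposite_bracket_neq0]); so the weights are, up to a scale, the integers from -L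
to M, and the vectors of weight j and -j are the powers p^j and q^j of two elements
p and q ([ladder_exists]). If L or M is at least 2, then [p, q] is a scalar, say 1;
commuting p^3 with q^2 shows that L and M are both 2 when both are at least 2. This
leaves sl(2), its product with the scalars, its semidirect product with the
Heisenberg algebra, and the algebras with basis h, X_0, ..., X_n
([ladder_classification]).

Suppose now that all [ad x] are nilpotent on g. By the theorem of Engel
([engel_full]) g contains the scalars and two elements v, w with [v, w] = 1, where w
is central modulo the scalars ([canonical_pair]). The centralizer of w in g consists
of polynomials in w, by integration along v ([centralizer_polynomial]), so g is
spanned by v and the polynomials in w up to some degree
([nilpotent_classification]).

Conversely the models are realized by q p, by powers of p and q, and by the
quadratic elements together with 1, p, q; the weights of [ad (q p)] show that these
are linearly independent. *)

(** * Shifted inner derivations *)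

Section ShiftedAd.
Variables (K : fieldType) (A : algType K).
Implicit Types (x u v : A) (a b : K).

(** The operator [ad x - a]; the elements killed by one of its powers are the
generalized eigenvectors of [ad x] for [a]. *)
Definition ad_sub x a u : A := x * u - u * x - a *: u.

Fact ad_sub_is_linear x a : linear (ad_sub x a).
Proof.
move=> c u v; rewrite /ad_sub mulrDl mulrDr -scalerAl -scalerAr !scalerDr.
rewrite !scalerN !opprD !scalerA [c * a]mulrC.
by rewrite (AC ((2*2)*2) ((1*3*5)*(2*4*6)))%AC.
Qed.

HB.instance Definition _ x a := GRing.isLinear.Build K A A _ (ad_sub x a) (ad_sub_is_linear x a).

Definition ad_subn x a n u : A := iter n (ad_sub x a) u.

Fact ad_subn_is_linear x a n : linear (ad_subn x a n).
Proof.
by rewrite /ad_subn; elim: n => //= n IH c u v; rewrite IH linearP.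
Qed.

HB.instance Definition _ x a n := GRing.isLinear.Build K A A _ (ad_subn x a n) (ad_subn_is_linear x a n).

Lemma ad_subnS x a n u : ad_subn x a n.+1 u = ad_sub x a (ad_subn x a n u).
Proof. by []. Qed.
Lemma ad_subnSr x a n u : ad_subn x a n.+1 u = ad_subn x a n (ad_sub x a u).
Proof. by rewrite /ad_subn iterSr. Qed.
Lemma ad_subnD x a m n u : ad_subn x a (m + n) u = ad_subn x a m (ad_subn x a n u).
Proof. by rewrite /ad_subn iterD. Qed.

Lemma ad_subn_kill x a m n u : (m <= n)%N -> ad_subn x a m u = 0 -> ad_subn x a n u = 0.
Proof. by move=> /subnK <- h; rewrite ad_subnD h linear0. Qed.

(** As [ad x] is a derivation, eigenvalues add up under products. *)
Lemma ad_subM x a b u v : ad_sub x (a + b) (u * v) = ad_sub x a u * v + u * ad_sub x b v.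
Proof.
rewrite /ad_sub !mulrBl !mulrBr scalerDl -!scalerAl -!scalerAr !mulrA.
by rewrite [RHS]addrACA opprD [X in _ = X + _]addrA subrK.
Qed.

(** The extreme case of the Leibniz formula: every other term applies the
shifted derivation once too often to one of the factors. *)
Lemma ad_subn_topP s x m n a b u v : (m + n = s)%N ->
  ad_subn x a m.+1 u = 0 -> ad_subn x b n.+1 v = 0 ->
  ad_subn x (a + b) s (u * v) = 'C(s, m)%:R *: (ad_subn x a m u * ad_subn x b n v).
Proof.
elim: s m n u v => [|s IH] m n u v.
  by case: m n => [|//] [|//] _ _ _; rewrite bin0 scale1r.
move=> E hu hv; rewrite ad_subnSr ad_subM linearD /=.
case: m E hu => [|m] E hu.
  rewrite add0n in E; rewrite {n}E in hv *.
  rewrite [ad_sub x a u]hu mul0r linear0 add0r bin0 scale1r ad_subnSr.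
  by rewrite (IH 0%N s) ?bin0 ?scale1r -?ad_subnSr.
case: n E hv => [|n] E hv.
  rewrite [ad_sub x b v]hv mulr0 linear0 addr0.
  rewrite addn0 in E; case: E => E; rewrite E in hu *.
  rewrite binn scale1r ad_subnSr.
  by rewrite (IH s 0%N) ?addn0 ?binn ?scale1r -?ad_subnSr.
rewrite (IH m n.+1 (ad_sub x a u) v) // ?(IH m.+1 n u (ad_sub x b v)) -?ad_subnSr //.
- by rewrite -scalerDl -natrD binS addnC.
- by case: E; rewrite -addSnnS.
- by case: E.
Qed.

Lemma ad_subn_top x m n a b u v :
  ad_subn x a m.+1 u = 0 -> ad_subn x b n.+1 v = 0 ->
  ad_subn x (a + b) (m + n) (u * v) = 'C(m + n, m)%:R *: (ad_subn x a m u * ad_subn x b n v).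
Proof. exact: ad_subn_topP. Qed.

Lemma ad_subn_nil x m n a b u v :
  ad_subn x a m.+1 u = 0 -> ad_subn x b n.+1 v = 0 ->
  ad_subn x (a + b) (m + n).+1 (u * v) = 0.
Proof.
by move=> hu hv; rewrite ad_subnS ad_subn_top // linearZ /= ad_subM -!ad_subnS hu hv mul0r mulr0 addr0 scaler0.
Qed.

Lemma ad_sub_comm x u : x * u = u * x -> ad_sub x 0 u = 0.
Proof. by move=> h; rewrite /ad_sub h subrr scale0r subr0. Qed.

Lemma ad_subn_mul_comm x a n u v : x * u = u * x -> ad_subn x a n (u * v) = u * ad_subn x a n v.
Proof.
move=> h; elim: n => //= n IH.
by rewrite -/(ad_subn x a n (u * v)) IH -{1}[a]add0r ad_subM ad_sub_comm // mul0r add0r.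
Qed.

(** A Jordan block [y -> c -> 0] behaves under powers like the variable of a
differentiation: the top iterate on [y ^+ n] is [n! c ^+ n]. *)
Lemma ad_subn_expS x a n y c : ad_sub x a y = c -> ad_sub x a c = 0 ->
  ad_subn x (a *+ n) n (y ^+ n) = n`!%:R *: c ^+ n /\ ad_subn x (a *+ n) n.+1 (y ^+ n) = 0.
Proof.
move=> yc c0.
have y2 : ad_subn x a 2 y = 0 by rewrite /ad_subn /= yc c0.
elim: n => [|n [IH1 IH2]].
  by split; rewrite ?mulr0n ?expr0 ?fact0 ?scale1r // /ad_subn /= ad_sub_comm // mulr1 mul1r.
rewrite exprS mulrS; split; last exact: (ad_subn_nil y2 IH2).
rewrite -add1n (ad_subn_top y2 IH2) IH1 bin1 add1n /ad_subn /= yc -scalerAr scalerA exprS.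
by rewrite factS natrM.
Qed.

Lemma ad_sub_exp_eig x a n y : ad_sub x a y = 0 -> ad_sub x (a *+ n) (y ^+ n) = 0.
Proof.
move=> h; elim: n => [|n IH]; first by rewrite mulr0n ad_sub_comm // mulr1 mul1r.
by rewrite exprS mulrS ad_subM h IH mul0r mulr0 addr0.
Qed.

End ShiftedAd.

Section DerivConst.
Variables (K : numFieldType) (A : algType K).
Implicit Types (u v c : A).

Lemma comm_exp_deriv u v c k : v * u - u * v = c -> c * u = u * c ->
  v * u ^+ k - u ^+ k * v = k%:R *: (u ^+ k.-1 * c).
Proof.
move=> vu cu; elim: k => [|k IH]; first by rewrite expr0 mulr1 mul1r subrr scale0r.
have -> : v * u ^+ k.+1 - u ^+ k.+1 * v = (v * u ^+ k - u ^+ k * v) * u + u ^+ k * (v * u - u * v).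
  by rewrite mulrBl mulrBr exprSr !mulrA addrA subrK.
rewrite IH vu -scalerAl -mulrA cu mulrA -exprSr -natr1 scalerDl scale1r.
by case: k {IH} => [|k] //=; rewrite !scale0r.
Qed.

(** The commutator with [v] acts on polynomials in [u] over its own centralizer
as [c] times the derivative in [u], and in characteristic zero only constants
have derivative zero. *)
Lemma deriv_const n (b : nat -> A) u v c :
    (forall k, v * b k = b k * v) -> v * u - u * v = c -> c * u = u * c ->
    (forall w, w * c = 0 -> w = 0) ->
    v * (\sum_(k < n.+1) b k * u ^+ k) = (\sum_(k < n.+1) b k * u ^+ k) * v ->
  forall k, (k < n)%N -> b k.+1 = 0.
Proof.
move=> bv vu cu creg; elim: n b bv => [//|n IH] b bv comm.
pose b' k := k.+1%:R *: b k.+1.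
have b'0 k : b' k = 0 -> b k.+1 = 0.
  by move/eqP; rewrite scaler_eq0 pnatr_eq0 => /eqP.
have s0 : \sum_(k < n.+1) b' k * u ^+ k = 0.
  apply: creg; rewrite mulr_suml; move/eqP: comm; rewrite -subr_eq0 => /eqP.
  rewrite mulr_sumr mulr_suml -sumrB big_ord_recl /= expr0 !mulr1 bv subrr add0r => s0.
  rewrite -[RHS]s0; apply: eq_bigr => k _.
  rewrite /bump leq0n add1n mulrA bv -!mulrA -mulrBr (comm_exp_deriv _ vu cu) /=.
  by rewrite /b' -scalerAl scalerAr.
have b'v k : v * b' k = b' k * v by rewrite /b' -scalerAl -scalerAr bv.
have bS k : (k < n)%N -> b' k.+1 = 0 by apply: IH => //; rewrite s0 mulr0 mul0r.
case=> [|k] lk; apply: b'0; last exact: bS.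
move: s0; rewrite big_ord_recl expr0 mulr1 big1 ?addr0 // => k _.
by rewrite /= /bump leq0n add1n bS ?mul0r.
Qed.

Lemma deriv_free n (b : nat -> A) u v c :
    (forall k, v * b k = b k * v) -> v * u - u * v = c -> c * u = u * c ->
    (forall w, w * c = 0 -> w = 0) ->
    \sum_(k < n) b k * u ^+ k = 0 ->
  forall k, (k < n)%N -> b k = 0.
Proof.
case: n => // n bv vu cu creg s0.
have bS : forall k, (k < n)%N -> b k.+1 = 0.
  by apply: deriv_const cu creg _ => //; rewrite s0 mulr0 mul0r.
case=> [|k] lk; last exact: bS.
move: s0; rewrite big_ord_recl expr0 mulr1 big1 ?addr0 // => k _.
by rewrite /= /bump leq0n add1n bS ?mul0r.
Qed.

(** The iterate of [ad u] of order equal to the degree kills all lower powers of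
[v] and turns the top one into a multiple of a power of [c]. *)
Lemma ad_free n (b : nat -> A) u v c :
    (forall k, u * b k = b k * u) -> u * v - v * u = c -> c * u = u * c ->
    (forall w k, w * c ^+ k = 0 -> w = 0) ->
    \sum_(k < n) b k * v ^+ k = 0 ->
  forall k, (k < n)%N -> b k = 0.
Proof.
move=> bu uv cu creg; elim: n => // n IH s0.
have bn : b n = 0.
  have hv : ad_sub u 0 v = c by rewrite /ad_sub scale0r subr0.
  have hc : ad_sub u 0 c = 0 by apply: ad_sub_comm.
  have := congr1 (ad_subn u 0 n) s0; rewrite linear0 big_ord_recr linearD linear_sum /=.
  have E k : ad_subn u 0 k (v ^+ k) = k`!%:R *: c ^+ k /\ ad_subn u 0 k.+1 (v ^+ k) = 0.
    by have := ad_subn_expS k hv hc; rewrite mul0rn.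
  rewrite big1 => [|k _]; last first.
    by rewrite ad_subn_mul_comm // (ad_subn_kill (ltn_ord k) (E k).2) mulr0.
  rewrite add0r ad_subn_mul_comm // (E n).1 -scalerAr => /eqP.
  by rewrite scaler_eq0 pnatr_eq0 eqn0Ngt fact_gt0 => /eqP /creg.
move=> k; rewrite ltnS leq_eqVlt => /predU1P[->//|]; apply: IH.
by move: s0; rewrite big_ord_recr /= bn mul0r addr0.
Qed.
End DerivConst.

(** * Monomials in the Weyl algebra *)

Section LinDep.
Variables (K : fieldType) (V : lmodType K).

Lemma linear_dependence (T S : finType) (m : S -> V) (v : T -> V) (C : T -> S -> K) :
    (forall t, v t = \sum_s C t s *: m s) -> (#|S| < #|T|)%N ->
  exists c : T -> K, (exists t, c t != 0) /\ \sum_t c t *: v t = 0.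
Proof.
move=> vE card_lt.
pose M := \matrix_(i < #|T|, j < #|S|) C (enum_val i) (enum_val j).
have /rowV0Pn[r rM r0] : kermx M != 0.
  rewrite -mxrank_eq0 mxrank_ker -lt0n subn_gt0.
  exact: leq_ltn_trans (rank_leq_col M) card_lt.
exists (fun t => r 0 (enum_rank t)); split.
  have /rV0Pn[i ri] := r0; exists (enum_val i); by rewrite enum_valK.
move/sub_kermxP: rM => rM.
under eq_bigr => t _ do rewrite vE scaler_sumr.
rewrite exchange_big /= big1 // => s _.
under eq_bigr => t _ do rewrite scalerA.
rewrite -scaler_suml.
have /(congr1 (fun B : 'M_(1, _) => B 0 (enum_rank s))) := rM.
rewrite !mxE => E; apply/eqP; rewrite scaler_eq0; apply/orP; left; apply/eqP.
rewrite -[RHS]E [RHS](reindex enum_rank) /=; last by apply: onW_bij; exact: enum_rank_bij.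
by apply: eq_bigr => t _; rewrite !mxE !enum_rankK.
Qed.
End LinDep.

Section WeylBasics.
Variable K : fieldType.
Local Notation A := (weyl K).
Local Notation p := (weyl_p K).
Local Notation q := (weyl_q K).

Lemma weyl_pi_word (w : seq bool) (k : {fmonom bool}) : k = w :> seq bool ->
  \pi_(weyl K) (<< k >> : {malg K[{fmonom bool}]}) =
  \prod_(b <- w) (if b then p else q) :> A.
Proof.
elim: w k => [|b w IH] k kw.
  have -> : k = mone by apply: val_inj; rewrite /= kw fm1.
  by rewrite big_nil; transitivity (weyl_one K); first by rewrite !piE.
have -> : k = (mmul (fmu b) (FMonom w)) by apply: val_inj; rewrite /= kw fmM fmU.
rewrite big_cons -(IH (FMonom w)) //.
have -> : << (mmul (fmu b) (FMonom w)) >> = << fmu b >> * << FMonom w >> :> {malg K[{fmonom bool}]}.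
  by rewrite malgM_def fgmulUU mul1r.
rewrite [LHS]pi_weyl_mul; case: b kw => //.
Qed.

(** Left multiplication by [p] and [q] builds every word, and words span the
free algebra, hence its quotient. *)
Lemma weyl_ind (P : A -> Prop) :
    P 1 -> (forall (a : K) u v, P u -> P v -> P (a *: u + v)) ->
    (forall u, P u -> P (p * u)) -> (forall u, P u -> P (q * u)) ->
  forall u, P u.
Proof.
move=> P1 Plin Pp Pq u.
have P0 : P 0 by rewrite -(addNr 1) -scaleN1r; apply: Plin.
have Pw (w : seq bool) : P (\prod_(b <- w) (if b then p else q)).
  elim: w => [|b w IH]; first by rewrite big_nil.
  by rewrite big_cons; case: b; [exact: Pp | exact: Pq].
rewrite -[u]reprK [repr u]monalgE raddf_sum /=.
apply: (big_ind P) => // [x y Px Py|k _]; first by rewrite -[x]scale1r; apply: Plin.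
have -> : << (repr u)@_k *g k >> = (repr u)@_k *: << k >> :> {malg K[{fmonom bool}]}.
  by apply/malgP => j; rewrite mcoeffZ !mcoeffU mulrnAr mulr1.
rewrite [X in P X]pi_weyl_scale (@weyl_pi_word k) //.
by rewrite -[weyl_scale _ _]addr0; apply: Plin.
Qed.

Lemma weyl_pqE : p * q = q * p + 1.
Proof. by rewrite -(weyl_pq K) addrC subrK. Qed.

Lemma weyl_pqX n : p * q ^+ n = q ^+ n * p + n%:R *: q ^+ n.-1.
Proof.
elim: n => [|n IH]; first by rewrite expr0 mulr1 mul1r scale0r addr0.
rewrite exprSr mulrA IH mulrDl -mulrA weyl_pqE mulrDr mulr1 mulrA -addrA; congr (_ + _).
case: n {IH} => [|n]; first by rewrite scale0r mul0r addr0 scale1r.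
by rewrite -scalerAl -exprSr -[X in X + _]scale1r -scalerDl addrC natr1.
Qed.

Definition mono i j : A := q ^+ i * p ^+ j.

Lemma mulq_mono i j : q * mono i j = mono i.+1 j.
Proof. by rewrite /mono mulrA -exprS. Qed.

Lemma mulp_mono i j : p * mono i j = mono i j.+1 + i%:R *: mono i.-1 j.
Proof. by rewrite /mono mulrA weyl_pqX mulrDl -mulrA -exprS -scalerAl. Qed.

(** The filtration by bidegree in [q] and [p]. Its quadratic growth is what
gives the Weyl algebra dimension two. *)
Definition box n (w : A) :=
  exists c : 'I_n * 'I_n -> K, w = \sum_t c t *: mono t.1 t.2.

Lemma box_lin n a u v : box n u -> box n v -> box n (a *: u + v).
Proof.
move=> [c ->] [d ->]; exists (fun t => a * c t + d t).
rewrite scaler_sumr -big_split; apply: eq_bigr => t _ /=.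
by rewrite scalerA scalerDl.
Qed.

Lemma box0 n : box n 0.
Proof. by exists (fun=> 0); rewrite big1 // => t _; rewrite scale0r. Qed.

Lemma boxZ n a u : box n u -> box n (a *: u).
Proof. by move=> hu; rewrite -[_ *: _]addr0; apply: box_lin (box0 n). Qed.

Lemma box_sum n (I : Type) (r : seq I) (P : pred I) F :
  (forall i, P i -> box n (F i)) -> box n (\sum_(i <- r | P i) F i).
Proof.
move=> h; apply: (big_ind (box n)) => //; first exact: box0.
by move=> u v hu hv; rewrite -[u]scale1r; apply: box_lin.
Qed.

Lemma box_mono n i j : (i < n)%N -> (j < n)%N -> box n (mono i j).
Proof.
move=> li lj; exists (fun t => (t == (Ordinal li, Ordinal lj))%:R).
rewrite (bigD1 (Ordinal li, Ordinal lj)) //= eqxx scale1r big1 ?addr0 // => t /negPf->.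
by rewrite scale0r.
Qed.

Lemma box_le m n u : (m <= n)%N -> box m u -> box n u.
Proof.
move=> mn [c ->]; apply: box_sum => t _; apply: boxZ; apply: box_mono; exact: leq_trans mn.
Qed.

Lemma box_mulq n u : box n u -> box n.+1 (q * u).
Proof.
move=> [c ->]; rewrite mulr_sumr; apply: box_sum => t _.
by rewrite -scalerAr mulq_mono; apply: boxZ; apply: box_mono; rewrite ltnS // ltnW.
Qed.

Lemma box_mulp n u : box n u -> box n.+1 (p * u).
Proof.
move=> [c ->]; rewrite mulr_sumr; apply: box_sum => t _.
rewrite -scalerAr mulp_mono; apply: boxZ; rewrite -[X in X + _]scale1r; apply: box_lin.
  by apply: box_mono; rewrite ltnS // ltnW.
apply: boxZ; apply: box_mono; last by rewrite ltnS ltnW.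
by apply: leq_ltn_trans (leq_pred _) _; rewrite ltnS ltnW.
Qed.

Lemma weyl_box u : exists n, box n u.
Proof.
elim/weyl_ind: u => [|a u v [m hu] [n hv]|u [n hu]|u [n hu]].
- by exists 1%N; rewrite -[1]mulr1; apply: (@box_mono 1 0 0).
- exists (maxn m n); apply: box_lin; first exact: box_le (leq_maxl _ _) hu.
  exact: box_le (leq_maxr _ _) hv.
- by exists n.+1; apply: box_mulp.
- by exists n.+1; apply: box_mulq.
Qed.

Lemma box_mulmono n i j u : box n u -> box (n + (i + j)) (mono i j * u).
Proof.
move=> hu; rewrite /mono -mulrA.
have hj : box (n + j) (p ^+ j * u).
  elim: j => [|j IH]; first by rewrite addn0 mul1r.
  by rewrite exprS -mulrA addnS; apply: box_mulp.
rewrite addnA addnAC; elim: i => [|i IH]; first by rewrite addn0 mul1r.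
by rewrite exprS -mulrA addnS; apply: box_mulq.
Qed.

Lemma box_mul m n u v : box m u -> box n v -> box (n + (m + m)) (u * v).
Proof.
move=> [c ->] hv; rewrite mulr_suml; apply: box_sum => t _; rewrite -scalerAl; apply: boxZ.
apply: box_le (box_mulmono _ _ hv); rewrite leq_add2l; apply: leq_add; exact: ltnW.
Qed.

Lemma box_mulX m n k u v : box m u -> box n v -> box (n + k * m.*2) (u ^+ k * v).
Proof.
move=> hu hv; elim: k => [|k IH]; first by rewrite addn0 mul1r.
have -> : (n + k.+1 * m.*2 = n + k * m.*2 + (m + m))%N by rewrite addnn mulSn addnCA addnC.
by rewrite exprS -mulrA; apply: box_mul.
Qed.
End WeylBasics.

(** * Zero divisors, units and growth of the Weyl algebra *)

Definition no_zero_divisors (K : fieldType) (A : algType K) : Prop :=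
  forall u v : A, u * v = 0 -> u = 0 \/ v = 0.

Definition units_central (K : fieldType) (A : algType K) : Prop :=
  forall b c w : A, b * c = 1 -> b * w = w * b.

(** The bound two on the Gelfand-Kirillov dimension, as a relation between the
ordered monomials in three elements; the coefficients are collected into
polynomials in the first element. *)
Definition gk_dim_le2 (K : fieldType) (A : algType K) : Prop :=
  forall x y z : A, exists N (f : 'I_N * 'I_N -> {poly K}),
    (exists t, f t != 0) /\
    \sum_t horner_alg x (f t) * y ^+ t.1 * z ^+ t.2 = 0.

Definition locally_nilpotent_ad (K : fieldType) (A : algType K) (x : A) :=
  forall u, exists n, ad_subn x 0 n u = 0.

Lemma ad_subn_last (K : fieldType) (A : algType K) (x u : A) (a : K) n :
  u != 0 -> ad_subn x a n u = 0 -> exists m, ad_subn x a m u != 0 /\ ad_subn x a m.+1 u = 0.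
Proof.
move=> u0; elim: n => [/eqP|n IH h]; first by rewrite (negPf u0).
by have [/IH//|nz] := eqVneq (ad_subn x a n u) 0; exists n.
Qed.

Section WeylDomain.
Variable K : numFieldType.
Local Notation A := (weyl K).
Local Notation p := (weyl_p K).
Local Notation q := (weyl_q K).

Lemma loc_nilp_p : locally_nilpotent_ad p.
Proof.
have step x u n : ad_subn p 0 2 x = 0 -> ad_subn p 0 n u = 0 -> ad_subn p 0 n.+2 (x * u) = 0.
  move=> x2 hu; rewrite -[0]addr0; apply: (@ad_subn_nil _ _ p 1 n) => //.
  by apply: ad_subn_kill hu.
elim/weyl_ind => [|a u v [m hu] [n hv]|u [n hu]|u [n hu]].
- by exists 1%N; apply: ad_sub_comm; rewrite mulr1 mul1r.
- exists (m + n)%N; rewrite linearP /= (ad_subn_kill (leq_addr n m) hu).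
  by rewrite (ad_subn_kill (leq_addl m n) hv) scaler0 addr0.
- exists n.+2; apply: step => //.
  by rewrite ad_subnSr /ad_subn [X in iter _ _ X]ad_sub_comm //= linear0.
- exists n.+2; apply: step => //; rewrite ad_subnSr.
  have -> : ad_sub p 0 q = 1 by rewrite /ad_sub scale0r subr0 weyl_pq.
  by apply: ad_sub_comm; rewrite mulr1 mul1r.
Qed.

Lemma loc_nilp_q : locally_nilpotent_ad q.
Proof.
have step x u n : ad_subn q 0 2 x = 0 -> ad_subn q 0 n u = 0 -> ad_subn q 0 n.+2 (x * u) = 0.
  move=> x2 hu; rewrite -[0]addr0; apply: (@ad_subn_nil _ _ q 1 n) => //.
  by apply: ad_subn_kill hu.
elim/weyl_ind => [|a u v [m hu] [n hv]|u [n hu]|u [n hu]].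
- by exists 1%N; apply: ad_sub_comm; rewrite mulr1 mul1r.
- exists (m + n)%N; rewrite linearP /= (ad_subn_kill (leq_addr n m) hu).
  by rewrite (ad_subn_kill (leq_addl m n) hv) scaler0 addr0.
- exists n.+2; apply: step => //; rewrite ad_subnSr.
  have -> : ad_sub q 0 p = - 1 by rewrite /ad_sub scale0r subr0 -opprB weyl_pq.
  by apply: ad_sub_comm; rewrite mulrN mulNr mulr1 mul1r.
- exists n.+2; apply: step => //.
  by rewrite ad_subnSr /ad_subn [X in iter _ _ X]ad_sub_comm //= linear0.
Qed.

(** Commuting with [q] excludes the positive powers of [p], as [ad q]
differentiates in [p]; then commuting with [p] excludes the positive powers of
[q]. *)
Lemma weyl_central u : p * u = u * p -> q * u = u * q -> exists c : K, u = c%:A.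
Proof.
have [n [c ->]] := weyl_box u.
case: n c => [c _ _|n c pu qu].
  exists 0; rewrite scale0r big1 // => t _; by case: t => [[]].
pose cc i j : K := if insub i is Some i' then
   if insub j is Some j' then c (i', j') else 0 else 0.
pose b j : A := \sum_(i < n.+1) cc i j *: q ^+ i.
have comm1 (w x : A) : (x * w - w * x = 0) <-> (x * w = w * x).
  by split=> [/eqP|->]; rewrite ?subrr // subr_eq0 => /eqP.
have bE : \sum_t c t *: mono K t.1 t.2 = \sum_(j < n.+1) b j * p ^+ j.
  transitivity (\sum_t c (t.1, t.2) *: mono K t.1 t.2); first by apply: eq_bigr => -[].
  rewrite -(pair_bigA _ (fun i j => c (i, j) *: mono K i j)) exchange_big /=.
  apply: eq_bigr => j _; rewrite /b mulr_suml; apply: eq_bigr => i _.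
  by rewrite /cc !valK -scalerAl.
have bq j : q * b j = b j * q.
  rewrite /b mulr_sumr mulr_suml; apply: eq_bigr => i _.
  by rewrite -scalerAl -scalerAr -exprS -exprSr.
have qp : q * p - p * q = - 1 by rewrite -opprB weyl_pq.
have b0 : \sum_t c t *: mono K t.1 t.2 = b 0%N.
  rewrite bE big_ord_recl expr0 mulr1 big1 ?addr0 // => k _.
  rewrite /= /bump leq0n add1n (deriv_const (n := n) bq qp) ?mul0r //.
  - by rewrite mulrN mulNr mulr1 mul1r.
  - by move=> w; rewrite mulrN mulr1 => /eqP; rewrite oppr_eq0 => /eqP.
  - by rewrite -bE.
rewrite b0 in pu *.
pose b1 i : A := (cc i 0%N)%:A.
have b1E : b 0%N = \sum_(i < n.+1) b1 i * q ^+ i.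
  by apply: eq_bigr => i _; rewrite /b1 -scalerAl mul1r.
exists (cc 0%N 0%N); rewrite b1E big_ord_recl expr0 mulr1 big1 ?addr0 // => k _.
rewrite /= /bump leq0n add1n (@deriv_const _ _ n b1 q p 1) ?mul0r ?mulr1 ?mul1r //.
- by move=> i; rewrite /b1 -scalerAl -scalerAr mulr1 mul1r.
- exact: weyl_pq.
- by move=> w; rewrite mulr1.
- by rewrite -b1E.
Qed.

(** The generators act by locally nilpotent derivations, whose top iterate on a
product is a nonzero multiple of the product of the top iterates. Taking top
iterates for [p] and then for [q] replaces both factors by nonzero scalars. *)
Lemma weyl_dom : no_zero_divisors A.
Proof.
have red (x : A) : locally_nilpotent_ad x -> forall u v : A, u != 0 -> v != 0 -> u * v = 0 ->
   exists m n, [/\ ad_subn x 0 m u != 0, ad_subn x 0 n v != 0,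
     x * ad_subn x 0 m u = ad_subn x 0 m u * x, x * ad_subn x 0 n v = ad_subn x 0 n v * x
     & ad_subn x 0 m u * ad_subn x 0 n v = 0].
  move=> nx u v u0 v0 uv.
  have [m [m0 m1]] := let: ex_intro n h := nx u in ad_subn_last u0 h.
  have [n [n0 n1]] := let: ex_intro n h := nx v in ad_subn_last v0 h.
  have comm w : ad_sub x 0 w = 0 -> x * w = w * x.
    by rewrite /ad_sub scale0r subr0 => /eqP; rewrite subr_eq0 => /eqP.
  exists m, n; split=> //; try exact: comm.
  have := ad_subn_top m1 n1; rewrite uv linear0 => /esym/eqP.
  by rewrite scaler_eq0 pnatr_eq0 eqn0Ngt bin_gt0 leq_addr => /eqP.
have stab n (w : A) : p * w = w * p -> p * ad_subn q 0 n w = ad_subn q 0 n w * p.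
  move=> pw; elim: n => //= n IH; rewrite -/(ad_subn q 0 n w); move: (ad_subn q 0 n w) IH => {pw}w pw.
  have E1 : p * (q * w) = q * w * p + w by rewrite mulrA weyl_pqE mulrDl mul1r -mulrA pw mulrA.
  have E2 : p * (w * q) = w * q * p + w by rewrite mulrA pw -(mulrA w p q) weyl_pqE mulrDr mulr1 mulrA.
  by rewrite /ad_sub scale0r subr0 mulrBr mulrBl E1 E2 opprD addrACA subrr addr0.
move=> u v uv; have [->|u0] := eqVneq u 0; [by left | right].
apply/eqP; apply: contraT => v0.
have [m [n [m0 n0 pm pn E]]] := red p loc_nilp_p u v u0 v0 uv.
have [m' [n' [m0' n0' qm qn]]] := red q loc_nilp_q _ _ m0 n0 E.
have [c cE] := weyl_central (stab m' _ pm) qm.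
have [d dE] := weyl_central (stab n' _ pn) qn.
rewrite cE dE -scalerAl mul1r scalerA in m0' n0' * => /eqP.
rewrite !scaler_eq0 mulf_eq0 oner_eq0 orbF; rewrite !scaler_eq0 !oner_eq0 !orbF in m0' n0'.
by rewrite (negPf m0') (negPf n0').
Qed.

Lemma weyl_neq0M (u v : A) : u != 0 -> v != 0 -> u * v != 0.
Proof.
move=> /eqP u0 /eqP v0; apply/eqP => uv.
by case: (weyl_dom uv) => E; [apply: u0 | apply: v0].
Qed.

(** The order of nilpotency under [ad p], or under [ad q], is additive on
products, so it is zero on a unit: a unit commutes with both generators. *)
Lemma weyl_unit_central : units_central A.
Proof.
move=> b c w bc.
have red (x : A) : locally_nilpotent_ad x -> x * b = b * x.
  move=> nx; have b0 : b != 0.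
    by apply: contraTneq (oner_neq0 A) => b0; rewrite -bc b0 mul0r eqxx.
  have c0 : c != 0.
    by apply: contraTneq (oner_neq0 A) => c0; rewrite -bc c0 mulr0 eqxx.
  have [m [m0 m1]] := let: ex_intro n h := nx b in ad_subn_last b0 h.
  have [n [n0 n1]] := let: ex_intro n h := nx c in ad_subn_last c0 h.
  have := ad_subn_top m1 n1; rewrite bc addr0; case: m m0 m1 => [|m] m0 m1.
    by move: m1 => /eqP; rewrite /ad_subn /= /ad_sub scale0r subr0 subr_eq0 => /eqP.
  have -> : ad_subn x 0 (m.+1 + n) 1 = 0.
    apply: (@ad_subn_kill _ _ x 0 1) => //; apply: ad_sub_comm; by rewrite mulr1 mul1r.
  move/esym/eqP; rewrite scaler_eq0 pnatr_eq0 eqn0Ngt bin_gt0 leq_addr /=.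
  by rewrite (negPf (weyl_neq0M m0 n0)).
have [a ->] := weyl_central (red p loc_nilp_p) (red q loc_nilp_q).
by rewrite -scalerAl -scalerAr mul1r mulr1.
Qed.

Lemma box1 : box 1 (1 : A).
Proof. by rewrite -[1]mulr1; apply: (@box_mono _ 1 0 0). Qed.

Lemma horner_alg_sum (B : algType K) (x : B) n (E : nat -> K) :
  horner_alg x (\poly_(i < n) E i) = \sum_(i < n) E i *: x ^+ i.
Proof.
rewrite poly_def raddf_sum; apply: eq_bigr => i _.
rewrite -mul_polyC /= rmorphM /= horner_algC rmorphXn /= horner_algX.
by rewrite -scalerAl mul1r.
Qed.

(** If the three elements lie in a fixed box, the [N ^ 3] monomials with
exponents below [N] lie in a box of dimension [(N * e) ^ 2], where [e] depends
only on that fixed box. *)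
Lemma weyl_gk : gk_dim_le2 A.
Proof.
move=> x y z.
have [d [dx dy dz]] : exists d, [/\ box d x, box d y & box d z].
  have [a ax] := weyl_box x; have [b byy] := weyl_box y; have [c cz] := weyl_box z.
  exists (a + b + c)%N; split; [move: ax|move: byy|move: cz]; apply: box_le.
  - by rewrite -addnA leq_addr.
  - by rewrite addnAC leq_addl.
  - by rewrite leq_addl.
pose e := (1 + (d.*2 + d.*2 + d.*2))%N.
(* The margin [e * e < N] makes the number [N ^ 3] of monomials exceed the
dimension [(N * e) ^ 2] of the box that contains them. *)
have [N Ne] : exists N, (e * e < N)%N by exists (e * e).+1.
have N0 : (0 < N)%N by apply: leq_ltn_trans Ne.
pose M := (N * e)%N.
pose v (t : 'I_N * 'I_N * 'I_N) := x ^+ t.1.1 * (y ^+ t.1.2 * (z ^+ t.2 * 1)).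
have hv t : box M (v t).
  have := box_mulX t.1.1 dx (box_mulX t.1.2 dy (box_mulX t.2 dz box1)).
  apply: box_le; rewrite /M /e !mulnDr muln1 -!addnA leq_add //.
  by rewrite !leq_add // leq_mul2r (ltnW (ltn_ord _)) orbT.
have [C hC] := choice hv.
have [|c [[[[i j] k] c0] cs]] := linear_dependence hC.
  by rewrite !card_prod !card_ord /M mulnACA ltn_mul2l muln_gt0 N0.
pose f (t : 'I_N * 'I_N) : {poly K} :=
  \poly_(i < N) (if insub i is Some i' then c (i', t.1, t.2) else 0).
exists N, f; split.
  exists (j, k); apply: contraNneq c0 => /(congr1 (fun P : {poly K} => P`_i)) /eqP.
  by rewrite coef_poly ltn_ord valK coef0.
have E t : horner_alg x (f t) * y ^+ t.1 * z ^+ t.2 = \sum_(i < N) c (i, t.1, t.2) *: v (i, t.1, t.2).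
  rewrite horner_alg_sum !mulr_suml; apply: eq_bigr => l _.
  by rewrite valK /v mulr1 -!scalerAl !mulrA.
under eq_bigr => t _ do rewrite E.
rewrite exchange_big pair_bigA /= -[RHS]cs.
rewrite (reindex (fun t : 'I_N * 'I_N * 'I_N => (t.1.1, (t.1.2, t.2)))) /=.
  by apply: eq_bigr => -[[a b] l].
by exists (fun t => (t.1, t.2.1, t.2.2)) => [[[a b] l]|[a [b l]]].
Qed.
End WeylDomain.

(** * Rigidity in dimension two *)

Section Components.
Variables (K : fieldType) (A : algType K).
Implicit Types (x u w : A) (a b : K).

Lemma ad_sub_shift x a b w : ad_sub x b w = ad_sub x a w + (a - b) *: w.
Proof. by rewrite /ad_sub scalerBl addrA subrK. Qed.

Lemma ad_subn_ad_sub_nil x a b n w : ad_subn x a n w = 0 -> ad_subn x a n (ad_sub x b w) = 0.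
Proof.
move=> h; rewrite (ad_sub_shift x a b) linearD linearZ /= h scaler0 addr0.
by rewrite -ad_subnSr ad_subnS h linear0.
Qed.

Lemma ad_subn_ad_subn_nil x a b n m w : ad_subn x a n w = 0 -> ad_subn x a n (ad_subn x b m w) = 0.
Proof. by elim: m => // m IH /IH h; rewrite ad_subnS ad_subn_ad_sub_nil. Qed.

Lemma ad_subn_eig x a b n w : ad_sub x a w = 0 -> ad_subn x b n w = (a - b) ^+ n *: w.
Proof.
move=> h; elim: n => [|n IH]; first by rewrite expr0 scale1r.
by rewrite ad_subnS IH linearZ /= (ad_sub_shift x a b) h add0r scalerA exprSr.
Qed.

Lemma gen_eig_inj x a b n m w : a != b ->
  ad_subn x a n w = 0 -> ad_subn x b m w = 0 -> w = 0.
Proof.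
move=> ab; elim: m w => // m IH w ha hb.
have {IH} h : ad_sub x b w = 0.
  by apply: IH; [exact: ad_subn_ad_sub_nil | rewrite -ad_subnSr].
move: ha; rewrite (ad_subn_eig _ _ h) => /eqP; rewrite scaler_eq0 expf_eq0 subr_eq0.
by rewrite [b == a]eq_sym (negPf ab) andbF => /eqP.
Qed.

Lemma gen_eig_free_seq x n (u : K -> A) rs : uniq rs ->
    (forall r, ad_subn x r n (u r) = 0) -> \sum_(r <- rs) u r = 0 ->
  forall r, r \in rs -> u r = 0.
Proof.
elim: rs u => // r0 rs IH u /= /andP[r0rs urs] hu s0.
have hr r : r \in rs -> u r = 0.
  move=> rrs; have r0r : r0 != r by apply: contraNneq r0rs => ->.
  apply: (gen_eig_inj (n := n) (m := n) r0r) => //.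
  apply: (IH (fun r => ad_subn x r0 n (u r))) => // [r'|]; first exact: ad_subn_ad_subn_nil.
  rewrite -linear_sum /=; move: s0; rewrite big_cons => /eqP; rewrite addrC addr_eq0 => /eqP->.
  by rewrite linearN /= hu oppr0.
move=> r; rewrite inE => /predU1P[->|]; last exact: hr.
by move: s0; rewrite big_cons big_seq big1 ?addr0.
Qed.

(** Generalized eigenvectors for distinct eigenvalues are independent, so a
relation between such vectors splits according to the eigenvalue. *)
Lemma gen_eig_component (I : finType) x n (nu : I -> K) (w : I -> A) :
    (forall t, ad_subn x (nu t) n (w t) = 0) -> \sum_t w t = 0 ->
  forall a, \sum_(t | nu t == a) w t = 0.
Proof.
move=> hw s0 a; pose rs := undup (codom nu).
have nurs t : nu t \in rs by rewrite mem_undup codom_f.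
have [ars|anrs] := boolP (a \in rs); last first.
  by rewrite big1 // => t /eqP ta; rewrite -ta nurs in anrs.
apply: (gen_eig_free_seq (x := x) (n := n) (u := fun r => \sum_(t | nu t == r) w t)
  (undup_uniq (codom nu)) _ _ ars).
  by move=> r; rewrite linear_sum big1 // => t /eqP <-; apply: hw.
rewrite -[RHS]s0 (exchange_big_dep xpredT) //=; apply: eq_bigr => t _.
rewrite -big_filter (bigD1_seq (nu t)) ?filter_uniq ?undup_uniq ?mem_filter ?eqxx ?nurs //=.
rewrite big1_seq ?addr0 // => r; rewrite mem_filter => /and3P[rt /eqP rt' _].
by rewrite rt' eqxx in rt.
Qed.
End Components.

Section Rigidity.
Variables (K : numClosedFieldType) (A : algType K).
Hypothesis dom : no_zero_divisors A.
Hypothesis gk : gk_dim_le2 A.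
Implicit Types (x y z u v w c : A) (a b : K).

Definition is_scalar x := exists a, x = a%:A.

Lemma dom_neq0 u v : u != 0 -> v != 0 -> u * v != 0.
Proof. by move=> u0 v0; apply/eqP => /dom[]; apply/eqP. Qed.

Lemma dom_reg u v : v != 0 -> u * v = 0 -> u = 0.
Proof. by move=> v0 /dom[//|/eqP]; rewrite (negPf v0). Qed.

Lemma dom_expr_neq0 u n : u != 0 -> u ^+ n != 0.
Proof.
by move=> u0; elim: n => [|n IH]; rewrite ?expr0 ?oner_neq0 // exprS dom_neq0.
Qed.

Lemma dom_regX u v n : v != 0 -> u * v ^+ n = 0 -> u = 0.
Proof. by move=> v0; apply: dom_reg; exact: dom_expr_neq0. Qed.

(** Over an algebraically closed field the annihilating polynomial splits, and
one of its linear factors must vanish in a domain. *)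
Lemma algebraic_is_scalar x P : P != 0 -> horner_alg x P = 0 -> is_scalar x.
Proof.
have [rs ->] := closed_field_poly_normal P; rewrite scaler_eq0 negb_or => /andP[l0 _].
rewrite -mul_polyC rmorphM /= horner_algC -scalerAl mul1r => /eqP.
rewrite scaler_eq0 (negPf l0) /= => /eqP; rewrite rmorph_prod /=.
elim: rs => [|r rs IH]; first by rewrite big_nil => /eqP; rewrite oner_eq0.
rewrite big_cons => /dom[|//]; rewrite rmorphB /= horner_algX horner_algC => /eqP.
by rewrite subr_eq0 => /eqP->; exists r.
Qed.

Lemma horner_alg_comm x u P : u * x = x * u -> u * horner_alg x P = horner_alg x P * u.
Proof.
move=> ux; elim/poly_ind: P => [|P c IH]; first by rewrite rmorph0 mulr0 mul0r.
rewrite rmorphD rmorphM /= horner_algX horner_algC mulrDr mulrDl mulrA IH -!mulrA ux.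
by rewrite -scalerAr -scalerAl mulr1 mul1r.
Qed.

Lemma comm_exp u x n : u * x = x * u -> u * x ^+ n = x ^+ n * u.
Proof. by move=> ux; rewrite (commrX n ux). Qed.

Lemma scalar_eig x a y : is_scalar x -> a != 0 -> ad_sub x a y = 0 -> y = 0.
Proof.
move=> [b ->] a0; rewrite /ad_sub -scalerAl -scalerAr mul1r mulr1 subrr sub0r => /eqP.
by rewrite oppr_eq0 scaler_eq0 (negPf a0) => /eqP.
Qed.

(** The dichotomy of Dixmier: an inner derivation with a nonzero eigenvalue has
no nontrivial Jordan block. Given both an eigenvector [z] and a block [y -> c ->
0], the monomials in [x], [z], [y] would be independent over the scalars. *)
Lemma semisimple_ad x z y c a b : a != 0 -> z != 0 -> ad_sub x a z = 0 ->
  ad_sub x b y = c -> ad_sub x b c = 0 -> c = 0.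
Proof.
move=> a0 z0 xz xy xc; apply/eqP; apply: contraT => c0.
have [N [f [[t0 ft0] s0]]] := gk x z y.
have xns : ~ is_scalar x by move=> /scalar_eig/(_ a0 xz)/eqP; rewrite (negPf z0).
(* Among the monomials that occur take one of maximal degree in [y]: the iterate
of that order kills every other term of the same eigenvalue. *)
case: (@arg_maxnP _ t0 (fun t => f t != 0) (fun t => t.2 : nat) ft0) => t ft tmax.
pose w t := horner_alg x (f t) * z ^+ t.1 * y ^+ t.2.
pose nu (t : 'I_N * 'I_N) := a *+ t.1 + b *+ t.2.
have wE s k : ad_subn x (nu s) k (w s) = horner_alg x (f s) * z ^+ s.1 * ad_subn x (b *+ s.2) k (y ^+ s.2).
  rewrite /w -!mulrA ad_subn_mul_comm; last by apply: horner_alg_comm.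
  congr (_ * _); rewrite /nu; elim: k => // k IH; rewrite !ad_subnS IH ad_subM.
  by rewrite (ad_sub_exp_eig _ xz) mul0r add0r.
have wnil s : ad_subn x (nu s) s.2.+1 (w s) = 0.
  by rewrite wE (ad_subn_expS _ xy xc).2 mulr0.
have := gen_eig_component (x := x) (n := N) (w := w) (nu := nu) _ s0 (nu t).
have {}wN s : ad_subn x (nu s) N (w s) = 0 by exact: ad_subn_kill (ltn_ord s.2) (wnil s).
move=> /(_ wN) comp0.
have := congr1 (ad_subn x (nu t) t.2) comp0; rewrite linear0 linear_sum /= (bigD1 t) //= big1 ?addr0.
  rewrite wE (ad_subn_expS _ xy xc).1 -scalerAr => /eqP.
  rewrite scaler_eq0 pnatr_eq0 eqn0Ngt fact_gt0 /= => /eqP /(dom_regX c0) /(dom_regX z0).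
  by move/(algebraic_is_scalar ft).
move=> s /andP[/eqP nus st]; have [fs|/tmax /=] := eqVneq (f s) 0.
  by rewrite /w fs rmorph0 !mul0r linear0.
rewrite leq_eqVlt => /predU1P[st2|lt]; last by rewrite -nus (ad_subn_kill lt (wnil s)).
have {}st2 : s.2 = t.2 by apply: val_inj.
move: nus; rewrite /nu st2 => /addIr /eqP; rewrite -subr_eq0 -[a *+ s.1]mulr_natr -[a *+ t.1]mulr_natr.
rewrite -mulrBr mulf_eq0 (negPf a0) subr_eq0 eqr_nat => /eqP/val_inj e1.
by case/eqP: st; rewrite [s]surjective_pairing e1 st2 -surjective_pairing.
Qed.

(** Were all the weights [a *+ i + b *+ j] distinct, a relation between the
monomials in [x], [y], [z] would split into relations with a single product [y
^+ i * z ^+ j] each. *)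
Lemma eigenvalues_commensurable x y z a b : ~ is_scalar x -> y != 0 -> z != 0 ->
    ad_sub x a y = 0 -> ad_sub x b z = 0 ->
  exists i j k l : nat, (i, j) != (k, l) /\ a *+ i + b *+ j = a *+ k + b *+ l.
Proof.
move=> xns y0 z0 xy xz; have [N [f [[t0 ft0] s0]]] := gk x y z.
apply: contrapT => none.
pose nu (t : 'I_N * 'I_N) := a *+ t.1 + b *+ t.2.
have nu_inj s t : nu s = nu t -> s = t.
  move=> st; apply: contrapT => neq; apply: none; exists s.1, s.2, t.1, t.2; split=> //.
  apply/eqP => -[/val_inj e1 /val_inj e2]; apply: neq.
  by rewrite [s]surjective_pairing e1 e2 -surjective_pairing.
have eig t : ad_subn x (nu t) 1 (horner_alg x (f t) * y ^+ t.1 * z ^+ t.2) = 0.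
  rewrite /ad_subn /= -[nu t]add0r -mulrA ad_subM ad_sub_comm ?mul0r ?add0r; last exact: horner_alg_comm.
  by rewrite /nu ad_subM !ad_sub_exp_eig // mul0r mulr0 addr0 mulr0.
have := gen_eig_component eig s0 (nu t0).
rewrite (bigD1 t0) //= big1 ?addr0 => [|t /andP[/eqP/nu_inj ->]]; last by rewrite eqxx.
move/(dom_regX z0)/(dom_regX y0); by move/(algebraic_is_scalar ft0).
Qed.

(** A binary form splits into linear forms, and one of these has to vanish on
the commuting pair. *)
Lemma homogeneous_factor d (P : {poly K}) y z : y * z = z * y -> y != 0 ->
    P != 0 -> (size P <= d.+1)%N ->
    \sum_(j < d.+1) P`_j *: (y ^+ (d - j) * z ^+ j) = 0 ->
  exists r, z = r *: y.
Proof.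
move=> yz y0; elim: d P => [|d IH] P P0 sP s0.
  have Pc := size1_polyC sP; move: s0 P0; rewrite big_ord1 Pc coefC /= !expr0 mulr1 => /eqP.
  by rewrite scaler_eq0 oner_eq0 orbF polyC_eq0 => ->.
have [sP1|sP1] := leqP (size P) 1.
  have Pc := size1_polyC sP1; move: s0 P0; rewrite Pc big_ord_recl coefC /= expr0 mulr1.
  rewrite big1 ?addr0 => [/eqP|j _]; last by rewrite coefC /= scale0r.
  by rewrite scaler_eq0 polyC_eq0 (negPf (dom_expr_neq0 _ y0)) orbF => ->.
have /closed_rootP[r /factor_theorem[Q PE]] : size P != 1 by rewrite neq_ltn sP1 orbT.
have Q0 : Q != 0 by apply: contraNneq P0 => Q0; rewrite PE Q0 mul0r.
have sQ : (size Q <= d.+1)%N.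
  by move: sP; rewrite PE size_Mmonic ?monicXsubC // size_XsubC addn2.
have E : \sum_(j < d.+2) P`_j *: (y ^+ (d.+1 - j) * z ^+ j) =
    (z - r *: y) * \sum_(j < d.+1) Q`_j *: (y ^+ (d - j) * z ^+ j).
  have -> : \sum_(j < d.+2) P`_j *: (y ^+ (d.+1 - j) * z ^+ j) =
    \sum_(j < d.+2) (Q * 'X)`_j *: (y ^+ (d.+1 - j) * z ^+ j)
    - r *: \sum_(j < d.+2) Q`_j *: (y ^+ (d.+1 - j) * z ^+ j).
    rewrite scaler_sumr -sumrB; apply: eq_bigr => j _.
    by rewrite PE mulrBr coefB coefMC scalerA -scalerBl [r * _]mulrC.
  rewrite mulrBl; congr (_ - _).
    rewrite big_ord_recl coefMX /= scale0r add0r mulr_sumr; apply: eq_bigr => j _.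
    rewrite /= /bump leq0n add1n coefMX /= subSS exprSr -scalerAr; congr (_ *: _).
    rewrite [LHS]mulrA; apply: esym; apply: commrM; apply: commrX => //; exact: esym yz.
  rewrite big_ord_recr /= (nth_default _ sQ) scale0r addr0 -scalerAl; congr (_ *: _).
  rewrite mulr_sumr; apply: eq_bigr => j _; rewrite -scalerAr mulrA -exprS subSn //.
  by rewrite -ltnS.
move: s0; rewrite E => /dom[/eqP|]; last exact: IH.
by rewrite subr_eq0 => /eqP ->; exists r.
Qed.

Lemma antidiagonal_sum (g : nat -> nat -> A) d B : (d < B)%N ->
  \sum_(t : 'I_B * 'I_B | (t.1 + t.2 == d)%N) g t.1 t.2 = \sum_(j < d.+1) g (d - j)%N j.
Proof.
move=> dB.
rewrite (big_ord_widen _ (fun j => g (d - j)%N j) dB).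
rewrite [LHS]big_mkcond -(pair_bigA _ (fun i j : 'I_B => if (i + j == d)%N then g i j else 0)) /=.
rewrite exchange_big /= [RHS]big_mkcond; apply: eq_bigr => j _; rewrite ltnS -big_mkcond /=.
case: leqP => jd.
  have lt : (d - j < B)%N by apply: leq_ltn_trans (leq_subr _ _) dB.
  rewrite (big_pred1 (Ordinal lt)) // => i; rewrite /= -val_eqE /=.
  by rewrite -(eqn_add2r j i) subnK.
by rewrite big1 // => i /eqP e; move: jd; rewrite -e ltnNge leq_addl.
Qed.

(** The relation between monomials, arranged by powers of the third element so
that those can be eliminated first. *)
Lemma gk_nested x y z : exists N (F : nat -> nat -> {poly K}),
  (exists j k, [/\ (j < N)%N, (k < N)%N & F j k != 0]) /\
  \sum_(k < N) (\sum_(j < N) horner_alg x (F j k) * y ^+ j) * z ^+ k = 0.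
Proof.
have [N [f [[[j0 k0] ft0] s0]]] := gk x y z.
pose F j k : {poly K} := if insub j is Some j' then
   if insub k is Some k' then f (j', k') else 0 else 0.
exists N, F; split; first by exists j0, k0; rewrite /F !valK.
rewrite -[RHS]s0.
under eq_bigr => k _ do rewrite mulr_suml.
rewrite exchange_big pair_bigA /=; apply: eq_bigr => -[j k] _ /=.
by rewrite /F !valK.
Qed.

(** The derivation [ad y] kills [y] and [z] but not [x], so it eliminates [x]
from the relation between [y], [z], [x]; the eigenvalues of [ad x] then make the
remaining relation between [y] and [z] homogeneous. *)
Lemma commuting_eigenvectors x y z a : a != 0 -> y != 0 ->
    ad_sub x a y = 0 -> ad_sub x a z = 0 -> y * z = z * y ->
  exists r, z = r *: y.
Proof.
move=> a0 y0 xy xz yz; have [N [F [[j0 [k0 [j0N k0N F0]]] s0]]] := gk_nested y z x.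
pose b k : A := \sum_(j < N) horner_alg y (F j k) * z ^+ j.
have yb k : y * b k = b k * y.
  rewrite /b mulr_sumr mulr_suml; apply: eq_bigr => j _.
  by rewrite mulrA (horner_alg_comm _ (erefl (y * y))) -!mulrA (comm_exp _ yz).
have yx : y * x - x * y = - a *: y.
  by move/eqP: xy; rewrite /ad_sub subr_eq0 scaleNr => /eqP <-; rewrite opprB.
(* Eliminate [x] by [ad y]. *)
have bk : b k0 = 0.
  apply: (ad_free yb yx _ _ s0) => //; first by rewrite -scalerAl -scalerAr.
  by move=> w k; apply: dom_regX; rewrite scaler_eq0 oppr_eq0 negb_or a0.
pose C i j := if (j < N)%N then (F j k0)`_i else 0.
pose i0 := (size (F j0 k0)).-1.
have C0 : C i0 j0 != 0 by rewrite /C j0N -lead_coefE lead_coef_eq0.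
pose d := (i0 + j0)%N.
(* [d] is the total degree of a monomial that occurs, and [B] bounds all the
exponents in sight. *)
have [B [NB dB sB]] : exists B, [/\ (N <= B)%N, (d < B)%N & forall j : 'I_N, (size (F j k0) <= B)%N].
  exists (N + \max_(j < N) size (F j k0))%N; rewrite leq_addr; split=> // [|j].
    rewrite /d addnC; apply: leq_ltn_trans (leq_add (ltnW j0N) (leqnn i0)) _.
    rewrite ltn_add2l; apply: leq_trans (leq_bigmax (Ordinal j0N)).
    by rewrite /i0 prednK // lt0n size_poly_eq0.
  exact: leq_trans (leq_bigmax j) (leq_addl _ _).
have sC : \sum_(t : 'I_B * 'I_B) C t.1 t.2 *: (y ^+ t.1 * z ^+ t.2) = 0.
  rewrite -(pair_bigA _ (fun i j : 'I_B => C i j *: (y ^+ i * z ^+ j))) exchange_big /=.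
  rewrite -[RHS]bk /b (big_ord_widen B (fun j => horner_alg y (F j k0) * z ^+ j) NB).
  rewrite [RHS]big_mkcond; apply: eq_bigr => j _.
  rewrite /C; case: ltnP => jN; last by rewrite big1 // => i _; rewrite scale0r.
  have FE : F j k0 = \poly_(i < B) (F j k0)`_i.
    apply/polyP => i; rewrite coef_poly; case: ltnP => // Bi.
    by rewrite nth_default // (leq_trans (sB (Ordinal jN))).
  rewrite [in RHS]FE horner_alg_sum mulr_suml; apply: eq_bigr => i _.
  by rewrite -scalerAl.
have eig (t : 'I_B * 'I_B) : ad_subn x (a *+ (t.1 + t.2)) 1 (C t.1 t.2 *: (y ^+ t.1 * z ^+ t.2)) = 0.
  by rewrite linearZ /= /ad_subn /= mulrnDr ad_subM !ad_sub_exp_eig // mul0r mulr0 addr0 scaler0.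
have hom0 : \sum_(j < d.+1) C (d - j)%N j *: (y ^+ (d - j) * z ^+ j) = 0.
  rewrite -(antidiagonal_sum (fun i j => C i j *: (y ^+ i * z ^+ j)) dB).
  rewrite -[RHS](gen_eig_component eig sC (a *+ d)); apply: eq_bigl => t.
  by rewrite -[a *+ _]mulr_natr -[a *+ d]mulr_natr (inj_eq (mulfI a0)) eqr_nat.
apply: (@homogeneous_factor d (\poly_(j < d.+1) C (d - j)%N j)) => //.
- apply: contraNneq C0 => /(congr1 (fun P : {poly K} => P`_j0)).
  by rewrite coef_poly ltnS leq_addl coef0 addnK => ->.
- by rewrite -[RHS]hom0; apply: eq_bigr => j _; rewrite coef_poly ltn_ord.
Qed.

(** In a relation between [z], [u], [v] the derivation [ad u] eliminates [v],
and after that [ad v] eliminates [u]; what remains is an algebraic equation for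
[z]. *)
Lemma commutes_with_nilpotent_pair z u v c : z * u = u * z -> z * v = v * z ->
    u * v - v * u = c -> c * u = u * c -> c != 0 -> is_scalar z.
Proof.
move=> zu zv uv cu c0; have [N [F [[j [k [jN kN F0]]] s0]]] := gk_nested z u v.
apply: (algebraic_is_scalar F0).
pose b k : A := \sum_(j < N) horner_alg z (F j k) * u ^+ j.
have ub l : u * b l = b l * u.
  rewrite /b mulr_sumr mulr_suml; apply: eq_bigr => i _.
  by rewrite mulrA (horner_alg_comm _ (esym zu)) -!mulrA -exprS -exprSr.
have bk : b k = 0.
  by apply: (ad_free ub uv cu _ s0) => // w l; apply: dom_regX.
have vu : v * u - u * v = - c by rewrite -uv opprB.
apply: (deriv_free (b := fun j => horner_alg z (F j k)) _ vu _ _ bk jN).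
- by move=> l; apply: horner_alg_comm.
- by rewrite mulNr mulrN cu.
- by move=> w; apply: dom_reg; rewrite oppr_eq0.
Qed.
End Rigidity.

(** * Lie algebras embedded in an associative algebra *)

Lemma lie_leibniz (K : fieldType) (g : lieAlgType K) (x y z : g) :
  lie x (lie y z) = lie (lie x y) z + lie y (lie x z).
Proof.
have /eqP := lie_jacobi x y z; rewrite -addrA addr_eq0 => /eqP ->.
by rewrite opprD addrC -lieC [lie z x]lieC lieNr opprK.
Qed.

Section EmbeddingBasics.
Variables (K : numClosedFieldType) (A : algType K).
Variables (g : lieAlgType K) (F : {linear g -> A}).
Hypothesis F_inj : injective F.
Hypothesis F_lie : forall x y, F (lie x y) = F x * F y - F y * F x.
Implicit Types (x y z : g) (a : K).

Lemma F_eq0 y : F y = 0 -> y = 0.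
Proof. by move=> h; apply: F_inj; rewrite h linear0. Qed.

Lemma F_neq0 y : y != 0 -> F y != 0.
Proof. by apply: contraNneq => /F_eq0 ->. Qed.

Lemma lie_eigenP x a y : lie x y = a *: y <-> ad_sub (F x) a (F y) = 0.
Proof.
rewrite /ad_sub -F_lie -linearZ -linearB; split=> [->|/F_eq0/eqP]; first by rewrite subrr linear0.
by rewrite subr_eq0 => /eqP.
Qed.

Lemma F_comm y z : lie y z = 0 <-> F y * F z = F z * F y.
Proof.
split=> h; first by apply/eqP; rewrite -subr_eq0 -F_lie h linear0.
by apply: F_eq0; rewrite F_lie h subrr.
Qed.

Lemma nonscalar_of_weight x a z : a != 0 -> z != 0 -> lie x z = a *: z -> ~ is_scalar (F x).
Proof.
move=> a0 z0 /lie_eigenP xz xs; have /eqP := scalar_eig xs a0 xz.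
by rewrite (negPf (F_neq0 z0)).
Qed.

End EmbeddingBasics.

(** * The spectrum of an inner derivation of a Lie algebra *)

Section AdSpectrum.
Variables (K : numClosedFieldType) (g : finLieAlgType K).
Implicit Types (x y w : g) (a b r : K).

Definition lie_sub x a y : g := lie x y - a *: y.

Fact lie_sub_is_linear x a : linear (lie_sub x a).
Proof.
move=> c u v; rewrite /lie_sub lie_linearr !scalerDr scalerN !scalerA [c * a]mulrC opprD.
by rewrite addrACA.
Qed.

HB.instance Definition _ x a := GRing.isLinear.Build K g g _ (lie_sub x a) (lie_sub_is_linear x a).

Lemma lie_sub0 x y : lie_sub x 0 y = lie x y.
Proof. by rewrite /lie_sub scale0r subr0. Qed.

Lemma lie_sub_shift x a b y : lie_sub x b y = lie_sub x a y + (a - b) *: y.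
Proof. by rewrite /lie_sub scalerBl addrA subrK. Qed.

Definition lie_sub_prod x (s : seq K) y : g := foldl (fun v r => lie_sub x r v) y s.

Lemma lie_linear_relation x : exists (n : nat) (P : {poly K}),
  [/\ P != 0, (size P <= n.+1)%N & forall w, \sum_(i < n.+1) P`_i *: iter i (lie x) w = 0].
Proof.
pose D : 'End(g) := linfun (lie_sub x 0).
pose v n : 'End(g) := iter n (fun E => D \o E)%VF \1%VF.
have vE n w : v n w = iter n (lie x) w.
  by elim: n => [|n IH]; rewrite /v /= ?id_lfunE // -/(v n) lfunE /= lfunE /= IH lie_sub0.
pose n := \dim {: 'End(g)}.
have [//|//|c [[i0 c0] s0]] := @linear_dependence K 'End(g) 'I_n.+1 'I_n
   (fun i => (vbasis {: 'End(g)})`_i) (fun i => v i)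
   (fun t s => coord (vbasis {: 'End(g)}) s (v t)).
- by move=> t; apply: coord_vbasis; rewrite memvf.
- by rewrite !card_ord.
exists n, (\poly_(i < n.+1) (if insub i is Some i' then c i' else 0)); split.
- apply: contraNneq c0 => /(congr1 (fun P : {poly K} => P`_i0)).
  by rewrite coef_poly ltn_ord valK coef0 => ->.
- exact: size_poly.
move=> w; transitivity ((\sum_t c t *: v t) w); last by rewrite s0 lfunE.
rewrite sum_lfunE; apply: eq_bigr => i _.
by rewrite coef_poly ltn_ord valK scale_lfunE vE.
Qed.

Lemma poly_ad_factor x n (P : {poly K}) : P != 0 -> (size P <= n.+1)%N ->
  exists l s, l != 0 /\ forall w, \sum_(i < n.+1) P`_i *: iter i (lie x) w = l *: lie_sub_prod x s w.
Proof.
elim: n P => [|n IH] P P0 sP.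
  have Pc := size1_polyC sP; exists P`_0, [::]; split.
    by apply: contraNneq P0 => P00; rewrite Pc P00.
  by move=> w; rewrite big_ord1.
have [sP1|sP1] := leqP (size P) 1.
  have [|l [s [l0 h]]] := IH P P0 (leq_trans sP1 _) => //.
  exists l, s; split=> // w; rewrite -h [LHS]big_ord_recr /= nth_default ?scale0r ?addr0 //.
  exact: leq_trans sP1 _.
have /closed_rootP[r /factor_theorem[Q PE]] : size P != 1 by rewrite neq_ltn sP1 orbT.
have Q0 : Q != 0 by apply: contraNneq P0 => Q0; rewrite PE Q0 mul0r.
have sQ : (size Q <= n.+1)%N.
  by move: sP; rewrite PE size_Mmonic ?monicXsubC // size_XsubC addn2.
have [l [s [l0 h]]] := IH Q Q0 sQ.
exists l, (r :: s); split=> // w; rewrite /= -h.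
have itD i : iter i (lie x) (lie_sub x r w) = iter i.+1 (lie x) w - r *: iter i (lie x) w.
  by elim: i => //= i ->; rewrite lieDr lieNr lieZr.
under [RHS]eq_bigr => i _ do rewrite itD scalerBr.
rewrite [RHS]sumrB.
have -> : \sum_(i < n.+2) P`_i *: iter i (lie x) w =
    \sum_(i < n.+2) (Q * 'X)`_i *: iter i (lie x) w - r *: \sum_(i < n.+2) Q`_i *: iter i (lie x) w.
  rewrite scaler_sumr -sumrB; apply: eq_bigr => j _.
  by rewrite PE mulrBr coefB coefMC scalerA -scalerBl [r * _]mulrC.
congr (_ - _).
  by rewrite big_ord_recl coefMX /= scale0r add0r; apply: eq_bigr => i _; rewrite coefMX.
rewrite big_ord_recr /= (nth_default _ sQ) scale0r addr0 scaler_sumr.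
by apply: eq_bigr => i _; rewrite !scalerA mulrC.
Qed.

(** The powers of [ad x] are linearly dependent in the finite-dimensional space
of endomorphisms, and the resulting polynomial splits into linear factors. *)
Lemma ad_annihilated x : exists s, forall w, lie_sub_prod x s w = 0.
Proof.
have [n [P [P0 sP h]]] := lie_linear_relation x.
have [l [s [l0 hs]]] := poly_ad_factor x P0 sP.
by exists s => w; move/eqP: (h w); rewrite hs scaler_eq0 (negPf l0) => /eqP.
Qed.

Lemma lie_sub_prod_eig x a s y : lie_sub x a y = 0 -> lie_sub_prod x s y = (\prod_(r <- s) (a - r)) *: y.
Proof.
move=> h; rewrite /lie_sub_prod; elim/last_ind: s => [|s r IH]; first by rewrite big_nil scale1r.
by rewrite foldl_rcons IH linearZ /= (lie_sub_shift x a) h add0r scalerA big_rcons /= mulrC.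
Qed.

Lemma eigenvalues_in x s a y : (forall w, lie_sub_prod x s w = 0) ->
  lie_sub x a y = 0 -> y != 0 -> a \in s.
Proof.
move=> hs hy y0; have := hs y; rewrite (lie_sub_prod_eig _ hy) => /eqP.
rewrite scaler_eq0 (negPf y0) orbF prodf_seq_eq0 => /hasP[r rs] /=.
by rewrite subr_eq0 => /eqP->.
Qed.

(** By induction on the annihilating product. Solving for the components with
eigenvalue other than [r] leaves a generalized eigenvector for [r], which the
absence of Jordan blocks turns into an eigenvector. *)
Lemma eigen_decomposition x (rs s : seq K) w :
    (forall a y c, lie_sub x a y = c -> lie_sub x a c = 0 -> c = 0) ->
    uniq rs -> {subset s <= rs} -> lie_sub_prod x s w = 0 ->
  exists u : K -> g, (forall r, lie_sub x r (u r) = 0) /\ w = \sum_(r <- rs) u r.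
Proof.
move=> ss urs; elim: s w => [|r s IH] w srs.
  rewrite /lie_sub_prod /= => ->; exists (fun=> 0); split=> [r|]; first by rewrite linear0.
  by rewrite big1.
rewrite /lie_sub_prod /= => h.
have rrs : r \in rs by apply: srs; rewrite inE eqxx.
have [|v [vE hv]] := IH (lie_sub x r w) _ h.
  by move=> t ts; apply: srs; rewrite inE ts orbT.
(* The part of [w] that should have eigenvalue [r]. *)
pose y := w - \sum_(t <- rs | t != r) (t - r)^-1 *: v t.
have yE : lie_sub x r y = v r.
  rewrite /y linearB /= hv (bigD1_seq r) //= linear_sum /= -[RHS]addr0 -addrA; congr (_ + _).
  rewrite -sumrB big1 // => t tr; rewrite linearZ /= (lie_sub_shift x t) vE add0r scalerA.
  by rewrite mulVf ?scale1r ?subrr // subr_eq0.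
have y0 : lie_sub x r y = 0 by rewrite yE; apply: (ss r y) => //; rewrite vE.
exists (fun t => if t == r then y else (t - r)^-1 *: v t); split=> [t|].
  by case: eqP => [->//|_]; rewrite linearZ /= vE scaler0.
rewrite (bigD1_seq r) //= eqxx /y.
under [X in _ = _ + X]eq_bigr => t /negPf tr do rewrite tr.
by rewrite subrK.
Qed.

(** In the annihilating product the factors with [r != 0] are injective. *)
Lemma nilpotent_of_no_eigenvalue x : (forall a y, lie_sub x a y = 0 -> y != 0 -> a = 0) ->
  forall w, exists n, iter n (lie x) w = 0.
Proof.
move=> h w; have [s /(_ w)] := ad_annihilated x.
elim: s w => [|r s IH] w; first by exists 0%N.
rewrite /lie_sub_prod /= => /IH[n hn].
have [r0|r0] := eqVneq r 0; first by exists n.+1; rewrite iterSr -lie_sub0 -r0.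
exists n; apply/eqP; apply: contraT => w0; case/eqP: r0; apply: h w0.
rewrite -[RHS]hn; elim: n {hn} => //= n <-.
by rewrite /lie_sub lieDr lieNr lieZr.
Qed.
End AdSpectrum.

(** * Integral weights *)

Section LieWeights.
Variables (K : numClosedFieldType) (g : finLieAlgType K).
Implicit Types (x y z w : g) (m n : int).

Definition wt x m y := lie_sub x m%:~R y = 0.

Lemma wtP x m y : wt x m y <-> lie x y = m%:~R *: y.
Proof. by rewrite /wt /lie_sub; split=> [/eqP|->]; rewrite ?subrr // subr_eq0 => /eqP. Qed.

Lemma wt_lie x m n y z : wt x m y -> wt x n z -> wt x (m + n) (lie y z).
Proof.
move=> /wtP hy /wtP hz; apply/wtP.
by rewrite lie_leibniz hy hz lieZl lieZr -scalerDl rmorphD.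
Qed.

Lemma wt_opp x m y : wt (- x) m y <-> wt x (- m) y.
Proof.
split=> /wtP; last by move=> h; apply/wtP; rewrite lieNl h rmorphN scaleNr opprK.
by move=> h; apply/wtP; rewrite rmorphN scaleNr -h lieNl opprK.
Qed.

(** A grading by integral weights; [rs] lists all the weights, so that there are
finitely many. *)
Definition graded_by x (rs : seq int) :=
  [/\ uniq rs, forall m y, wt x m y -> y != 0 -> m \in rs &
    forall w, exists u : int -> g, (forall m, wt x m (u m)) /\ w = \sum_(m <- rs) u m].

Lemma graded_by_opp x rs : graded_by x rs -> graded_by (- x) [seq - m | m <- rs].
Proof.
case=> urs hrs dec; split; first by rewrite map_inj_uniq //; exact: oppr_inj.
  by move=> m y /wt_opp h /(hrs _ _ h) ?; apply/mapP; exists (- m); rewrite ?opprK.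
move=> w; have [u [hu ->]] := dec w; exists (fun m => u (- m)); split.
  by move=> m; apply/wt_opp.
by rewrite big_map; apply: eq_bigr => m _; rewrite opprK.
Qed.
End LieWeights.

Section Embedded.
Variables (K : numClosedFieldType) (A : algType K).
Hypothesis dom : no_zero_divisors A.
Hypothesis gk : gk_dim_le2 A.
Hypothesis unit_central : units_central A.
Variables (g : finLieAlgType K) (F : {linear g -> A}).
Hypothesis F_inj : injective F.
Hypothesis F_lie : forall x y, F (lie x y) = F x * F y - F y * F x.
Implicit Types (x y z w : g) (a b r : K).

Lemma F_lie_sub x a y : F (lie_sub x a y) = ad_sub (F x) a (F y).
Proof. by rewrite /lie_sub linearB linearZ /= F_lie. Qed.

Lemma wt_ad_sub x m y : wt x m y -> ad_sub (F x) m%:~R (F y) = 0.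
Proof. by rewrite -F_lie_sub => ->; rewrite linear0. Qed.

Lemma eigen_semisimple x a0 z : a0 != 0 -> z != 0 -> lie_sub x a0 z = 0 ->
  forall a y c, lie_sub x a y = c -> lie_sub x a c = 0 -> c = 0.
Proof.
move=> a00 z0 xz a y c yc cc; apply: (F_eq0 F_inj).
apply: (semisimple_ad dom gk (x := F x) (y := F y) a00 (F_neq0 F_inj z0) (b := a)).
- by rewrite -F_lie_sub xz linear0.
- by rewrite -F_lie_sub yc.
- by rewrite -F_lie_sub cc linear0.
Qed.

Lemma nonscalar_of_eigen x a z : a != 0 -> z != 0 -> lie_sub x a z = 0 -> ~ is_scalar (F x).
Proof.
by move=> a0 z0 /eqP; rewrite subr_eq0 => /eqP; apply: (nonscalar_of_weight F_inj F_lie).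
Qed.

Lemma rational_ratio x a b y z : a != 0 -> y != 0 -> z != 0 -> lie_sub x a y = 0 -> lie_sub x b z = 0 ->
  exists (n : nat) (m : int), (0 < n)%N /\ b * n%:R = m%:~R * a.
Proof.
move=> a0 y0 z0 xy xz.
have [||i [j [k [l [neq E]]]]] := eigenvalues_commensurable dom gk
  (nonscalar_of_eigen a0 y0 xy) (F_neq0 F_inj y0) (F_neq0 F_inj z0) (a := a) (b := b) .
- by rewrite -F_lie_sub xy linear0.
- by rewrite -F_lie_sub xz linear0.
have E' : b * (j%:Z - l%:Z)%:~R = (k%:Z - i%:Z)%:~R * a.
  rewrite !rmorphB /= mulrBr mulrBl !mulr_natr !mulr_natl.
  by apply: (addrI (a *+ i)); rewrite addrA E addrK [RHS]addrC subrK.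
pose n := j%:Z - l%:Z.
have n0 : n != 0.
  apply: contraNneq neq; rewrite /n => n0; move: E'; rewrite n0 mulr0 => /esym/eqP.
  rewrite mulf_eq0 (negPf a0) orbF intr_eq0 subr_eq0 => /eqP[->].
  by move/eqP: n0; rewrite subr_eq0 => /eqP[->].
move: n0 E'; rewrite -/n; case: n => n' n0 E'.
  by exists n', (k%:Z - i%:Z); split; [rewrite lt0n | exact: E'].
exists n'.+1, (- (k%:Z - i%:Z)); split=> //.
by rewrite rmorphN mulNr -E' NegzE rmorphN /= mulrN opprK.
Qed.

Lemma common_denominator x a y (s : seq K) : a != 0 -> y != 0 -> lie_sub x a y = 0 ->
  exists D : nat, (0 < D)%N /\ forall b z, b \in s -> z != 0 -> lie_sub x b z = 0 ->
    exists m : int, b * D%:R = m%:~R * a.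
Proof.
move=> a0 y0 xy; elim: s => [|b0 s [D [D0 IH]]]; first by exists 1%N.
have [[z [z0 xz]]|none] := pselect (exists z, z != 0 /\ lie_sub x b0 z = 0); last first.
  exists D; split=> // b z; rewrite inE => /predU1P[->|bs] z0 xz; last exact: IH bs z0 xz.
  by case: none; exists z.
have [n [m [n0 E]]] := rational_ratio a0 y0 z0 xy xz.
exists (n * D)%N; split=> [|b z']; first by rewrite muln_gt0 n0.
rewrite inE => /predU1P[->|bs] z'0 xz'.
  by exists (m * D%:Z); rewrite natrM mulrA E rmorphM /= mulrAC.
have [m' E'] := IH b z' bs z'0 xz'.
by exists (m' * n%:Z); rewrite natrM mulrCA E' rmorphM /= mulrCA mulrA.
Qed.

Lemma integral_part (s : seq K) : exists sz : seq int, uniq sz /\ forall m, (m \in sz) = (m%:~R \in s).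
Proof.
elim: s => [|r s [sz [usz IH]]]; first by exists [::].
have [[m rm]|none] := pselect (exists m : int, r = m%:~R).
  exists (undup (m :: sz)); split=> [|m']; first exact: undup_uniq.
  by rewrite mem_undup !inE IH rm eqr_int.
exists sz; split=> // m; rewrite inE IH; case: eqP => // h; case: none.
by exists m.
Qed.

(** A nonzero eigenvalue makes [ad x] diagonalizable with pairwise commensurable
eigenvalues; dividing [x] by a common measure makes them integers and one of
them positive. *)
Lemma graded_exists x a z : a != 0 -> z != 0 -> lie_sub x a z = 0 ->
  exists x' rs m z', [/\ graded_by x' rs, 0 < m, wt x' m z' & z' != 0].
Proof.
move=> a0 z0 xz; have [s0 hs0] := ad_annihilated x.
have [D [D0 hD]] := common_denominator s0 a0 z0 xz.
have D0' : D%:R != 0 :> K by rewrite pnatr_eq0 -lt0n.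
(* With this scale an eigenvalue [b] becomes [b * D / a], and the chosen
eigenvalue [a] becomes the positive integer [D]. *)
pose t := D%:R / a; have t0 : t != 0 by rewrite mulf_neq0 ?invr_eq0.
have tE c y : lie_sub (t *: x) c y = t *: lie_sub x (c / t) y.
  by rewrite /lie_sub lieZl scalerBr scalerA mulrC divfK.
have tz : wt (t *: x) D%:Z z by rewrite /wt tE /t invf_div mulrCA mulfV // mulr1 xz scaler0.
have hint c y : lie_sub (t *: x) c y = 0 -> y != 0 -> exists m : int, c = m%:~R.
  rewrite tE => /eqP; rewrite scaler_eq0 (negPf t0) => /eqP xy y0.
  have [m E] := hD _ _ (eigenvalues_in hs0 xy y0) y0 xy.
  by exists m; apply: (mulIf a0); rewrite -E /t invf_div mulrA divfK.
have [s hs] := ad_annihilated (t *: x).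
have [rs [urs rsE]] := integral_part (undup s).
exists (t *: x), rs, D%:Z, z; split=> //; split=> // [m y my y0|w].
  by rewrite rsE mem_undup (eigenvalues_in hs my y0).
have [|u [hu ->]] := eigen_decomposition (rs := undup s) (s := s) (w := w)
    (eigen_semisimple D0' z0 tz) (undup_uniq s) _ (hs w).
  by move=> r; rewrite mem_undup.
exists (fun m => u m%:~R); split=> [m|]; first exact: hu.
rewrite -[RHS](big_map (fun m : int => m%:~R : K) xpredT u).
rewrite (bigID (fun r => r \in [seq m%:~R | m <- rs])) /= addrC big1 ?add0r => [|r rn].
  rewrite -big_filter; apply: perm_big; apply: uniq_perm.
  - by rewrite filter_uniq // undup_uniq.
  - by rewrite map_inj_uniq //; exact: intr_inj.
  move=> r; rewrite mem_filter; apply: andb_idr => /mapP[m]; by rewrite rsE => h ->.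
apply/eqP; apply: contraNT rn => ur0; have [m rm] := hint _ _ (hu r) ur0.
rewrite rm map_f // rsE -rm mem_undup (eigenvalues_in hs (hu r) ur0) //.
Qed.

Definition has_wt x (m : int) := exists y, wt x m y /\ y != 0.

Lemma wt_unique x m y z : m != 0 -> wt x m y -> wt x m z -> lie y z = 0 -> y != 0 ->
  exists r, z = r *: y.
Proof.
move=> m0 hy hz /(F_comm F_inj F_lie) yz y0.
have [|||r E] := commuting_eigenvectors dom gk (x := F x) (a := m%:~R) _ (F_neq0 F_inj y0) _ _ yz.
- by rewrite intr_eq0.
- exact: wt_ad_sub.
- exact: wt_ad_sub.
- exists r; apply: F_inj; rewrite linearZ; exact: E.
Qed.

Lemma wt_scalar x m y : m != 0 -> wt x m y -> is_scalar (F y) -> y = 0.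
Proof.
move=> m0 /wtP hy [r yE]; have /eqP : lie x y = 0.
  by apply/(F_comm F_inj F_lie); rewrite yE -scalerAl -scalerAr mul1r mulr1.
by rewrite hy scaler_eq0 intr_eq0 (negPf m0) => /eqP.
Qed.

(** Otherwise the last two nonzero iterates of [ad y] on [z] form with [y] a
pair to which [commutes_with_nilpotent_pair] applies. *)
Lemma nilpotent_centralizer_commute w y z n : ~ is_scalar (F w) ->
  lie w y = 0 -> lie w z = 0 -> iter n (lie y) z = 0 -> lie y z = 0.
Proof.
move=> wns wy wz hn; apply: contrapT => yz.
have [k [s0 c0]] : exists k, iter k.+1 (lie y) z != 0 /\ iter k.+2 (lie y) z = 0.
  case: n hn => [z0|n]; first by case: yz; rewrite [z]z0 lie0r.
  elim: n => [/yz//|n IH hn].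
  by have [/IH//|nz] := eqVneq (iter n.+1 (lie y) z) 0; exists n.
apply: wns; have comm i : lie w (iter i (lie y) z) = 0.
  by elim: i => //= i IH; rewrite lie_leibniz wy IH lie0l lie0r addr0.
apply: (commutes_with_nilpotent_pair dom gk (u := F y) (v := F (iter k (lie y) z)) _ _ (erefl _)).
- exact/(F_comm F_inj F_lie).
- exact/(F_comm F_inj F_lie)/comm.
- rewrite -F_lie; apply: esym; exact/(F_comm F_inj F_lie).
- by rewrite -F_lie (F_neq0 F_inj).
Qed.

Section Graded.
Variables (x : g) (rs : seq int).
Hypothesis gr : graded_by x rs.

Lemma weight_bound : exists B : nat, forall m, has_wt x m -> (`|m| <= B)%N.
Proof.
case: gr => _ hrs _; exists (\max_(m <- rs) `|m|)%N => m [y [my y0]].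
by apply: (@leq_bigmax_seq _ rs xpredT (fun m : int => `|m|%N)) => //; apply: hrs my y0.
Qed.

Lemma iter_lie_wt m n y z k : wt x m y -> wt x n z -> wt x (n + m *+ k) (iter k (lie y) z).
Proof.
move=> hy hz; elim: k => [|k IH]; first by rewrite mulr0n addr0.
by rewrite mulrS addrCA; apply: wt_lie.
Qed.

(** The iterates have pairwise distinct weights, and only finitely many weights
occur. *)
Lemma positive_nilpotent m n y z : 0 < m -> wt x m y -> wt x n z ->
  exists k, iter k (lie y) z = 0.
Proof.
move=> m0 hy hz; have [B hB] := weight_bound.
pose k := (B + `|n|).+1%N; exists k; apply/eqP; apply: contraT => nz.
have /hB : has_wt x (n + m *+ k) by exists (iter k (lie y) z); split=> //; apply: iter_lie_wt.
have h1 : k%:Z <= m * k%:Z by rewrite ler_peMl // -gtz0_ge1.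
by rewrite -mulr_natr natz; move: h1; rewrite /k; set mk := m * _; lia.
Qed.

Lemma top_weight : (exists m, 0 < m /\ has_wt x m) ->
  exists M, [/\ 0 < M, has_wt x M & forall m, M < m -> ~ has_wt x m].
Proof.
case=> -[k|k] [k0 hk] //; have [B hB] := weight_bound.
pose P n := (0 < n)%N && `[< has_wt x n%:Z >].
have exP : exists n, P n by exists k; apply/andP; split=> //; apply/asboolP.
have bP n : P n -> (n <= B)%N by case/andP => _ /asboolP /hB.
case: (ex_maxnP exP bP) => M /andP[M0 /asboolP hM] Mmax.
exists M%:Z; split=> // -[m|m] Mm hm //; have : (m <= M)%N.
  by apply: Mmax; apply/andP; split; [exact: leq_ltn_trans Mm | apply/asboolP].
by rewrite leqNgt; case/negP.
Qed.

(** Both vectors commute with a vector of top weight, because the bracket would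
have a larger weight, and [ad y] is nilpotent on [z]. *)
Lemma positive_commute m n y z : 0 < m -> 0 < n -> wt x m y -> wt x n z -> lie y z = 0.
Proof.
move=> m0 n0 hy hz; have [->|y0] := eqVneq y 0; first exact: lie0l.
have [|M [M0 [w [hw w0]] Mtop]] := top_weight; first by exists m; split=> //; exists y.
have comm k u : 0 < k -> wt x k u -> lie w u = 0.
  move=> k0 hu; apply: contrapT => nz; apply: (Mtop (M + k)); first by rewrite ltrDl.
  by exists (lie w u); split; [exact: wt_lie | exact/eqP].
have [k hk] := positive_nilpotent m0 hy hz.
apply: (nilpotent_centralizer_commute _ (comm _ _ m0 hy) (comm _ _ n0 hz) hk).
by move/(wt_scalar (lt0r_neq0 M0) hw)/eqP; rewrite (negPf w0).
Qed.

Lemma positive_proportional m y z : 0 < m -> wt x m y -> wt x m z -> y != 0 ->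
  exists r, z = r *: y.
Proof.
move=> m0 hy hz y0; apply: (wt_unique (lt0r_neq0 m0) hy hz) => //.
exact: positive_commute hy hz.
Qed.

(** The eigenvectors [F y] and [t * F y] have the same weight and commute, so
they are proportional. *)
Lemma weight0_commuting_scalar m y (t : A) : m != 0 -> wt x m y -> y != 0 ->
  F x * t = t * F x -> F y * t = t * F y -> is_scalar t.
Proof.
move=> m0 hy y0 xt yt.
have [|||||r E] := commuting_eigenvectors dom gk (x := F x) (a := m%:~R) (y := F y) (z := t * F y).
- by rewrite intr_eq0.
- exact: (F_neq0 F_inj).
- exact: wt_ad_sub.
- by rewrite -[m%:~R]add0r ad_subM (ad_sub_comm xt) mul0r add0r wt_ad_sub // mulr0.
- by rewrite mulrA yt.
exists r; apply/eqP; rewrite -subr_eq0; apply/eqP/(dom_reg dom (F_neq0 F_inj y0)).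
by rewrite mulrBl E -scalerAl mul1r subrr.
Qed.

(** The vectors of a positive weight form a line, on which [z] acts by a scalar;
a multiple of [x] compensates this action, and the difference commutes with [x]
and with that line. *)
Lemma weight_zero z : (exists m, 0 < m /\ has_wt x m) -> wt x 0 z ->
  exists a b, F z = a *: F x + b%:A.
Proof.
case=> m [m0 [y [hy y0]]] hz; have m0' := lt0r_neq0 m0.
have [r E] : exists r, lie z y = r *: y.
  by apply: (positive_proportional m0 hy _ y0); rewrite -[m]add0r; apply: wt_lie.
pose z' := z - (r / m%:~R) *: x.
have [b zE] : is_scalar (F z').
  apply: (weight0_commuting_scalar m0' hy y0); apply/(F_comm F_inj F_lie).
    by rewrite /z' lieDr lieNr lieZr liexx scaler0 oppr0 addr0; move/wtP: hz; rewrite scale0r.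
  rewrite /z' lieC lieDl lieNl lieZl E; have /wtP -> := hy; rewrite scalerA divfK ?intr_eq0 //.
  by rewrite subrr oppr0.
exists (r / m%:~R), b; rewrite -zE /z' linearB linearZ /= addrC subrK //.
Qed.
End Graded.

(** If they commuted, a product of powers of [F a] and [F b] would have weight
zero and commute with [F b], so it would be a nonzero scalar. Then [F a] would
be a unit, hence central, hence of weight zero. *)
Lemma opposite_bracket_neq0 x rs (m n : nat) (b a : g) : graded_by x rs -> (0 < m)%N -> (0 < n)%N ->
  wt x m b -> wt x (- n%:Z) a -> b != 0 -> a != 0 -> lie b a <> 0.
Proof.
move=> gr m0 n0 hb ha b0 a0 /(F_comm F_inj F_lie) ab.
have mz : m%:Z != 0 by rewrite eqz_nat -lt0n.
pose t := F a ^+ m * F b ^+ n.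
have xt : F x * t = t * F x.
  have : ad_sub (F x) 0 t = 0.
    have <- : (- n%:Z)%:~R *+ m + m%:~R *+ n = 0 :> K.
      by rewrite rmorphN /= -!pmulrn mulNrn -!mulrnA mulnC addNr.
    by rewrite ad_subM !(ad_sub_exp_eig _ (wt_ad_sub _)) // mul0r mulr0 addr0.
  by rewrite /ad_sub scale0r subr0 => /eqP; rewrite subr_eq0 => /eqP.
have bt : F b * t = t * F b.
  by rewrite /t; apply: commrM; apply: commrX; [exact: ab | ].
have [r tE] := weight0_commuting_scalar mz hb b0 xt bt.
have r0 : r != 0.
  have : t != 0 by apply: (dom_neq0 dom); apply: (dom_expr_neq0 dom); exact: (F_neq0 F_inj).
  by apply: contraNneq => r0; rewrite tE r0 scale0r.
have unit : F a * (r^-1 *: (F a ^+ m.-1 * F b ^+ n)) = 1.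
  by rewrite -scalerAr mulrA -exprS prednK // -/t tE scalerA mulVf // scale1r.
case/eqP: a0; apply: (F_eq0 F_inj); apply/eqP; apply: contraT => Fa0.
have /wtP := ha; have -> : lie x a = 0 by apply/(F_comm F_inj F_lie); rewrite (unit_central _ unit).
by move/esym/eqP; rewrite scaler_eq0 intr_eq0 oppr_eq0 eqz_nat eqn0Ngt n0 => /eqP a0; rewrite a0 linear0 eqxx in Fa0.
Qed.
(** For weights of one sign, with [d] the smallest absolute value of a weight:
bracketing with a vector of the opposite weight subtracts [d], so every weight
is a multiple of [d] and all smaller multiples occur. *)
Lemma weight_descent (P : nat -> Prop) d : (0 < d)%N ->
    (forall n, (0 < n)%N -> P n -> (d <= n)%N) ->
    (forall m, P m -> (d < m)%N -> P (m - d)%N) ->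
  forall m, (0 < m)%N -> P m ->
  exists j, [/\ (0 < j)%N, m = (j * d)%N & forall i, (0 < i <= j)%N -> P (i * d)%N].
Proof.
move=> d0 dmin sub; elim/ltn_ind => m IH m0 Pm.
have := dmin m m0 Pm; rewrite leq_eqVlt => /predU1P[dE|dm].
  have Pd : P d by rewrite dE.
  exists 1%N; rewrite mul1n; split=> // i i1.
  have -> : i = 1%N; first by lia.
  by rewrite mul1n.
have [||j [j0 E h]] := IH (m - d)%N _ _ (sub m Pm dm).
- by rewrite ltn_subrL d0 m0.
- by rewrite subn_gt0.
have mE : m = (j.+1 * d)%N by rewrite mulSn -E subnKC // ltnW.
exists j.+1; split=> // i /andP[i0]; rewrite leq_eqVlt => /predU1P[->|ij].
  by rewrite -mE.
by apply: h; rewrite i0.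
Qed.
Lemma weight_chain_max x rs d s : graded_by x rs -> (0 < d)%N ->
    has_wt x (s * d%:Z) -> `|s|%N = 1%N ->
  exists M, (0 < M)%N /\ has_wt x (s * (M * d)%:Z) /\
    forall j, has_wt x (s * (j * d)%:Z) -> (j <= M)%N.
Proof.
move=> gr d0 hd s1; have [B hB] := weight_bound gr.
pose P j := (0 < j)%N && `[< has_wt x (s * (j * d)%:Z) >].
have exP : exists j, P j by exists 1%N; apply/andP; split=> //; apply/asboolP; rewrite mul1n.
have bP j : P j -> (j <= B)%N.
  case/andP => _ /asboolP /hB; rewrite abszM s1 mul1n absz_nat.
  by apply: leq_trans; rewrite leq_pmulr.
case: (ex_maxnP exP bP) => M /andP[M0 /asboolP hM] Mmax.
exists M; split=> //; split=> // -[//|j] hj.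
by apply: Mmax; apply/andP; split=> //; apply/asboolP.
Qed.

(** A graded algebra with weights of both signs, normalized so that the weights
are the integers from [- L] to [M]; it is spanned by [X], possibly the unit, and
elements mapped to powers of [F p] and of [F q]. The field [ladder_ind] is the
spanning property in the form of an induction principle. *)
Record ladder X p q (M L : nat) : Prop := Ladder {
  ladder_M : (0 < M)%N;
  ladder_L : (0 < L)%N;
  ladder_p : lie X p = p;
  ladder_q : lie X q = - q;
  ladder_p0 : p != 0;
  ladder_q0 : q != 0;
  ladder_pq : lie p q <> 0;
  ladder_p1 : forall y, lie X y = y -> exists r, y = r *: p;
  ladder_q1 : forall y, lie X y = - y -> exists r, y = r *: q;
  ladder_0 : forall y, lie X y = 0 -> exists a b, F y = a *: F X + b%:A;
  ladder_pX : forall j, (0 < j <= M)%N -> exists y, F y = F p ^+ j;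
  ladder_qX : forall j, (0 < j <= L)%N -> exists y, F y = F q ^+ j;
  ladder_ind : forall S : g -> Prop,
    (forall (a : K) u v, S u -> S v -> S (a *: u + v)) ->
    (forall j y, (0 < j <= M)%N -> F y = F p ^+ j -> S y) ->
    (forall j y, (0 < j <= L)%N -> F y = F q ^+ j -> S y) ->
    (forall y a b, F y = a *: F X + b%:A -> S y) ->
    forall w, S w
}.

Lemma lie_comm_eq0 x y : lie x y = 0 -> lie y x = 0.
Proof. by move=> h; rewrite lieC h oppr0. Qed.

Lemma power_vector x m p j y : m != 0 -> wt x m p -> p != 0 -> (0 < j)%N ->
    wt x (m * j%:Z) y -> lie p y = 0 ->
  exists r, F y = r *: F p ^+ j.
Proof.
move=> m0 hp p0 j0 hy /(F_comm F_inj F_lie) py.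
apply: (commuting_eigenvectors dom gk (x := F x) (a := (m * j%:Z)%:~R)).
- by rewrite intr_eq0 mulf_neq0 // eqz_nat -lt0n.
- by apply: (dom_expr_neq0 dom); exact: (F_neq0 F_inj).
- by rewrite rmorphM /= -pmulrn mulr_natr; apply: ad_sub_exp_eig; apply: wt_ad_sub.
- exact: wt_ad_sub.
- by apply/esym/commrX/esym.
Qed.

(** Brackets of vectors of opposite signs do not vanish
([opposite_bracket_neq0]), which forces the weights to be consecutive multiples
of the smallest one. *)
Lemma ladder_exists x rs : graded_by x rs ->
    (exists m, 0 < m /\ has_wt x m) -> (exists m, m < 0 /\ has_wt x m) ->
  exists X p q M L, ladder X p q M L.
Proof.
move=> gr pos neg.
have gro := graded_by_opp gr.
pose P n := has_wt x n%:Z; pose Q n := has_wt x (- n%:Z).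
have bracket m n (b a : g) : (0 < m)%N -> (0 < n)%N -> wt x m b -> wt x (- n%:Z) a ->
    b != 0 -> a != 0 -> has_wt x (m%:Z - n%:Z).
  move=> m0 n0 hb ha b0 a0; exists (lie b a); split; first exact: wt_lie.
  by apply/eqP; exact: opposite_bracket_neq0 gr m0 n0 hb ha b0 a0.
have [m [m0 Pm]] : exists m, (0 < m)%N /\ P m.
  by case: pos => -[m|m] [m0 hm] //; exists m.
have [n [n0 Qn]] : exists n, (0 < n)%N /\ Q n.
  by case: neg => -[n|n] [n0 hn] //; exists n.+1; split=> //; rewrite /Q -NegzE.
(* The smallest absolute value of a nonzero weight; its opposite is a weight
too, by descent from a weight of the other sign. *)
have exd : exists d, (0 < d)%N && `[< P d \/ Q d >].
  by exists m; rewrite m0; apply/asboolP; left.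
case: (ex_minnP exd) => d /andP[d0 /asboolP PQd] dmin.
have minP k : (0 < k)%N -> P k -> (d <= k)%N.
  by move=> k0 Pk; apply: dmin; rewrite k0; apply/asboolP; left.
have minQ k : (0 < k)%N -> Q k -> (d <= k)%N.
  by move=> k0 Qk; apply: dmin; rewrite k0; apply/asboolP; right.
have subP k : Q d -> P k -> (d < k)%N -> P (k - d)%N.
  move=> [a [ha a0]] [b [hb b0]] dk; rewrite /P -subzn ?(ltnW dk) //.
  exact: bracket (leq_ltn_trans (leq0n _) dk) d0 hb ha b0 a0.
have subQ k : P d -> Q k -> (d < k)%N -> Q (k - d)%N.
  move=> [b [hb b0]] [a [ha a0]] dk; rewrite /Q -subzn ?(ltnW dk) // opprB.
  exact: bracket d0 (leq_ltn_trans (leq0n _) dk) hb ha b0 a0.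
have [Pd Qd] : P d /\ Q d.
  case: PQd => h; split=> //.
    have [j [j0 _ hj]] := weight_descent d0 minQ (fun k => subQ k h) n0 Qn.
    by have := hj 1%N; rewrite mul1n; apply.
  have [j [j0 _ hj]] := weight_descent d0 minP (fun k => subP k h) m0 Pm.
  by have := hj 1%N; rewrite mul1n; apply.
have chainP := weight_descent d0 minP (fun k => subP k Qd).
have chainQ := weight_descent d0 minQ (fun k => subQ k Pd).
have [||M [M0 [PM Mmax]]] := weight_chain_max (s := 1) gr d0; [by rewrite mul1r | by [] | ].
have [||L [L0 [QL Lmax]]] := weight_chain_max (s := -1) gr d0; [by rewrite mulN1r | by [] | ].
rewrite mul1r in PM; rewrite mulN1r in QL.
have {}Mmax j : P (j * d)%N -> (j <= M)%N by move=> h; apply: Mmax; rewrite mul1r.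
have {}Lmax j : Q (j * d)%N -> (j <= L)%N by move=> h; apply: Lmax; rewrite mulN1r.
have dz : d%:Z != 0 by rewrite eqz_nat -lt0n.
have dK : d%:R != 0 :> K by rewrite pnatr_eq0 -lt0n.
have [p [hp p0]] := Pd; have [q [hq q0]] := Qd.
have posM j y z : (0 < j)%N -> wt x d y -> wt x (j * d)%:Z z -> lie y z = 0.
  by move=> j0; apply: (positive_commute gr); rewrite ltz_nat ?muln_gt0 ?j0.
have negM j y z : (0 < j)%N -> wt x (- d%:Z) y -> wt x (- (j * d)%:Z) z -> lie y z = 0.
  move=> j0 hy hz; apply: (positive_commute gro (m := d) (n := (j * d)%N)).
  - by rewrite ltz_nat.
  - by rewrite ltz_nat muln_gt0 j0.
  - exact/wt_opp.
  - exact/wt_opp.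
have powP j y : (0 < j)%N -> wt x (j * d)%:Z y -> exists r, F y = r *: F p ^+ j.
  move=> j0 hy; apply: (power_vector dz hp p0 j0); last exact: posM hp hy.
  by rewrite -PoszM mulnC.
have powQ j y : (0 < j)%N -> wt x (- (j * d)%:Z) y -> exists r, F y = r *: F q ^+ j.
  move=> j0 hy; apply: (power_vector (m := - d%:Z) _ hq q0 j0); last exact: negM hq hy.
    by rewrite oppr_eq0.
  by rewrite mulNr -PoszM mulnC.
pose X := d%:R^-1 *: x.
have Xwt (m' : int) y : lie X y = m'%:~R *: y -> wt x (m' * d%:Z) y.
  move=> h; apply/wtP; rewrite rmorphM /= mulrC -scalerA -h /X lieZl scalerA.
  by rewrite -pmulrn mulfV // scale1r.
have FX : F x = d%:R *: F X by rewrite /X linearZ /= scalerA mulfV // scale1r.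
have zeroX y : wt x 0 y -> exists a b, F y = a *: F X + b%:A.
  move=> h; have [a [b ->]] := weight_zero gr pos h.
  by exists (a * d%:R), b; rewrite FX scalerA.
have scale_power r y v : y != 0 -> F y = r *: v -> exists y', F y' = v /\ y = r *: y'.
  move=> y0 E; have r0 : r != 0.
    by apply: contraNneq y0 => r0; apply/eqP/(F_eq0 F_inj); rewrite E r0 scale0r.
  exists (r^-1 *: y); rewrite linearZ /= E !scalerA mulVf ?mulfV ?scale1r //.
exists X, p, q, M, L; apply: Ladder => //.
- by rewrite /X lieZl; have /wtP -> := hp; rewrite scalerA -pmulrn mulVf // scale1r.
- rewrite /X lieZl; have /wtP -> := hq; rewrite rmorphN /= scaleNr scalerN scalerA -pmulrn.
  by rewrite mulVf // scale1r.
- exact: (opposite_bracket_neq0 gr d0 d0 hp hq p0 q0).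
- move=> y h; have [|r E] := powP 1%N y isT.
    by rewrite mul1n -[d%:Z]mul1r; apply: Xwt; rewrite scale1r.
  by exists r; apply: F_inj; rewrite E linearZ.
- move=> y h; have [|r E] := powQ 1%N y isT.
    by rewrite mul1n -mulN1r; apply: Xwt; rewrite scaleN1r.
  by exists r; apply: F_inj; rewrite E linearZ.
- by move=> y h; apply: zeroX; rewrite -[0](mul0r d%:Z); apply: Xwt; rewrite scale0r.
- move=> j /andP[j0 jM]; have [||j' [_ E h]] := chainP (M * d)%N => //.
    by rewrite muln_gt0 M0.
  have [|y [hy y0]] := h j.
    by move/eqP: E; rewrite eqn_pmul2r // => /eqP<-; rewrite j0.
  have [r E'] := powP j y j0 hy.
  by have [y' [Ey' _]] := scale_power r y _ y0 E'; exists y'.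
- move=> j /andP[j0 jM]; have [||j' [_ E h]] := chainQ (L * d)%N => //.
    by rewrite muln_gt0 L0.
  have [|y [hy y0]] := h j.
    by move/eqP: E; rewrite eqn_pmul2r // => /eqP<-; rewrite j0.
  have [r E'] := powQ j y j0 hy.
  by have [y' [Ey' _]] := scale_power r y _ y0 E'; exists y'.
move=> S Slin Sp Sq S0 w.
have S00 : S 0 by apply: (S0 0 0 0); rewrite linear0 !scale0r addr0.
have SZ r y : S y -> S (r *: y) by move=> hy; rewrite -[_ *: _]addr0; apply: Slin.
case: gr => _ _ /(_ w)[u [hu ->]].
apply: (big_ind S) => // [y z hy hz|m' _]; first by rewrite -[y]scale1r; apply: Slin.
have [->//|u0] := eqVneq (u m') 0.
case: m' u0 (hu m') => [[|k]|k] u0 huk.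
- by have [a [b E]] := zeroX _ huk; apply: (S0 _ a b).
- have [//||j [j0 E h]] := chainP k.+1; first by exists (u k.+1).
  rewrite E in huk u0 *; have [r Er] := powP j _ j0 huk.
  have [y' [Ey' ->]] := scale_power r _ _ u0 Er; apply: SZ; apply: (Sp j) => //.
  by rewrite j0; apply: Mmax; apply: h; rewrite j0 leqnn.
have [//||j [j0 E h]] := chainQ k.+1; first by exists (u (Negz k)); rewrite -NegzE.
rewrite NegzE E in huk u0 *; have [r Er] := powQ j _ j0 huk.
have [y' [Ey' ->]] := scale_power r _ _ u0 Er; apply: SZ; apply: (Sq j) => //.
by rewrite j0; apply: Lmax; apply: h; rewrite j0 leqnn.
Qed.
End Embedded.

(** * Maps out of the model Lie algebras *)

Section LieMaps.
Variable K : fieldType.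

Lemma lie_isomorphic_of_map (g h : lieAlgType K) (phi : {linear h -> g}) :
    (forall u, phi u = 0 -> u = 0) -> (forall w, exists u, w = phi u) ->
    (forall u v, phi (lie u v) = lie (phi u) (phi v)) ->
  lie_isomorphic g h.
Proof.
move=> ker surj morph.
have inj : injective phi.
  move=> u v E; apply/eqP; rewrite -subr_eq0; apply/eqP/ker.
  by rewrite linearB E subrr.
have [psi psiK] := choice surj.
have psiP u : psi (phi u) = u by apply: inj; rewrite -psiK.
have psi_lin : linear psi.
  by move=> a u v; apply: inj; rewrite -psiK linearP /= -!psiK.
pose Psi : {linear g -> h} := HB.pack psi (GRing.isLinear.Build K g h _ psi psi_lin).
exists Psi; split; first by exists phi => u /=; [rewrite -psiK | exact: psiP].
by move=> u v; apply: inj; rewrite /= morph -!psiK.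
Qed.

Lemma lie_embeds_trans (g h k : lieAlgType K) : lie_embeds g h -> lie_embeds h k -> lie_embeds g k.
Proof.
move=> [f [fi fm]] [e [ei em]]; exists (e \o f)%FUN; split; first exact: inj_comp.
by move=> x y /=; rewrite fm em.
Qed.

Lemma lie_embeds_iso (g h : lieAlgType K) : lie_isomorphic g h -> lie_embeds g h.
Proof. by move=> [f [fb fm]]; exists f; split=> //; exact: bij_inj. Qed.

Section Spans.
Variables (I : finType) (V : lmodType K) (e : I -> V).

Definition in_span w := exists c : I -> K, w = \sum_i c i *: e i.

Lemma in_span_lin a u v : in_span u -> in_span v -> in_span (a *: u + v).
Proof.
move=> [c ->] [d ->]; exists (fun t => a * c t + d t).
by rewrite scaler_sumr -big_split; apply: eq_bigr => t _ /=; rewrite scalerA scalerDl.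
Qed.

Lemma in_span_e i : in_span (e i).
Proof.
exists (fun j => (j == i)%:R); rewrite (bigD1 i) //= eqxx scale1r big1 ?addr0 // => j /negPf->.
by rewrite scale0r.
Qed.

Lemma in_spanZ a i : in_span (a *: e i).
Proof.
exists (fun j => if j == i then a else 0).
rewrite (bigD1 i) //= eqxx big1 ?addr0 // => j /negPf->.
by rewrite scale0r.
Qed.
End Spans.

Section LieOf.
Variables (I : finType) (r : lie_relations K I) (g : lieAlgType K) (e : I -> g).

Definition lin_comb (c : lie_of r) : g := \sum_i ((c : {ffun I -> K^o}) i : K) *: e i.

Fact lin_comb_is_linear : linear lin_comb.
Proof.
move=> a u v; rewrite /lin_comb scaler_sumr -big_split; apply: eq_bigr => i _ /=.
by rewrite scalerA -scalerDl !ffunE.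
Qed.

HB.instance Definition _ := GRing.isLinear.Build K (lie_of r) g _ lin_comb lin_comb_is_linear.

Lemma lin_comb_bvec i : lin_comb (bvec K i : {ffun I -> K^o}) = e i.
Proof.
rewrite /lin_comb (bigD1 i) //= ffunE eqxx scale1r big1 ?addr0 // => j /negPf ji.
by rewrite ffunE ji scale0r.
Qed.

Lemma lin_combE : [/\ lin_comb 0 = 0,
  forall a i, lin_comb (- (a *: bvec K i) : {ffun I -> K^o}) = - (a *: e i) &
  forall i, lin_comb (bvec K i : {ffun I -> K^o}) = e i].
Proof.
split; [exact: linear0 | | exact: lin_comb_bvec].
by move=> a i; rewrite linearN linearZ /= lin_comb_bvec.
Qed.

Hypothesis e_lie : forall i j, lie (e i) (e j) = lin_comb (r i j) - lin_comb (r j i).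

Lemma lin_comb_lie u v : lin_comb (lie u v) = lie (lin_comb u) (lin_comb v).
Proof.
have lie_suml (J : Type) (s : seq J) (G : J -> g) w : lie (\sum_(j <- s) G j) w = \sum_(j <- s) lie (G j) w.
  by apply: (big_morph (fun x => lie x w)); [move=> *; exact: lieDl | exact: lie0l].
have lie_sumr (J : Type) (s : seq J) (G : J -> g) w : lie w (\sum_(j <- s) G j) = \sum_(j <- s) lie w (G j).
  by apply: (big_morph (fun x => lie w x)); [move=> *; exact: lieDr | exact: lie0r].
rewrite {1}/lie /= /rel_lie linear_sum [RHS]lie_suml; apply: eq_bigr => i _.
rewrite linear_sum lie_sumr; apply: eq_bigr => j _.
by rewrite linearZ linearB /= lieZl lieZr scalerA e_lie.
Qed.

Hypothesis e_free : forall c : I -> K, \sum_i c i *: e i = 0 -> forall i, c i = 0.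

Lemma lin_comb_eq0 u : lin_comb u = 0 -> u = 0.
Proof. by move=> /e_free h; apply/ffunP => i; rewrite h ffunE. Qed.

Lemma lie_embeds_basis : lie_embeds (lie_of r) g.
Proof.
exists lin_comb; split; last exact: lin_comb_lie.
move=> u v E; apply/eqP; rewrite -subr_eq0; apply/eqP/lin_comb_eq0.
by rewrite linearB /= E subrr.
Qed.

Lemma lie_isomorphic_basis : (forall w, in_span e w) ->
  lie_isomorphic g (lie_of r).
Proof.
move=> span; apply: (lie_isomorphic_of_map (phi := lin_comb)).
- exact: lin_comb_eq0.
- move=> w; have [c ->] := span w; exists ([ffun i => c i] : {ffun I -> K^o}).
  by apply: eq_bigr => i _; rewrite ffunE.
- exact: lin_comb_lie.
Qed.
End LieOf.

Lemma sl2_eq (A B : sl2 K) : A 0 0 = B 0 0 -> A 0 1 = B 0 1 -> A 1 0 = B 1 0 -> A = B.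
Proof.
move=> e00 e01 e10; apply: val_inj; apply/matrixP => i j.
have I2 (k : 'I_2) : k = 0 \/ k = 1.
  by case: k => [[|[|//]] lt]; [left | right]; apply: val_inj.
case: (I2 i) => ->; case: (I2 j) => -> //.
by rewrite [LHS]sl2_tr [RHS]sl2_tr e00.
Qed.

Lemma sl2_exists (a b c : K) : exists A : sl2 K, [/\ A 0 0 = a, A 0 1 = b & A 1 0 = c].
Proof.
pose M : 'M[K]_2 := \matrix_(i, j) if i == 0 then if j == 0 then a else b
                                   else if j == 0 then c else - a.
have trM : M \in @traceless K by rewrite unfold_in /mxtrace !big_ord_recl big_ord0 !mxE /= addr0 subrr.
by exists (Sl2 trM); rewrite /= !mxE.
Qed.

Section Sl2Map.
Variables (g : lieAlgType K) (H E F : g).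

(** In the matrix model the coordinates of [H], [E], [F] are the entries at
(0,0), (0,1), (1,0). *)
Definition sl2_map (A : sl2 K) : g := A 0 0 *: H + A 0 1 *: E + A 1 0 *: F.

Fact sl2_map_is_linear : linear sl2_map.
Proof.
move=> a A B; rewrite /sl2_map /= !mxE !scalerDl !scalerDr -!scalerA.
by rewrite (AC ((2*2)*2) ((1*3*5)*(2*4*6)))%AC.
Qed.

HB.instance Definition _ := GRing.isLinear.Build K (sl2 K) g _ sl2_map sl2_map_is_linear.

Hypotheses (HE : lie H E = 2 *: E) (HF : lie H F = - (2 *: F)) (EF : lie E F = H).

Lemma sl2_map_lie A B : sl2_map (lie A B) = lie (sl2_map A) (sl2_map B).
Proof.
have l1 : lift ord0 ord0 = 1 :> 'I_2 by apply: val_inj.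
have EH : lie E H = - (2 *: E) by rewrite lieC HE.
have FH : lie F H = 2 *: F by rewrite lieC HF opprK.
have FE : lie F E = - H by rewrite lieC EF.
rewrite /sl2_map /= !mxE !big_ord_recl !big_ord0 !addr0 l1 -[ord0]/(0 : 'I_2) !(sl2_tr A) !(sl2_tr B).
rewrite !(lieDl, lieDr, lieZl, lieZr, liexx, HE, HF, EF, EH, FH, FE) !(scaler0, add0r, addr0).
set a := A 0 0; set b := A 0 1; set c := A 1 0.
set a' := B 0 0; set b' := B 0 1; set c' := B 1 0.
have -> : a * a' + b * c' - (a' * a + b' * c) = b * c' - c * b' by ring.
have -> : a * b' + b * - a' - (a' * b + b' * - a) = a * b' * 2 - b * a' * 2 by ring.
have -> : c * a' + - a * c' - (c' * a + - a' * c) = c * a' * 2 - a * c' * 2 by ring.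
rewrite !scalerBl !scalerDr !scalerN !scalerA.
by rewrite (AC ((2*2)*2) ((3*6)*(4*1)*(5*2)))%AC.
Qed.

Section Heisenberg.
Variables (P Q C : g).

Definition heis_map (u : heisenberg K) : g :=
  heis_coord u 0 *: P + heis_coord u 1 *: Q + heis_coord u 2%:R *: C.

Fact heis_map_is_linear : linear heis_map.
Proof.
move=> a u v; rewrite /heis_map !heis_coordD !heis_coordZ !scalerDl !scalerDr -!scalerA.
by rewrite (AC ((2*2)*2) ((1*3*5)*(2*4*6)))%AC.
Qed.

HB.instance Definition _ :=
  GRing.isLinear.Build K (heisenberg K) g _ heis_map heis_map_is_linear.

Hypotheses (PQ : lie P Q = C) (PC : lie P C = 0) (QC : lie Q C = 0).

Lemma heis_map_lie u v : heis_map (lie u v) = lie (heis_map u) (heis_map v).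
Proof.
have QP : lie Q P = - C by rewrite lieC PQ.
have CP : lie C P = 0 by rewrite lieC PC oppr0.
have CQ : lie C Q = 0 by rewrite lieC QC oppr0.
rewrite /heis_map !heis_lieE /= !scale0r !add0r.
rewrite !(lieDl, lieDr, lieZl, lieZr, liexx, PQ, QP, PC, QC, CP, CQ) !(scaler0, add0r, addr0).
by rewrite scalerN scalerBl !scalerA scalerN scalerA.
Qed.

Hypotheses (HP : lie H P = P) (HQ : lie H Q = - Q) (HC : lie H C = 0).
Hypotheses (EP : lie E P = 0) (EQ : lie E Q = P) (EC : lie E C = 0).
Hypotheses (FP : lie F P = Q) (FQ : lie F Q = 0) (FC : lie F C = 0).

Definition sl2_heis_map (s : sl2_heisenberg K) : g := sl2_map s.1 + heis_map s.2.

Fact sl2_heis_map_is_linear : linear sl2_heis_map.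
Proof.
move=> a s t; rewrite /sl2_heis_map /= !linearP /= [X in _ = X + _]scalerDr.
by rewrite addrACA.
Qed.

HB.instance Definition _ :=
  GRing.isLinear.Build K (sl2_heisenberg K) g _ sl2_heis_map sl2_heis_map_is_linear.

Lemma sl2_heis_map_action A u : heis_map (sl2_heis A u) = lie (sl2_map A) (heis_map u).
Proof.
rewrite /heis_map /sl2_map !sl2_heisE /= scale0r addr0 sl2_tr.
rewrite !(lieDl, lieDr, lieZl, lieZr, HP, HQ, HC, EP, EQ, EC, FP, FQ, FC).
rewrite !(scaler0, add0r, addr0) !scalerDl !scalerDr !scalerN !scalerA mulNr scaleNr.
by rewrite (AC ((2*2)) ((1*4)*2*3))%AC.
Qed.

Lemma sl2_heis_map_lie s t : sl2_heis_map (lie s t) = lie (sl2_heis_map s) (sl2_heis_map t).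
Proof.
case: s t => [A u] [B v]; rewrite /sl2_heis_map /= sl2_map_lie linearB linearD /=.
rewrite !sl2_heis_map_action heis_map_lie.
move: (sl2_map A) (sl2_map B) (heis_map u) (heis_map v) => a b c d.
rewrite !lieDl !lieDr [lie c b]lieC.
by rewrite (AC (1*(2*1)) ((1*3)*(4*2)))%AC.
Qed.
End Heisenberg.

Section Sl2Center.
Variables (C : g).
Hypotheses (HC : lie H C = 0) (EC : lie E C = 0) (FC : lie F C = 0).

Definition sl2_C_map (s : sl2_C K) : g := sl2_map s.1 + (s.2 : K) *: C.

Fact sl2_C_map_is_linear : linear sl2_C_map.
Proof.
move=> a s t; rewrite /sl2_C_map /= linearP /= scalerDl [X in _ = X + _]scalerDr -scalerA.
by rewrite addrACA.
Qed.

HB.instance Definition _ :=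
  GRing.isLinear.Build K (sl2_C K) g _ sl2_C_map sl2_C_map_is_linear.

Lemma sl2_C_map_lie s t : sl2_C_map (lie s t) = lie (sl2_C_map s) (sl2_C_map t).
Proof.
case: s t => [A a] [B b]; rewrite /sl2_C_map /= sl2_map_lie scale0r addr0.
have CZ (M : sl2 K) : lie (sl2_map M) C = 0.
  by rewrite /sl2_map !lieDl !lieZl HC EC FC !scaler0 !addr0.
have ZC (M : sl2 K) : lie C (sl2_map M) = 0 by rewrite lieC CZ oppr0.
by rewrite !(lieDl, lieDr, lieZl, lieZr, CZ, ZC, liexx) !(scaler0, addr0).
Qed.
End Sl2Center.
End Sl2Map.
End LieMaps.

(** * Families with the brackets of the models *)

Section AlgWeights.
Variables (K : numClosedFieldType) (A : algType K).
Implicit Types (a b : K).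

(** Independence by weights, with one index [h] allowed to share the weight zero
with scalars. *)
Lemma alg_weights_free (I : finType) (x : A) (e : I -> A) (nu : I -> K) (h : I) :
    (forall i, ad_sub x (nu i) (e i) = 0) -> (forall i, e i != 0) ->
    (forall i j, i != h -> j != h -> nu i = nu j -> i = j) ->
    nu h = 0 -> ~ is_scalar (e h) ->
    (forall i, i != h -> nu i = 0 -> is_scalar (e i)) ->
  forall c : I -> K, \sum_i c i *: e i = 0 -> forall i, c i = 0.
Proof.
move=> eig e0 nu_inj nuh eh esc c s0.
have eigc i : ad_subn x (nu i) 1 (c i *: e i) = 0.
  by rewrite linearZ /= /ad_subn /= eig scaler0.
have comp := gen_eig_component eigc s0.
have ch : c h = 0.
  apply: contrapT => /eqP ch0; apply: eh.
  have := comp 0; rewrite (bigD1 h) ?nuh //=.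
  have [s ->] : is_scalar (\sum_(i | (nu i == 0) && (i != h)) c i *: e i).
    apply: (big_ind (@is_scalar _ A)) => [|_ _ [a ->] [b ->]|i /andP[/eqP i0 ih]].
    - by exists 0; rewrite scale0r.
    - by exists (a + b); rewrite scalerDl.
    - by have [b ->] := esc i ih i0; exists (c i * b); rewrite scalerA.
  move/eqP; rewrite addr_eq0 => /eqP E; exists ((c h)^-1 * - s).
  by rewrite -scalerA scaleNr -E scalerA mulVf // scale1r.
move=> i; have [->//|ih] := eqVneq i h.
have := comp (nu i); rewrite (bigD1 i) //= big1 ?addr0 => [/eqP|j /andP[/eqP ji nji]].
  by rewrite scaler_eq0 (negPf (e0 i)) orbF => /eqP.
have [->|jh] := eqVneq j h; first by rewrite ch scale0r.
by move: nji; rewrite (nu_inj j i jh ih ji) eqxx.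
Qed.

End AlgWeights.

Section LieRelationFamilies.
Variables (K : fieldType) (g : lieAlgType K) (n : nat) (X p : g) (y : nat -> g).

(** The basis of the models [calL] and [calLt]: the vector of index [k > 0] is
the divided power [y (n - k)], on which [p] acts as a derivative. *)
Definition L_family (k : 'I_n.+1) : g := if k == 0%N :> nat then p else y (n - k)%N.

Definition Lt_family (k : option 'I_n.+1) : g := if k is Some k then L_family k else X.

Hypotheses (p_y : forall j, (j.+1 < n)%N -> lie p (y j.+1) = y j) (p_y0 : lie p (y 0%N) = 0).
Hypothesis y_comm : forall i j, (i < n)%N -> (j < n)%N -> lie (y i) (y j) = 0.

Lemma L_family_lt (k : 'I_n.+1) : k != 0%N :> nat -> (n - k < n)%N.
Proof. by have := ltn_ord k; lia. Qed.

Lemma L_family0 (k : 'I_n.+1) : k != 0%N :> nat ->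
  lie p (L_family k) = if (k < n)%N then L_family (inord k.+1) else 0.
Proof.
move=> k0; rewrite /L_family (negPf k0); case: ifP => kn.
  rewrite inordK ?ltnS //= -(p_y (j := (n - k.+1)%N)).
    by rewrite subnSK.
  by move: k0 kn; clear; lia.
have -> : (n - k = 0)%N by apply/eqP; rewrite subn_eq0 leqNgt kn.
exact: p_y0.
Qed.

Lemma L_family_comm (i j : 'I_n.+1) : i != 0%N :> nat -> j != 0%N :> nat ->
  lie (L_family i) (L_family j) = 0.
Proof.
move=> i0 j0; rewrite /L_family (negPf i0) (negPf j0).
by apply: y_comm; exact: L_family_lt.
Qed.

Lemma L_family_lie i j : lie (L_family i) (L_family j) =
  lin_comb (r := LieRelations (@L_jacobi K n)) L_family (L_rels K i j) -
  lin_comb (r := LieRelations (@L_jacobi K n)) L_family (L_rels K j i).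
Proof.
have [C0 _ C1] := lin_combE (LieRelations (@L_jacobi K n)) L_family.
have L0 : L_family ord0 = p by [].
have eS (k : 'I_n.+1) : k != 0%N :> nat -> lie p (L_family k) =
   lin_comb (r := LieRelations (@L_jacobi K n)) L_family (L_rels K ord0 k).
  by move=> k0; rewrite L_family0 // /L_rels /= lt0n k0 /=; case: ifP; rewrite ?C0 ?C1.
have rS0 (i' j' : 'I_n.+1) : i' != 0%N :> nat -> L_rels K i' j' = 0.
  by move=> i0; rewrite /L_rels (negPf i0).
have [i0|i0] := eqVneq (i : nat) 0%N; have [j0|j0] := eqVneq (j : nat) 0%N.
- by rewrite /L_rels i0 j0 /= C0 subrr /L_family i0 j0 liexx.
- have -> : i = ord0 by apply: val_inj.
  by rewrite (rS0 j) // C0 subr0 L0 eS.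
- have -> : j = ord0 by apply: val_inj.
  by rewrite (rS0 i) // C0 sub0r L0 lieC eS.
- by rewrite !rS0 // C0 subrr L_family_comm.
Qed.

Hypothesis X_p : lie X p = p.
Hypothesis X_y : forall j, (j < n)%N -> lie X (y j) = - j%:R *: y j.

Lemma Lt_family_lie i j : lie (Lt_family i) (Lt_family j) =
  lin_comb (r := LieRelations (@Lt_jacobi K n)) Lt_family (Lt_rels K i j) -
  lin_comb (r := LieRelations (@Lt_jacobi K n)) Lt_family (Lt_rels K j i).
Proof.
have [C0 CN C1] := lin_combE (LieRelations (@Lt_jacobi K n)) Lt_family.
have eN k : lie X (Lt_family (Some k)) =
    lin_comb (r := LieRelations (@Lt_jacobi K n)) Lt_family (Lt_rels K None (Some k)).
  rewrite /Lt_rels; case: ifP => k0; first by rewrite C1 /= /L_family k0 X_p.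
  by rewrite CN /= /L_family k0 X_y ?scaleNr // L_family_lt ?k0.
have eS (k : 'I_n.+1) : k != 0%N :> nat -> lie p (L_family k) =
   lin_comb (r := LieRelations (@Lt_jacobi K n)) Lt_family (Lt_rels K (Some ord0) (Some k)).
  by move=> k0; rewrite L_family0 // /Lt_rels /= lt0n k0 /=; case: ifP; rewrite ?C0 ?C1.
have rN a : Lt_rels K a None = 0 :> {ffun option 'I_n.+1 -> K^o} by case: a.
have rS0 (i' j' : 'I_n.+1) : i' != 0%N :> nat -> Lt_rels K (Some i') (Some j') = 0.
  by move=> i0; rewrite /Lt_rels (negPf i0).
have L0 : L_family ord0 = p by [].
case: i j => [i|] [j|]; last by rewrite subrr /= liexx.
- have [i0|i0] := eqVneq (i : nat) 0%N; have [j0|j0] := eqVneq (j : nat) 0%N.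
  + by rewrite /Lt_rels i0 j0 /= C0 subrr /L_family i0 j0 liexx.
  + have -> : i = ord0 by apply: val_inj.
    by rewrite (rS0 j) // C0 subr0 [Lt_family (Some ord0)]L0 [Lt_family _]/= eS.
  + have -> : j = ord0 by apply: val_inj.
    by rewrite (rS0 i) // C0 sub0r [Lt_family (Some ord0)]L0 [Lt_family _]/= lieC eS.
  + by rewrite !rS0 // C0 subrr [LHS]L_family_comm.
- by rewrite rN C0 sub0r lieC [lie (Lt_family None) _]eN.
- by rewrite rN C0 subr0 [LHS]eN.
Qed.
End LieRelationFamilies.

Section EmbeddedFamilies.
Variables (K : numClosedFieldType) (A : algType K).
Hypothesis dom : no_zero_divisors A.
Variables (g : lieAlgType K) (F : {linear g -> A}).
Hypothesis F_inj : injective F.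
Hypothesis F_lie : forall x y, F (lie x y) = F x * F y - F y * F x.
Implicit Types (x y z w X p q : g) (a b r : K).

Lemma weights_free (I : finType) X (e : I -> g) (nu : I -> K) (h : I) :
    (forall i, lie X (e i) = nu i *: e i) -> (forall i, e i != 0) ->
    (forall i j, i != h -> j != h -> nu i = nu j -> i = j) ->
    nu h = 0 -> ~ is_scalar (F (e h)) ->
    (forall i, i != h -> nu i = 0 -> is_scalar (F (e i))) ->
  forall c : I -> K, \sum_i c i *: e i = 0 -> forall i, c i = 0.
Proof.
move=> eig e0 nu_inj nuh eh esc c s0.
apply: (alg_weights_free (x := F X) (e := F \o e) (nu := nu) (h := h)) => //= [i|i|].
- exact/(lie_eigenP F_inj F_lie).
- exact: (F_neq0 F_inj).
by rewrite -[RHS](linear0 F) -s0 linear_sum; apply: eq_bigr => i _; rewrite linearZ.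
Qed.

Lemma power_weight X p a j y : lie X p = a *: p -> F y = F p ^+ j -> lie X y = (a *+ j) *: y.
Proof. by move=> /(lie_eigenP F_inj F_lie) hp E; apply/(lie_eigenP F_inj F_lie); rewrite E ad_sub_exp_eig. Qed.

(** When [F p] and [Q] satisfy the canonical commutation relation, [ad p]
differentiates the divided powers of [Q]. *)
Lemma divided_power_brackets p (Q : A) (y : nat -> g) L : F p * Q - Q * F p = 1 ->
    (forall j, (j <= L)%N -> F (y j) = j`!%:R^-1 *: Q ^+ j) ->
  [/\ forall j, (j < L)%N -> lie p (y j.+1) = y j, lie p (y 0%N) = 0 &
      forall i j, (i <= L)%N -> (j <= L)%N -> lie (y i) (y j) = 0].
Proof.
move=> PQ yE; split=> [j jL||i j iL jL].
- apply: F_inj; rewrite F_lie !yE ?(ltnW jL) //.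
  rewrite -scalerAr -scalerAl -scalerBr (comm_exp_deriv _ PQ) ?mul1r ?mulr1 //= scalerA.
  by rewrite factS natrM invfM mulrAC mulVf ?mul1r // pnatr_eq0.
- by apply: (F_eq0 F_inj); rewrite F_lie yE // fact0 invr1 scale1r expr0 mulr1 mul1r subrr.
- apply: (F_eq0 F_inj); rewrite F_lie !yE // -!scalerAl -!scalerAr.
  by rewrite !scalerA -!exprD [(i + j)%N]addnC [_^-1 * _]mulrC subrr.
Qed.

Section DividedPowers.
Variables (X p q : g) (L : nat) (y : nat -> g).
Hypotheses (Xp : lie X p = p) (Xq : lie X q = - q) (pq1 : F (lie p q) = 1).
Hypothesis yE : forall j, (j <= L)%N -> F (y j) = j`!%:R^-1 *: F q ^+ j.

Let fact_neq0 j : j`!%:R != 0 :> K.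
Proof. by rewrite pnatr_eq0 -lt0n fact_gt0. Qed.

Lemma divided_power_weight j : (j <= L)%N -> lie X (y j) = - j%:R *: y j.
Proof.
move=> jL; rewrite -mulNrn; apply/(lie_eigenP F_inj F_lie); rewrite yE // linearZ /=.
rewrite ad_sub_exp_eig ?scaler0 //; apply/(lie_eigenP F_inj F_lie).
by rewrite scaleN1r.
Qed.

Lemma divided_power_Lt_lie i j : lie (Lt_family (n := L.+1) X p y i) (Lt_family (n := L.+1) X p y j) =
  lin_comb (r := LieRelations (@Lt_jacobi K L.+1)) (Lt_family (n := L.+1) X p y) (Lt_rels K i j) -
  lin_comb (r := LieRelations (@Lt_jacobi K L.+1)) (Lt_family (n := L.+1) X p y) (Lt_rels K j i).
Proof.
have PQ : F p * F q - F q * F p = 1 by rewrite -F_lie.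
have [p_y p_y0 y_comm] := divided_power_brackets PQ yE.
exact: (Lt_family_lie (n := L.+1) p_y p_y0 y_comm Xp divided_power_weight).
Qed.

Lemma divided_power_Lt_free (c : option 'I_L.+2 -> K) :
  \sum_i c i *: Lt_family (n := L.+1) X p y i = 0 -> forall i, c i = 0.
Proof.
have [p0 q0] : p != 0 /\ q != 0.
  by split; apply: contraTneq (oner_neq0 A) => h0; rewrite -pq1 h0 ?lie0l ?lie0r linear0 eqxx.
set n := L.+1.
have nk (k : 'I_n.+1) : k != 0%N :> nat -> (n - k <= L)%N by rewrite /n; lia.
have y0 j : (j <= L)%N -> y j != 0.
  move=> jL; apply/eqP => yj; have := yE jL; rewrite yj linear0 => /esym/eqP.
  by rewrite scaler_eq0 invr_eq0 (negPf (fact_neq0 j)) (negPf (dom_expr_neq0 dom _ (F_neq0 F_inj q0))).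
have X_ns : ~ is_scalar (F X).
  by apply: (nonscalar_of_weight F_inj F_lie (a := 1) _ p0); rewrite ?oner_eq0 // scale1r.
pose nu (i : option 'I_n.+1) : K :=
  if i is Some k then if k == 0%N :> nat then 1 else - (n - k)%:R else 0.
have nat_neg (k : nat) : 1 <> - k%:R :> K.
  by move/eqP; rewrite -addr_eq0 nat1r pnatr_eq0.
move: c; apply: (weights_free (X := X) (nu := nu) (h := None)) => //.
- move=> [k|]; last by rewrite liexx scale0r.
  rewrite /nu /= /L_family; case: ifP => k0; first by rewrite Xp scale1r.
  by rewrite divided_power_weight ?nk ?k0.
- move=> [k|]; last first.
    by apply/eqP => X0; apply: X_ns; exists 0; rewrite -[X]/(Lt_family (n := n) X p y None) X0 linear0 scale0r.
  by rewrite /= /L_family; case: ifP => k0; [exact: p0 | rewrite y0 ?nk ?k0].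
- move=> [i|//] [j|//] _ _; rewrite /nu.
  case: (eqVneq (i : nat) 0%N) => [i0|i0]; case: (eqVneq (j : nat) 0%N) => [j0|j0].
  + by move=> _; congr Some; apply: val_inj; rewrite /= i0 j0.
  + by move/nat_neg.
  + by move/esym/nat_neg.
  + move/oppr_inj/eqP; rewrite eqr_nat => /eqP E; congr Some; apply: val_inj => /=.
    by have := ltn_ord i; have := ltn_ord j; lia.
- move=> [k|//] _; rewrite /nu; case: ifP => [_ /eqP|k0]; first by rewrite oner_eq0.
  move/eqP; rewrite oppr_eq0 pnatr_eq0 => /eqP k1; exists 1.
  by rewrite /= /L_family k0 k1 yE // fact0 invr1 expr0.
Qed.
End DividedPowers.

Section Quadratic.
Variables p q p2 q2 : g.
Hypotheses (pq1 : F (lie p q) = 1) (p2E : F p2 = F p ^+ 2) (q2E : F q2 = F q ^+ 2).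

(** The standard triple of quadratic elements, normalized to act on the span of
[p] and [q] by the standard representation. *)
Definition quad_E : g := 2^-1 *: p2.
Definition quad_F : g := - (2^-1 *: q2).
Definition quad_H : g := lie quad_E quad_F.
Local Notation E := quad_E.
Local Notation Fm := quad_F.
Local Notation H := quad_H.
Local Notation C := (lie p q).

Let two0 : 2 != 0 :> K.
Proof. by rewrite pnatr_eq0. Qed.

Lemma quad_central y : lie y C = 0.
Proof. by apply: (F_eq0 F_inj); rewrite F_lie pq1 mulr1 mul1r subrr. Qed.

Lemma quad_linear_action : [/\ lie E p = 0, lie E q = p, lie Fm p = q & lie Fm q = 0].
Proof.
have PQ : F p * F q - F q * F p = 1 by rewrite -F_lie.
have QP : F q * F p - F p * F q = - 1 by rewrite -opprB PQ.
have pq2 : lie p q2 = 2 *: q.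
  apply: F_inj; rewrite F_lie q2E linearZ /=.
  by rewrite (comm_exp_deriv 2 PQ) ?mulr1 ?mul1r ?expr1.
have qp2 : lie q p2 = - (2 *: p).
  apply: F_inj; rewrite F_lie p2E linearN linearZ /=.
  by rewrite (comm_exp_deriv 2 QP) ?mulrN1 ?mulN1r ?expr1 ?scalerN.
have pp2 : lie p p2 = 0 by apply: (F_eq0 F_inj); rewrite F_lie p2E -exprS -exprSr subrr.
have qq2 : lie q q2 = 0 by apply: (F_eq0 F_inj); rewrite F_lie q2E -exprS -exprSr subrr.
split.
- by rewrite /E lieZl lieC pp2 oppr0 scaler0.
- by rewrite /E lieZl lieC qp2 opprK scalerA mulVf // scale1r.
- by rewrite /Fm lieNl lieZl lieC pq2 scalerN opprK scalerA mulVf // scale1r.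
- by rewrite /Fm lieNl lieZl lieC qq2 oppr0 scaler0 oppr0.
Qed.

(** The triple acts on [p] and [q] by the standard representation, hence on [p2]
and [q2] with weights two and minus two. *)
Lemma quad_weights : [/\ lie H p = p, lie H q = - q, lie H E = 2 *: E & lie H Fm = - (2 *: Fm)].
Proof.
have [EP EQ FP FQ] := quad_linear_action.
have bracket u v w : lie (lie u v) w = lie u (lie v w) - lie v (lie u w).
  by rewrite (lie_leibniz u v w) addrK.
have HP : lie H p = p by rewrite /H bracket FP EP EQ lie0r subr0.
have HQ : lie H q = - q by rewrite /H bracket FQ EQ FP lie0r sub0r.
have Hp2 : lie H p2 = 2 *: p2 by rewrite (@power_weight H p 1 2 p2) ?scale1r.
have Hq2 : lie H q2 = - 2 *: q2 by rewrite (@power_weight H q (- 1) 2 q2) ?mulNrn // HQ scaleN1r.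
split=> //; first by rewrite /E lieZr Hp2 !scalerA mulrC.
by rewrite /Fm lieNr lieZr Hq2 scaleNr !scalerN !opprK !scalerA mulrC.
Qed.

Lemma quad_neq0 : p != 0 /\ q != 0.
Proof.
by split; apply: contraTneq (oner_neq0 A) => h0; rewrite -pq1 h0 ?lie0l ?lie0r linear0 eqxx.
Qed.

Lemma quad_H_nonscalar : ~ is_scalar (F H).
Proof.
have [HP _ _ _] := quad_weights.
by apply: (nonscalar_of_weight F_inj F_lie (a := 1) _ quad_neq0.1); rewrite ?oner_eq0 // scale1r.
Qed.

Definition quad_family (i : 'I_6) : g := nth 0 [:: H; E; Fm; p; q; C] i.

Lemma quad_free (c : 'I_6 -> K) : \sum_i c i *: quad_family i = 0 -> forall i, c i = 0.
Proof.
have [HP HQ HE HF] := quad_weights; have [p0 q0] := quad_neq0.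
have neq0 y v j : F y = v ^+ j -> v != 0 -> y != 0.
  by move=> yE v0; apply: contraNneq (dom_expr_neq0 dom j v0) => y0; rewrite -yE y0 linear0.
have p20 : p2 != 0 := neq0 _ _ _ p2E (F_neq0 F_inj p0).
have q20 : q2 != 0 := neq0 _ _ _ q2E (F_neq0 F_inj q0).
pose nuz (i : 'I_6) : int := nth 0%Z [:: 0%Z; 2%Z; -2%Z; 1%Z; -1%Z; 0%Z] i.
move: c; apply: (weights_free (X := H) (nu := fun i => (nuz i)%:~R) (h := ord0)) => //.
- case=> [[|[|[|[|[|[|//]]]]]] lt]; rewrite /nuz /quad_family /=.
  + by rewrite liexx scale0r.
  + by rewrite HE.
  + by rewrite HF rmorphN scaleNr.
  + by rewrite HP scale1r.
  + by rewrite HQ rmorphN /= scaleN1r.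
  + by rewrite quad_central scale0r.
- case=> [[|[|[|[|[|[|//]]]]]] lt]; rewrite /quad_family //=.
  + by apply: contra_notN quad_H_nonscalar => /eqP ->; exists 0; rewrite linear0 scale0r.
  + by rewrite scaler_eq0 invr_eq0 negb_or two0.
  + by rewrite oppr_eq0 scaler_eq0 invr_eq0 negb_or two0.
  + by apply: contraTneq (oner_neq0 A) => C0; rewrite -pq1 C0 linear0 eqxx.
- move=> i j i0 j0 /eqP; rewrite eqr_int => /eqP E'; apply: val_inj; move: i0 j0 E'.
  by case: i => [[|[|[|[|[|[|//]]]]]] lti]; case: j => [[|[|[|[|[|[|//]]]]]] ltj].
- exact: quad_H_nonscalar.
- move=> i i0 /eqP; rewrite intr_eq0; move: i0.
  case: i => [[|[|[|[|[|[|//]]]]]] lt] //= _ _; exists 1.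
  by rewrite /quad_family /= pq1 scale1r.
Qed.

Definition quad_map : {linear sl2_heisenberg K -> g} := sl2_heis_map H E Fm p q C.

Lemma quad_map_lie s t : quad_map (lie s t) = lie (quad_map s) (quad_map t).
Proof.
have [EP EQ FP FQ] := quad_linear_action; have [HP HQ HE HF] := quad_weights.
by apply: sl2_heis_map_lie => //; exact: quad_central.
Qed.

Lemma quad_map_eq0 s : quad_map s = 0 -> s = 0.
Proof.
case: s => [B u]; rewrite /quad_map /= /sl2_heis_map /sl2_map /heis_map /= => E0.
pose c (i : 'I_6) := nth 0 [:: B 0 0; B 0 1; B 1 0; heis_coord u 0; heis_coord u 1; heis_coord u 2%:R] i.
have c0 : forall i, c i = 0.
  by apply: quad_free; rewrite -[RHS]E0 !big_ord_recr big_ord0 /= add0r !addrA.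
congr (_, _).
  by apply: sl2_eq; rewrite /= mxE; [exact: (c0 0) | exact: (c0 1) | exact: (c0 2%:R)].
apply: heis_coordP; case=> [[|[|[|//]]] lt].
- rewrite (_ : Ordinal lt = 0); last exact: val_inj.
  by rewrite [RHS]ffunE; exact: (c0 3%:R).
- rewrite (_ : Ordinal lt = 1); last exact: val_inj.
  by rewrite [RHS]ffunE; exact: (c0 4%:R).
- rewrite (_ : Ordinal lt = 2%:R); last exact: val_inj.
  by rewrite [RHS]ffunE; exact: (c0 5%:R).
Qed.

Lemma quad_map_surj w : in_span quad_family w -> exists s, w = quad_map s.
Proof.
move=> [c ->]; have [B [B0 B1 B2]] := sl2_exists (c 0) (c 1) (c 2%:R).
pose u : heisenberg K := [ffun i : 'I_3 => nth 0 [:: c 3%:R; c 4%:R; c 5%:R] i : K^o].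
exists (B, u); rewrite /quad_map /= /sl2_heis_map /sl2_map /heis_map /heis_coord B0 B1 B2 !ffunE /=.
rewrite !big_ord_recr big_ord0 /= add0r !addrA.
by do ?congr (_ + _); congr (c _ *: _); apply: val_inj.
Qed.
End Quadratic.
End EmbeddedFamilies.

(** * Weights of both signs *)

Section LadderClassification.
Variables (K : numClosedFieldType) (A : algType K).
Hypothesis dom : no_zero_divisors A.
Hypothesis gk : gk_dim_le2 A.
Variables (g : finLieAlgType K) (F : {linear g -> A}).
Hypothesis F_inj : injective F.
Hypothesis F_lie : forall x y, F (lie x y) = F x * F y - F y * F x.
Implicit Types (x y z w X p q : g) (a b r : K).

Lemma ladder_swap X p q M L : ladder F X p q M L -> ladder F (- X) q p L M.
Proof.
case=> M0 L0 Xp Xq p0 q0 pq p1 q1 z0 pX qX ind; apply: Ladder => //.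
- by rewrite lieNl Xq opprK.
- by rewrite lieNl Xp.
- by move=> /lie_comm_eq0.
- by move=> y h; apply: q1; rewrite -[LHS]opprK -lieNl h.
- by move=> y /eqP; rewrite lieNl eqr_opp => /eqP; apply: p1.
- move=> y /eqP; rewrite lieNl oppr_eq0 => /eqP /z0[a [b ->]].
  by exists (- a), b; rewrite linearN scaleNr scalerN opprK.
move=> S Slin Sq Sp S0; apply: ind => // y a b E; apply: (S0 y (- a) b).
by rewrite E linearN scaleNr scalerN opprK.
Qed.

Lemma ladder_scale X p q M L r : r != 0 -> ladder F X p q M L -> ladder F X p (r *: q) M L.
Proof.
move=> r0 [M0 L0 Xp Xq p0 q0 pq p1 q1 z0 pX qX ind]; apply: Ladder => //.
- by rewrite lieZr Xq scalerN.
- by rewrite scaler_eq0 negb_or r0.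
- by rewrite lieZr => /eqP; rewrite scaler_eq0 (negPf r0) => /eqP.
- by move=> y /q1[s ->]; exists (s / r); rewrite scalerA divfK.
- move=> j /qX[y yE]; exists (r ^+ j *: y).
  by rewrite !linearZ /= yE exprZn.
move=> S Slin Sp Sq S0.
have S00 : S 0 by apply: (S0 0 0 0); rewrite linear0 !scale0r addr0.
apply: ind => // j y jL E; have rj : r ^+ j != 0 by rewrite expf_neq0.
have -> : y = (r ^+ j)^-1 *: (r ^+ j *: y) + 0 by rewrite scalerA mulVf // scale1r addr0.
by apply: Slin => //; apply: (Sq j) => //; rewrite !linearZ /= E exprZn.
Qed.

Lemma ladder_X_nonscalar X p q M L : ladder F X p q M L -> ~ is_scalar (F X).
Proof.
move=> l; apply: (nonscalar_of_weight F_inj F_lie (a := 1) _ (ladder_p0 l)).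
  exact: oner_neq0.
by rewrite scale1r (ladder_p l).
Qed.

Lemma ladder_power_q X p q M L j y : ladder F X p q M L -> F y = F q ^+ j -> lie X y = - j%:R *: y.
Proof.
move=> l E; rewrite (power_weight F_inj F_lie (p := q) (a := -1) (j := j)) // ?mulNrn //.
by rewrite (ladder_q l) scaleN1r.
Qed.

Lemma ladder_power_p X p q M L j y : ladder F X p q M L -> F y = F p ^+ j -> lie X y = j%:R *: y.
Proof.
by move=> l E; rewrite (power_weight F_inj F_lie (p := p) (a := 1) (j := j)) // (ladder_p l) scale1r.
Qed.

(** Otherwise the bracket of [p] with the element of [g] mapped to [F q ^+ 2]
would involve [F q * F X], while its weight forces it to be a multiple of [q].
*)
Lemma ladder_bracket_scalar X p q M L : (2 <= L)%N -> ladder F X p q M L ->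
  is_scalar (F (lie p q)).
Proof.
move=> L2 l; have [a [b pqE]] : exists a b, F (lie p q) = a *: F X + b%:A.
  apply: (ladder_0 l); rewrite lie_leibniz (ladder_p l) (ladder_q l) lieNr subrr //.
have [y yE] := ladder_qX l (j := 2) L2.
have [r rE] : exists r, lie p y = r *: q.
  apply: (ladder_q1 l); rewrite lie_leibniz (ladder_p l) (ladder_power_q l yE).
  by rewrite lieZr -{1}[lie p y]scale1r -scalerDl -[RHS]scaleN1r; congr (_ *: _); rewrite mulr2n opprD addNKr.
have QX : F X * F q = F q * F X - F q.
  by have /eqP := F_lie X q; rewrite (ladder_q l) linearN eq_sym subr_eq addrC => /eqP.
(* The commutator of [F p] with [F q ^+ 2] is a multiple of [F q] by weight;
expand it and collect the factor [F q] on the left. *)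
have E : F q * (a *+ 2 *: F X + (b *+ 2 - a - r)%:A) = 0.
  have : F (lie p y) = F (lie p q) * F q + F q * F (lie p q).
    by rewrite !F_lie yE expr2 mulrBl mulrBr !mulrA addrA subrK.
  rewrite rE pqE linearZ /= mulrDl mulrDr -!scalerAl -!scalerAr mul1r mulr1 QX => E.
  rewrite mulrDr -!scalerAr mulr1 !scalerBl E !scalerBr !mulr2n !scalerDl !opprD opprK !addrA.
  rewrite (AC 10 ((1*6)*(2*9)*(3*8)*(4*10)*(5*7)))%AC /=.
  by rewrite !(subrr, addNr) !addr0.
have {E} : a *+ 2 *: F X + (b *+ 2 - a - r)%:A = 0.
  by case: (dom E) => // /(F_eq0 F_inj) /eqP; rewrite (negPf (ladder_q0 l)).
have [a00|a0] := eqVneq a 0.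
  by move=> _; exists b; rewrite pqE a00 scale0r add0r.
move/eqP; rewrite addr_eq0 => /eqP E; case: (ladder_X_nonscalar l).
have a20 : a *+ 2 != 0 by rewrite mulrn_eq0.
exists ((a *+ 2)^-1 * - (b *+ 2 - a - r)).
by rewrite -scalerA scaleNr -E scalerA mulVf // scale1r.
Qed.

Lemma ladder_normalize X p q M L : is_scalar (F (lie p q)) -> ladder F X p q M L ->
  exists q', ladder F X p q' M L /\ F (lie p q') = 1.
Proof.
move=> [b pqE] l; have b0 : b != 0.
  apply/eqP => b0; apply: (ladder_pq l); apply: (F_eq0 F_inj).
  by rewrite pqE b0 scale0r.
exists (b^-1 *: q); split; first by apply: ladder_scale l; rewrite invr_eq0.
by rewrite lieZr linearZ /= pqE scalerA mulVf // scale1r.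
Qed.

Lemma ladder_Lt X p q L : ladder F X p q 1 L -> F (lie p q) = 1 ->
  lie_isomorphic g (calLt K L.+1).
Proof.
move=> l pq1; set n := L.+1.
have fact_neq0 j : j`!%:R != 0 :> K by rewrite pnatr_eq0 -lt0n fact_gt0.
have /choice[y yE] : forall j : nat, exists z, (j <= L)%N -> F z = j`!%:R^-1 *: F q ^+ j.
  case=> [|j]; first by exists (lie p q); rewrite fact0 invr1 scale1r expr0.
  have [jL|jL] := leqP j.+1 L; last by exists 0.
  have [z zE] := ladder_qX l (j := j.+1) jL; exists (j.+1`!%:R^-1 *: z) => _.
  by rewrite linearZ /= zE.
pose e := Lt_family (n := n) X p y.
apply: (lie_isomorphic_basis (e := e)).
- exact: (divided_power_Lt_lie F_inj F_lie (ladder_p l) (ladder_q l) pq1 yE).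
- exact: (divided_power_Lt_free dom F_inj F_lie (ladder_p l) (ladder_q l) pq1 yE).
apply: (ladder_ind l) => [||j z /andP[j0 jL] E|z a b E]; first exact: in_span_lin.
- case=> [//|[|//]] z _; rewrite expr1 => /F_inj ->.
  by have := in_span_e e (Some ord0).
- have lt : (n - j < n.+1)%N by rewrite ltnS leq_subr.
  have -> : z = j`!%:R *: e (Some (Ordinal lt)).
    rewrite /e /= /L_family /=; case: ifP => [/eqP|_]; first by rewrite /n; lia.
    have -> : (n - (n - j) = j)%N by rewrite /n; lia.
    by apply: F_inj; rewrite linearZ /= yE // scalerA mulfV ?scale1r.
  exact: in_spanZ.
have -> : z = a *: e None + b *: e (Some ord_max).
  apply: F_inj; rewrite linearD !linearZ /= /L_family /= subnn yE // fact0 invr1 expr0 scale1r.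
  exact: E.
by apply: in_span_lin; [exact: in_span_e | exact: in_spanZ].
Qed.

(** The commutator [a k] of [F p ^+ k] and [F q ^+ 2] satisfies a recursion
under [ad (F q)]. As [a 3] has weight one, it is a multiple of [F p], so two
steps of the recursion bring it to zero instead of a nonzero multiple of [F q].
*)
Lemma ladder_lt3 X p q M L : (2 <= L)%N -> ladder F X p q M L -> F (lie p q) = 1 -> (M < 3)%N.
Proof.
move=> L2 l pq1; rewrite ltnNge; apply/negP => M3.
have [u uE] := ladder_pX l (j := 3) M3.
have [v vE] := ladder_qX l (j := 2) L2.
have [r rE] : exists r, lie u v = r *: p.
  apply: (ladder_p1 l); rewrite lie_leibniz (ladder_power_p l uE) (ladder_power_q l vE).
  by rewrite lieZl lieZr -scalerDl -[RHS]scale1r; congr (_ *: _); ring.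
have QP : F q * F p - F p * F q = - 1 by rewrite -opprB -F_lie pq1.
(* The element [a 3] is the image of a vector of weight one. *)
pose a k := F p ^+ k * F q ^+ 2 - F q ^+ 2 * F p ^+ k.
have step k : F q * a k.+1 - a k.+1 * F q = - k.+1%:R *: a k.
  have E : F q * F p ^+ k.+1 = F p ^+ k.+1 * F q - k.+1%:R *: F p ^+ k.
    have /eqP := comm_exp_deriv k.+1 QP (etrans (mulN1r _) (esym (mulrN1 _))).
    by rewrite subr_eq mulrN1 scalerN addrC => /eqP.
  have comm : F q * F q ^+ 2 = F q ^+ 2 * F q by rewrite -exprS -exprSr.
  have E1 : F q * (F p ^+ k.+1 * F q ^+ 2) = F p ^+ k.+1 * F q ^+ 2 * F q - k.+1%:R *: (F p ^+ k * F q ^+ 2).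
    by rewrite mulrA E mulrBl -(mulrA _ (F q) (F q ^+ 2)) comm mulrA -scalerAl.
  have E2 : F q * (F q ^+ 2 * F p ^+ k.+1) = F q ^+ 2 * F p ^+ k.+1 * F q - k.+1%:R *: (F q ^+ 2 * F p ^+ k).
    by rewrite mulrA comm -(mulrA _ (F q)) E mulrBr mulrA -scalerAr.
  rewrite /a mulrBr mulrBl E1 E2 scaleNr scalerBr !opprB.
  set x := _ *: (F p ^+ k * _); set y := _ *: (F q ^+ 2 * _).
  set X' := F p ^+ k.+1 * F q ^+ 2 * F q; set Y' := F q ^+ 2 * F p ^+ k.+1 * F q.
  by rewrite (AC (2*2*2) ((1*6)*(4*5)*(3*2)))%AC /= !(subrr, addNr) !add0r.
have a3 : a 3 = r *: F p by rewrite /a -uE -vE -F_lie rE linearZ.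
have a2 : - 3%:R *: a 2 = r *: - 1.
  by rewrite -step a3 -scalerAr -scalerAl -scalerBr QP.
have a1 : a 1%N = 0.
  have := step 1%N; have -> : a 2 = (- r / - 3%:R)%:A.
    apply: (@scalerI _ _ (- 3%:R)); first by rewrite oppr_eq0 pnatr_eq0.
    by rewrite a2 scalerA mulrC divfK ?oppr_eq0 ?pnatr_eq0 // scaleNr scalerN.
  rewrite -scalerAl -scalerAr mul1r mulr1 subrr => /esym/eqP.
  by rewrite scaler_eq0 oppr_eq0 pnatr_eq0 => /eqP.
have := a1; rewrite /a expr1; have E := comm_exp_deriv 2 (u := F q) (v := F p) (c := 1).
rewrite E ?mul1r ?mulr1 ?expr1 // -?F_lie ?pq1 // => /eqP.
by rewrite scaler_eq0 pnatr_eq0 (negPf (F_neq0 F_inj (ladder_q0 l))).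
Qed.
Lemma ladder_flip X p q M L : ladder F X p q M L -> F (lie p q) = 1 ->
  ladder F (- X) q (- p) L M /\ F (lie q (- p)) = 1.
Proof.
move=> l pq1; split; last by rewrite lieNr -lieC.
by rewrite -[- p]scaleN1r; apply: ladder_scale (ladder_swap l); rewrite oppr_eq0 oner_eq0.
Qed.

(** The elements [X] and [quad_H] act in the same way on [p] and [q], so they
differ by a scalar. *)
Lemma ladder_sl2_heisenberg X p q : ladder F X p q 2 2 -> F (lie p q) = 1 ->
  lie_isomorphic g (sl2_heisenberg K).
Proof.
move=> l pq1.
have [p2 p2E] := ladder_pX l (j := 2) isT.
have [q2 q2E] := ladder_qX l (j := 2) isT.
have two0 : 2 != 0 :> K by rewrite pnatr_eq0.
pose H := quad_H p2 q2.
have [HP HQ _ _] := quad_weights F_inj F_lie pq1 p2E q2E.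
have [s sE] : is_scalar (F (X - H)).
  apply: (commutes_with_nilpotent_pair dom gk (u := F p) (v := F q) (c := 1)).
  - by apply/(F_comm F_inj F_lie); rewrite lieDl lieNl HP (ladder_p l) subrr.
  - by apply/(F_comm F_inj F_lie); rewrite lieDl lieNl HQ (ladder_q l) subrr.
  - by rewrite -F_lie pq1.
  - by rewrite mulr1 mul1r.
  - exact: oner_neq0.
have FX : F X = F H + s%:A by rewrite -sE linearB addrC subrK.
pose e := quad_family p q p2 q2.
apply: (lie_isomorphic_of_map (phi := quad_map p q p2 q2)).
- exact: (quad_map_eq0 dom F_inj F_lie pq1 p2E q2E).
- move=> w; apply: quad_map_surj; move: w.
  apply: (ladder_ind l) => [||j y jL yE|y a b yE]; first exact: in_span_lin.
  + case=> [//|[|[|//]]] y _ yE.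
      have -> : y = e 3%:R by apply: F_inj; rewrite yE expr1.
      exact: in_span_e.
    have -> : y = 2 *: e 1.
      by rewrite /e /quad_family /= scalerA mulfV // scale1r; apply: F_inj; rewrite yE p2E.
    exact: in_spanZ.
  + case: j jL yE => [//|[|[|//]]] _ yE.
      have -> : y = e 4%:R by apply: F_inj; rewrite yE expr1.
      exact: in_span_e.
    have -> : y = - 2 *: e 2%:R.
      rewrite /e /quad_family /= /quad_F scaleNr scalerN opprK scalerA mulfV // scale1r.
      by apply: F_inj; rewrite yE q2E.
    exact: in_spanZ.
  + have -> : y = a *: e 0 + (a * s + b) *: e 5%:R.
      have FD : F (a *: H + (a * s + b) *: lie p q) = a *: F H + (a * s + b)%:A.
        by rewrite linearD !linearZ /= pq1.
      apply: F_inj; rewrite yE FX -[e 5%:R]/(lie p q) -[e 0]/H FD scalerDr scalerA.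
      by rewrite scalerDl addrA.
    by apply: in_span_lin; [exact: in_span_e | exact: in_spanZ].
- exact: (quad_map_lie F_inj F_lie pq1 p2E q2E).
Qed.

(** Here [p] and [q] already generate a copy of sl(2), and the only further
element possible is a scalar. *)
Lemma ladder_sl2 X p q a b : ladder F X p q 1 1 -> F (lie p q) = a *: F X + b%:A -> a != 0 ->
  lie_isomorphic g (sl2 K) \/ lie_isomorphic g (sl2_C K).
Proof.
move=> l pqE a0.
pose E := p; pose Fm := (2 / a) *: q; pose H := lie E Fm.
have two0 : 2 != 0 :> K by rewrite pnatr_eq0.
have FH : F H = 2 *: F X + (2 / a * b)%:A.
  by rewrite /H /Fm lieZr linearZ /= pqE scalerDr !scalerA divfK.
have F1 (y : g) : F y * 1 - 1 * F y = 0 by rewrite mulr1 mul1r subrr.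
have HX y : lie H y = 2 *: lie X y.
  apply: F_inj; rewrite linearZ /= (F_lie H) (F_lie X) FH mulrDl mulrDr -!scalerAl -!scalerAr mul1r mulr1.
  by rewrite opprD addrACA subrr addr0 -scalerBr.
have HE : lie H E = 2 *: E by rewrite HX (ladder_p l).
have HF : lie H Fm = - (2 *: Fm) by rewrite HX lieZr (ladder_q l) !scalerN.
have H0 : ~ is_scalar (F H).
  by apply: (nonscalar_of_weight F_inj F_lie (a := 2) two0 (ladder_p0 l)); exact: HE.
have ca0 : 2 / a != 0 by rewrite mulf_neq0 ?invr_eq0.
(* The normalization makes [H] equal to [2 X] up to a scalar. *)
have qE : q = (a / 2) *: Fm by rewrite /Fm scalerA mulrA divfK // mulfV ?scale1r.
have XE : F X = 2^-1 *: F H + (- (b / a))%:A.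
  rewrite FH scalerDr !scalerA mulVf // scale1r mulrA mulrA mulVf // mul1r.
  by rewrite [a^-1 * b]mulrC scaleNr addrK.
have Fm0 : Fm != 0 by rewrite scaler_eq0 negb_or ca0 (ladder_q0 l).
have nz (m n : int) : (m%:~R == n%:~R :> K) = (m == n) by rewrite eqr_int.
have [[C CE]|noC] := pselect (exists C, F C = 1); [right | left].
- have central y : lie y C = 0 by apply: (F_eq0 F_inj); rewrite F_lie CE F1.
  pose e (i : 'I_4) := nth 0 [:: H; E; Fm; C] i.
  pose nu (i : 'I_4) : K := nth 0 [:: 0; 2; - 2; 0] i.
  have free : forall c : 'I_4 -> K, \sum_i c i *: e i = 0 -> forall i, c i = 0.
    apply: (weights_free F_inj F_lie (X := H) (nu := nu) (h := ord0)) => //.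
    + case=> [[|[|[|[|//]]]] lt]; rewrite /nu /e /=.
      * by rewrite liexx scale0r.
      * by rewrite HE.
      * by rewrite HF scaleNr.
      * by rewrite central scale0r.
    + case=> [[|[|[|[|//]]]] lt]; rewrite /e //=.
      * by apply: contra_notN H0 => /eqP ->; exists 0; rewrite linear0 scale0r.
      * exact: ladder_p0 l.
      * by apply: contraTneq (oner_neq0 A) => C0; rewrite -CE C0 linear0 eqxx.
    + have nuE (i : 'I_4) : nu i = (nth 0%Z [:: 0%Z; 2%Z; -2%Z; 0%Z] i)%:~R.
        by case: i => [[|[|[|[|//]]]] lt]; rewrite /nu /= ?rmorphN.
      move=> i j i0 j0; rewrite !nuE => /eqP; rewrite nz => /eqP E'; apply: val_inj; move: i0 j0 E'.
      by case: i => [[|[|[|[|//]]]] lti]; case: j => [[|[|[|[|//]]]] ltj].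
    + case=> [[|[|[|[|//]]]] lt]; rewrite /nu /e //= => _.
      * by move/eqP; rewrite (negPf two0).
      * by move/eqP; rewrite oppr_eq0 (negPf two0).
      * by move=> _; exists 1; rewrite CE scale1r.
  apply: (lie_isomorphic_of_map (phi := sl2_C_map H E Fm C)).
  + move=> [B t]; rewrite /= /sl2_C_map /sl2_map /= => E0.
    pose c (i : 'I_4) := nth 0 [:: B 0 0; B 0 1; B 1 0; t : K] i.
    have c0 : forall i, c i = 0.
      by apply: free; rewrite -[RHS]E0 !big_ord_recr big_ord0 /= add0r.
    congr (_, _); last exact: (c0 3%:R).
    by apply: sl2_eq; rewrite /= mxE; [exact: (c0 0) | exact: (c0 1) | exact: (c0 2%:R)].
  + move=> w; suff [c ->] : in_span e w.
      have [B [B0 B1 B2]] := sl2_exists (c 0) (c 1) (c 2%:R).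
      exists (B, c 3%:R : K^o); rewrite /= /sl2_C_map /sl2_map B0 B1 B2 /=.
      rewrite !big_ord_recr big_ord0 /= add0r.
      by do ?congr (_ + _); congr (c _ *: _); apply: val_inj.
    move: w; apply: (ladder_ind l) => [||j y jL yE|y s t yE]; first exact: in_span_lin.
    * case=> [//|[|//]] y _ yE; have -> : y = e 1 by apply: F_inj; rewrite yE expr1.
      exact: in_span_e.
    * case: j jL yE => [//|[|//]] _ yE; have -> : y = (a / 2) *: e 2%:R.
        by rewrite -qE; apply: F_inj; rewrite yE expr1.
      exact: in_spanZ.
    have -> : y = (s / 2) *: e 0 + (t - s * (b / a)) *: e 3%:R.
      have FD : F ((s / 2) *: H + (t - s * (b / a)) *: C) = (s / 2) *: F H + (t - s * (b / a))%:A.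
        by rewrite linearD !linearZ /= CE.
      apply: F_inj; rewrite yE XE -[e 3%:R]/C -[e 0]/H FD scalerDr !scalerA -addrA -scalerDl.
      by rewrite mulrN [t - _]addrC.
    by apply: in_span_lin; [exact: in_span_e | exact: in_spanZ].
  apply: sl2_C_map_lie => //.
pose e (i : 'I_3) := nth 0 [:: H; E; Fm] i.
pose nu (i : 'I_3) : K := nth 0 [:: 0; 2; - 2] i.
have free : forall c : 'I_3 -> K, \sum_i c i *: e i = 0 -> forall i, c i = 0.
  apply: (weights_free F_inj F_lie (X := H) (nu := nu) (h := ord0)) => //.
  + case=> [[|[|[|//]]] lt]; rewrite /nu /e /=.
    * by rewrite liexx scale0r.
    * by rewrite HE.
    * by rewrite HF scaleNr.
  + case=> [[|[|[|//]]] lt]; rewrite /e //=.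
    * by apply: contra_notN H0 => /eqP ->; exists 0; rewrite linear0 scale0r.
    * exact: ladder_p0 l.
  + have nuE (i : 'I_3) : nu i = (nth 0%Z [:: 0%Z; 2%Z; -2%Z] i)%:~R.
      by case: i => [[|[|[|//]]] lt]; rewrite /nu /= ?rmorphN.
    move=> i j i0 j0; rewrite !nuE => /eqP; rewrite nz => /eqP E'; apply: val_inj; move: i0 j0 E'.
    by case: i => [[|[|[|//]]] lti]; case: j => [[|[|[|//]]] ltj].
  + case=> [[|[|[|//]]] lt]; rewrite /nu /e //= => _.
    * by move/eqP; rewrite (negPf two0).
    * by move/eqP; rewrite oppr_eq0 (negPf two0).
apply: (lie_isomorphic_of_map (phi := sl2_map H E Fm)).
+ move=> B; rewrite /= /sl2_map => E0.
  pose c (i : 'I_3) := nth 0 [:: B 0 0; B 0 1; B 1 0] i.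
  have c0 : forall i, c i = 0.
    by apply: free; rewrite -[RHS]E0 !big_ord_recr big_ord0 /= add0r.
  by apply: sl2_eq; rewrite /= mxE; [exact: (c0 0) | exact: (c0 1) | exact: (c0 2%:R)].
+ move=> w; suff [c ->] : in_span e w.
    have [B [B0 B1 B2]] := sl2_exists (c 0) (c 1) (c 2%:R).
    exists B; rewrite /= /sl2_map B0 B1 B2 /=.
    rewrite !big_ord_recr big_ord0 /= add0r.
    by do ?congr (_ + _); congr (c _ *: _); apply: val_inj.
  move: w; apply: (ladder_ind l) => [||j y jL yE|y s t yE]; first exact: in_span_lin.
  * case=> [//|[|//]] y _ yE; have -> : y = e 1 by apply: F_inj; rewrite yE expr1.
    exact: in_span_e.
  * case: j jL yE => [//|[|//]] _ yE; have -> : y = (a / 2) *: e 2%:R.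
      by rewrite -qE; apply: F_inj; rewrite yE expr1.
    exact: in_spanZ.
  have yE' : F y = (s / 2) *: F H + (t - s * (b / a))%:A.
    rewrite yE XE scalerDr !scalerA -addrA -scalerDl.
    by rewrite mulrN [t - _]addrC.
  have t0 : t - s * (b / a) = 0.
    apply: contrapT => /eqP t0; apply: noC.
    exists ((t - s * (b / a))^-1 *: (y - (s / 2) *: H)).
    by rewrite linearZ linearB linearZ /= yE' addrAC subrr add0r scalerA mulVf // scale1r.
  have -> : y = (s / 2) *: e 0 by apply: F_inj; rewrite yE' t0 scale0r addr0 linearZ.
  exact: in_spanZ.
exact: sl2_map_lie.
Qed.
End LadderClassification.

(** * Algebras with a nonzero eigenvalue *)

Section NonNilpotent.
Variables (K : numClosedFieldType) (A : algType K).
Hypothesis dom : no_zero_divisors A.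
Hypothesis gk : gk_dim_le2 A.
Hypothesis unit_central : units_central A.
Variables (g : finLieAlgType K) (F : {linear g -> A}).
Hypothesis F_inj : injective F.
Hypothesis F_lie : forall x y, F (lie x y) = F x * F y - F y * F x.
Implicit Types (x y z w X p q : g) (a b r : K).

(** A bracket [[p, q]] which is a nonzero scalar may be normalized to one;
otherwise there are no powers of [p] and [q] beyond the first. *)
Lemma ladder_classification X p q M L : ladder F X p q M L ->
  [\/ lie_isomorphic g (sl2 K), lie_isomorphic g (sl2_C K),
      lie_isomorphic g (sl2_heisenberg K) |
      exists n, (2 <= n)%N /\ lie_isomorphic g (calLt K n)].
Proof.
move=> l; have M0 := ladder_M l; have L0 := ladder_L l.
have [sc|nsc] := pselect (is_scalar (F (lie p q))).
  have [{sc} {}q [{}l pq1]] := ladder_normalize F_inj sc l.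
  have [l' pq1'] := ladder_flip l pq1.
  have [M1|M2] := leqP M 1.
    have ME : M = 1%N by apply/eqP; rewrite eqn_leq M1.
    rewrite ME in l; constructor 4; exists L.+1; split=> //.
    exact: (ladder_Lt dom F_inj F_lie l pq1).
  have [L1|L2] := leqP L 1.
    have LE : L = 1%N by apply/eqP; rewrite eqn_leq L1.
    rewrite LE in l'; constructor 4; exists M.+1; split=> //.
    exact: (ladder_Lt dom F_inj F_lie l' pq1').
  have ME : M = 2%N.
    by apply/eqP; rewrite eqn_leq -ltnS (ladder_lt3 F_inj F_lie L2 l pq1) M2.
  have LE : L = 2%N.
    by apply/eqP; rewrite eqn_leq -ltnS (ladder_lt3 F_inj F_lie M2 l' pq1') L2.
  rewrite ME LE in l; constructor 3.
  exact: (ladder_sl2_heisenberg dom gk F_inj F_lie l pq1).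
have [L1|L2] := leqP L 1; last by case: nsc; exact: (ladder_bracket_scalar dom F_inj F_lie L2 l).
have [M1|M2] := leqP M 1; last first.
  have [b bE] := ladder_bracket_scalar dom F_inj F_lie M2 (ladder_swap l).
  by case: nsc; exists (- b); rewrite lieC linearN /= bE scaleNr.
have ME : M = 1%N by apply/eqP; rewrite eqn_leq M1.
have LE : L = 1%N by apply/eqP; rewrite eqn_leq L1.
rewrite ME LE in l.
have [a [b pqE]] : exists a b, F (lie p q) = a *: F X + b%:A.
  by apply: (ladder_0 l); rewrite lie_leibniz (ladder_p l) (ladder_q l) lieNr subrr.
have a0 : a != 0.
  by apply/eqP => a0; apply: nsc; exists b; rewrite pqE a0 scale0r add0r.
have [h|h] := ladder_sl2 F_inj F_lie l pqE a0; [by constructor 1 | by constructor 2].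
Qed.

(** The positive weight vectors commute and have multiplicity one. The list [s]
of the exponents contains zero when [g] contains the unit of the associative
algebra. *)
Lemma one_sided_classification x rs : graded_by x rs ->
    (exists m, 0 < m /\ has_wt x m) -> (forall m, m < 0 -> ~ has_wt x m) ->
  exists (n : nat) (i : 'I_n -> nat),
      [/\ (1 <= n)%N, (forall j k : 'I_n, (j < k)%N -> (i j < i k)%N),
          (exists j : 'I_n, i j <> 0%N) & lie_isomorphic g (calr K i)].
Proof.
move=> gr pos neg; have [B hB] := weight_bound gr.
(* The exponents: the positive weights, and zero when the unit belongs to the
image. *)
pose S (n : nat) := if n is 0 then exists o, F o = 1 else has_wt x n%:Z.
pose s := [seq n <- iota 0 B.+1 | `[< S n >]].
have sS n : S n -> n \in s.
  move=> Sn; rewrite mem_filter mem_iota /= add0n ltnS; apply/andP; split; first exact/asboolP.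
  by case: n Sn => // n /hB.
have Ss n : n \in s -> S n by rewrite mem_filter => /andP[/asboolP].
have s_sorted : sorted ltn s by apply: sorted_filter; [exact: ltn_trans | exact: iota_ltn_sorted].
have x_nonscalar : ~ is_scalar (F x).
  case: pos => m [m0 [z [hz z0]]]; apply: (nonscalar_of_eigen F_inj F_lie _ z0 hz).
  by rewrite intr_eq0 lt0r_neq0.
have /choice[y yP] : forall n : nat, exists z, S n -> [/\ wt x n%:Z z, z != 0 & n = 0%N -> F z = 1].
  case=> [|n].
    have [[o oE]|no] := pselect (S 0%N); last by exists 0.
    exists o => _; split=> //.
      by apply/wtP/F_inj; rewrite F_lie oE mulr1 mul1r subrr scale0r linear0.
    by apply: contraTneq (oner_neq0 A) => o0; rewrite -oE o0 linear0 eqxx.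
  have [[z [hz z0]]|no] := pselect (S n.+1); last by exists 0.
  by exists z.
pose i (k : 'I_(size s)) := nth 0%N s k.
have Si k : S (i k) by apply/Ss/mem_nth.
pose e (k : option 'I_(size s)) := if k is Some k then y (i k) else - x.
have iS (j k : 'I_(size s)) : (j < k)%N -> (i j < i k)%N.
  by move=> jk; apply: (sorted_ltn_nth ltn_trans) => //; rewrite inE.
have idx n : S n -> exists k, i k = n.
  move=> /sS ns; have lt : (index n s < size s)%N by rewrite index_mem.
  by exists (Ordinal lt); rewrite /i nth_index.
have [k0 k0S] : exists k, i k <> 0%N.
  case: pos => -[m|m] [m0 hm] //; have Sm : S m by case: m m0 hm.
  by have [k kE] := idx m Sm; exists k; rewrite kE; case: m m0 {hm kE Sm}.
have y_comm m n : S m -> S n -> lie (y m) (y n) = 0.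
  move=> Sm Sn; have [hm _ m1] := yP m Sm; have [hn _ n1] := yP n Sn.
  have F1 (w : A) : w * 1 - 1 * w = 0 by rewrite mulr1 mul1r subrr.
  case: m Sm hm m1 => [|m] Sm hm m1.
    by apply: (F_eq0 F_inj); rewrite F_lie m1 // mulr1 mul1r subrr.
  case: n Sn hn n1 => [|n] Sn hn n1.
    by apply: (F_eq0 F_inj); rewrite F_lie n1 // mulr1 mul1r subrr.
  exact: (positive_commute dom gk F_inj F_lie gr _ _ hm hn).
exists (size s), i; split=> //; first by case: (size s) k0 {k0S} => [[]|].
  by exists k0.
have [C0 CN C1] := lin_combE (LieRelations (@r_jacobi K _ i)) e.
have lie_y k : lie (- x) (y (i k)) = - ((i k)%:R *: y (i k)).
  by have [/wtP h _ _] := yP _ (Si k); rewrite lieNl h -pmulrn.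
apply: (lie_isomorphic_basis (e := e)).
- move=> [j|] [k|] /=; rewrite ?C0 ?CN ?subrr ?subr0 ?sub0r.
  + exact: y_comm.
  + by rewrite lieC lie_y.
  + exact: lie_y.
  + by rewrite liexx.
- pose nu (k : option 'I_(size s)) : K := if k is Some k then (i k)%:R else 0.
  apply: (weights_free F_inj F_lie (X := x) (nu := nu) (h := None)) => //.
  + case=> [k|]; last by rewrite /= lieNr liexx oppr0 scale0r.
    by have [/wtP h _ _] := yP _ (Si k); rewrite /nu pmulrn.
  + case=> [k|]; first by have [] := yP _ (Si k).
    by rewrite /e oppr_eq0; apply: contra_notN x_nonscalar => /eqP ->; exists 0; rewrite linear0 scale0r.
  + case=> [j|//] [k|//] _ _ /eqP; rewrite eqr_nat => /eqP E; congr Some.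
    by apply: val_inj; apply/eqP; case: ltngtP => // /iS; rewrite E ltnn.
  + by move=> [a aE]; apply: x_nonscalar; exists (- a); rewrite scaleNr -aE linearN opprK.
  + case=> [k|//] _ /eqP; rewrite pnatr_eq0 => /eqP ik0; exists 1.
    by have [_ _ ->] := yP _ (Si k); rewrite ?scale1r.
have [_ _ dec] := gr.
move=> w; have [u [hu ->]] := dec w.
have span0 : in_span e 0 by exists (fun=> 0); rewrite big1 // => k _; rewrite scale0r.
apply: (big_ind (in_span e)) => // [v v' hv hv'|m _].
  by rewrite -[v]scale1r; apply: in_span_lin.
have [->//|um0] := eqVneq (u m) 0.
case: m um0 (hu m) => [[|n]|n] um0 hum.
- have [a [b E]] := weight_zero dom gk F_inj F_lie gr pos hum.
  have xE : in_span e (a *: x).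
    by rewrite -[x]opprK scalerN -scaleNr; apply: (in_spanZ e (- a) None).
  have [b0|b0] := eqVneq b 0.
    by rewrite (_ : u 0 = a *: x) //; apply: F_inj; rewrite E b0 scale0r addr0 linearZ.
  have S0 : S 0%N.
    exists (b^-1 *: (u 0 - a *: x)).
    by rewrite linearZ linearB linearZ /= E addrAC subrr add0r scalerA mulVf // scale1r.
  have [k kE] := idx _ S0.
  have -> : u 0 = b *: e (Some k) + a *: x.
    apply: F_inj; rewrite E linearD !linearZ /= kE; have [_ _ ->//] := yP _ S0.
    by rewrite addrC.
  by apply: in_span_lin => //; exact: in_span_e.
- have Sn : S n.+1 by exists (u n.+1).
  have [k kE] := idx _ Sn; have [hy y0 _] := yP _ Sn.
  have [|r ->] := positive_proportional dom gk F_inj F_lie gr _ hy hum y0 => //.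
  by rewrite -kE; apply: (in_spanZ e r (Some k)).
- by case: (neg (Negz n)) => //; exists (u (Negz n)).
Qed.

Theorem non_nilpotent_classification x a z : a != 0 -> z != 0 -> lie_sub x a z = 0 ->
  [\/ lie_isomorphic g (sl2 K), lie_isomorphic g (sl2_C K),
      lie_isomorphic g (sl2_heisenberg K) |
      (exists n, (2 <= n)%N /\ lie_isomorphic g (calLt K n)) \/
      exists (n : nat) (i : 'I_n -> nat),
      [/\ (1 <= n)%N, (forall j k : 'I_n, (j < k)%N -> (i j < i k)%N),
          (exists j : 'I_n, i j <> 0%N) & lie_isomorphic g (calr K i)]].
Proof.
move=> a0 z0 xz; have [y [rs [m [w [gr m0 hw w0]]]]] := graded_exists dom gk F_inj F_lie a0 z0 xz.
have pos : exists m, 0 < m /\ has_wt y m by exists m; split=> //; exists w.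
have [neg|noneg] := pselect (exists m, m < 0 /\ has_wt y m).
  have [X [p [q [M [L l]]]]] := ladder_exists dom gk unit_central F_inj F_lie gr pos neg.
  have [h|h|h|h] := ladder_classification l;
    [by constructor 1 | by constructor 2 | by constructor 3 | by constructor 4; left].
constructor 4; right; apply: (one_sided_classification gr pos) => k k0 hk.
by apply: noneg; exists k.
Qed.
End NonNilpotent.

(** * Nilpotent algebras *)

Section Engel.
Variables (K : numClosedFieldType) (g : finLieAlgType K).
Hypothesis nil : forall x w : g, exists n, iter n (lie x) w = 0.
Implicit Types (h V W : {vspace g}).

Definition stable h V := forall u v, u \in h -> v \in V -> lie u v \in V.

(** The conclusion of the theorem of Engel for [h] acting on a subquotient [V /
W] of [g]. *)
Definition engel h := forall W V, stable h W -> stable h V -> ~~ (V <= W)%VS ->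
  exists v, [/\ v \in V, v \notin W & forall u, u \in h -> lie u v \in W].

(** The elements of [V] which [h] sends into [W] are stable under [x]; apply [ad
x] to one of them as often as possible without entering [W]. *)
Lemma engel_step h x : stable h h -> engel h -> (forall u, u \in h -> lie u x \in h) ->
  stable (h + <[x]>) (h + <[x]>) /\ engel (h + <[x]>).
Proof.
move=> hh eh xh; split.
  move=> _ _ /memv_addP[u uh [_ /vlineP[a ->] ->]] /memv_addP[v vh [_ /vlineP[b ->] ->]].
  apply: (subvP (addvSl _ _)); rewrite !(lieDl, lieDr, lieZl, lieZr) liexx !scaler0 addr0.
  apply: rpredD.
    by apply: rpredD; [exact: hh | apply: rpredZ; exact: xh].
  by apply: rpredZ; rewrite lieC rpredN; exact: xh.
move=> W V sW sV nVW.
have sub u : u \in h -> u \in (h + <[x]>)%VS by move=> uh; apply: (subvP (addvSl _ _)).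
have xin : x \in (h + <[x]>)%VS by apply: (subvP (addvSr _ _)); exact: memv_line.
have [v0 [v0V v0W hv0]] := eh W V (fun u v uh => sW u v (sub u uh)) (fun u v uh => sV u v (sub u uh)) nVW.
have iterV i : iter i (lie x) v0 \in V by elim: i => //= i IH; apply: sV.
have iterh i u : u \in h -> lie u (iter i (lie x) v0) \in W.
  elim: i u => [|i IH] u uh; first exact: hv0.
  by rewrite iterS lie_leibniz rpredD ?IH ?xh //; apply: sW => //; exact: IH.
have [n hn] := nil x v0.
have [i [iW iSW]] : exists i, iter i (lie x) v0 \notin W /\ iter i.+1 (lie x) v0 \in W.
  have : iter n (lie x) v0 \in W by rewrite hn mem0v.
  elim: {hn} n => [v0inW|n IH hn]; first by rewrite v0inW in v0W.
  by have [/IH//|nin] := boolP (iter n (lie x) v0 \in W); exists n.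
exists (iter i (lie x) v0); split=> // _ /memv_addP[u uh [_ /vlineP[a ->] ->]].
by rewrite lieDl lieZl rpredD ?iterh // rpredZ.
Qed.

(** Applying the property of [h] to the subquotient [g / h] itself gives an
element normalizing [h], so [h] can be enlarged until it is everything. *)
Lemma engel_full : engel fullv.
Proof.
suff flag k : exists h, [/\ stable h h, engel h & (k <= \dim h)%N \/ h = fullv].
  have [h [_ eh [dh|<-//]]] := flag (\dim {: g}).+1.
  by move: (dimvS (subvf h)); rewrite leqNgt dh.
elim: k => [|k [h [hh eh hk]]].
  exists 0%VS; split; last by left.
    by move=> u v /[!memv0] /eqP-> _; rewrite lie0l.
  move=> W V _ _ /subvPn[v vV vW]; exists v; split=> // u /[!memv0] /eqP->.
  by rewrite lie0l mem0v.
have [hf|hf] := eqVneq h fullv.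
  by rewrite hf in hh eh; exists fullv; split=> //; right.
have [||x [_ xh hx]] := eh h fullv hh.
- by move=> u v _ _; exact: memvf.
- by apply: contra hf => sub; rewrite eqEsubv subvf.
have [hh' eh'] := engel_step hh eh hx.
exists (h + <[x]>)%VS; split=> //; left.
case: hk => [hk|hk]; last by rewrite hk eqxx in hf.
apply: leq_ltn_trans hk _; rewrite (ltn_leqif (dimv_leqif_sup (addvSl _ _))).
by apply: contra xh => /subvP; apply; apply: (subvP (addvSr _ _)); exact: memv_line.
Qed.

Lemma engel_vector (W : {vspace g}) : stable fullv W -> W != fullv ->
  exists v, v \notin W /\ forall u, lie u v \in W.
Proof.
move=> sW Wf; have [||v [_ vW h]] := engel_full sW (V := fullv).
- by move=> u v _ _; exact: memvf.
- by apply: contra Wf => sub; rewrite eqEsubv subvf.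
by exists v; split=> // u; apply: h; exact: memvf.
Qed.
End Engel.

Section Nilpotent.
Variables (K : numClosedFieldType) (A : algType K).
Hypothesis dom : no_zero_divisors A.
Hypothesis gk : gk_dim_le2 A.
Variables (g : finLieAlgType K) (F : {linear g -> A}).
Hypothesis F_inj : injective F.
Hypothesis F_lie : forall x y, F (lie x y) = F x * F y - F y * F x.
Hypothesis nil : forall x w : g, exists n, iter n (lie x) w = 0.
Hypothesis nonab : exists u v : g, lie u v <> 0.
Implicit Types (x y z w : g) (a b r : K).

Lemma central_scalar z : (forall u, lie z u = 0) -> is_scalar (F z).
Proof.
move=> zc; apply: contrapT => zns; have [u [v uv]] := nonab.
have [n hn] := nil u v.
by apply: uv; exact: (nilpotent_centralizer_commute dom gk F_inj F_lie zns (zc u) (zc v) hn).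
Qed.

Lemma unit_vector : exists o, F o = 1.
Proof.
have [||z [z0 zc]] := engel_vector nil (W := 0%VS).
- by move=> u v _ /[!memv0] /eqP->; rewrite lie0r.
- apply/eqP => E; have [u [v uv]] := nonab; apply: uv; apply/eqP.
  by rewrite -memv0 E memvf.
rewrite memv0 in z0.
have [|b zE] := central_scalar (z := z).
  by move=> u; rewrite lieC; apply/eqP; rewrite oppr_eq0 -memv0.
have b0 : b != 0.
  by apply: contraNneq z0 => b0; apply/eqP/(F_eq0 F_inj); rewrite zE b0 scale0r.
by exists (b^-1 *: z); rewrite linearZ /= zE scalerA mulVf // scale1r.
Qed.

(** The first two steps of the upper central series: the centre consists of
scalars, and an element central modulo scalars is one half of a canonical pair.
*)
Lemma canonical_pair : exists v w o, [/\ F o = 1, lie v w = o & forall u, exists b, lie u w = b *: o].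
Proof.
have [o oE] := unit_vector.
have oc u : lie u o = 0 by apply: (F_eq0 F_inj); rewrite F_lie oE mulr1 mul1r subrr.
have [||w [wo hw]] := engel_vector nil (W := <[o]>%VS).
- by move=> u _ _ /vlineP[a ->]; rewrite lieZr oc scaler0 mem0v.
- apply/eqP => E; have [u [v uv]] := nonab; apply: uv.
  have /vlineP[a ->] : u \in <[o]>%VS by rewrite E memvf.
  by rewrite lieZl lieC oc oppr0 scaler0.
have {}hw u : exists b, lie u w = b *: o by apply/vlineP.
have [v vw] : exists v, lie v w <> 0.
  apply: contrapT => none; have [|b wE] := central_scalar (z := w).
    move=> u; rewrite lieC; apply: contrapT => h; apply: none; exists u => h'.
    by rewrite h' oppr0 in h.
  case/negP: wo; apply/vlineP; exists b; apply: F_inj.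
  by rewrite linearZ /= oE.
have [b bE] := hw v; have b0 : b != 0.
  by apply/eqP => b0; apply: vw; rewrite bE b0 scale0r.
exists (b^-1 *: v), w, o; split=> //.
by rewrite lieZl bE scalerA mulVf // scale1r.
Qed.

Lemma horner_alg_deriv (u v : A) (P : {poly K}) : v * u - u * v = 1 ->
  v * horner_alg u P - horner_alg u P * v = horner_alg u P^`().
Proof.
move=> vu; elim/poly_ind: P => [|P c IH].
  by rewrite deriv0 !rmorph0 mulr0 mul0r subrr.
rewrite derivMXaddC !rmorphD !rmorphM /= !horner_algX horner_algC -IH.
rewrite mulrDr mulrDl -scalerAl -scalerAr mul1r mulr1 opprD addrACA subrr addr0.
rewrite [in RHS]mulrBl -[X in _ = X + _]mulr1 -vu mulrBr !mulrA.
by rewrite [RHS]addrC addrA subrK.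
Qed.

Lemma poly_antiderivative (Q : {poly K}) : exists P : {poly K}, P^`() = Q.
Proof.
exists (\poly_(i < (size Q).+1) (Q`_i.-1 / i%:R)); apply/polyP => i.
rewrite coef_deriv coef_poly ltnS; case: ltnP => iQ.
  by rewrite /= -[LHS]mulr_natr divfK // pnatr_eq0.
by rewrite mul0rn nth_default.
Qed.

(** By induction on the order of nilpotency of [ad v] on [y]: integrating the
polynomial of [lie v y] gives a polynomial in [F w] which differs from [F y] by
an element commuting with both [F v] and [F w]. *)
Lemma centralizer_polynomial v w o y : F o = 1 -> lie v w = o -> lie w y = 0 ->
  exists P, F y = horner_alg (F w) P.
Proof.
move=> oE vw; have [n] := nil v y.
have VW : F v * F w - F w * F v = 1 by rewrite -F_lie vw.
elim: n y => [|n IH] y hn wy; first by exists 0; rewrite rmorph0 [y]hn linear0.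
have [||Q QE] := IH (lie v y); first by rewrite -iterSr.
  have oy : lie o y = 0 by apply: (F_eq0 F_inj); rewrite F_lie oE mulr1 mul1r subrr.
  by rewrite lie_leibniz wy lie0r addr0 [lie w v]lieC vw lieNl oy oppr0.
have [P PQ] := poly_antiderivative Q.
have [b bE] : is_scalar (F y - horner_alg (F w) P).
  apply: (commutes_with_nilpotent_pair dom gk (u := F v) (v := F w) (c := 1)).
  - have : F v * F y - F y * F v = F v * horner_alg (F w) P - horner_alg (F w) P * F v.
      by rewrite -F_lie QE horner_alg_deriv // PQ.
    move/eqP; rewrite subr_eq => /eqP E.
    by rewrite mulrBl mulrBr E addrAC [_ - _ - _ in RHS]addrAC subrr sub0r addrC.
  - rewrite mulrBr mulrBl (horner_alg_comm _ (erefl (F w * F w))); congr (_ - _).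
    by apply/esym/(F_comm F_inj F_lie).
  - exact: VW.
  - by rewrite mulr1 mul1r.
  - exact: oner_neq0.
by exists (P + b%:P); rewrite rmorphD /= horner_algC -bE addrC subrK.
Qed.

(** The centralizer of [w] consists of polynomials in [F w] and is stable under
differentiation; it is therefore the space of all polynomials up to some degree,
and [v] spans a complement. *)
Theorem nilpotent_classification : exists n, (2 <= n)%N /\ lie_isomorphic g (calL K n).
Proof.
have [v [w [o [oE vw wcom]]]] := canonical_pair.
have VW : F v * F w - F w * F v = 1 by rewrite -F_lie vw.
have wns : ~ is_scalar (F w).
  move=> [b wE]; move: VW; rewrite wE -scalerAl -scalerAr mul1r mulr1 subrr => /esym/eqP.
  by rewrite oner_eq0.
have oc u : lie u o = 0 by apply: (F_eq0 F_inj); rewrite F_lie oE mulr1 mul1r subrr.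
have fact_neq0 j : j`!%:R != 0 :> K by rewrite pnatr_eq0 -lt0n fact_gt0.
have general y : exists b P, F y = b *: F v + horner_alg (F w) P.
  have [b bE] := wcom y.
  have [|P PE] := centralizer_polynomial (y := y - b *: v) oE vw.
    by rewrite lieC lieDl lieNl lieZl bE vw subrr oppr0.
  by exists b, P; rewrite -PE linearB linearZ /= addrC subrK.
pose T k := exists y, F y = F w ^+ k.
(* Brackets with [v] differentiate, so one polynomial of degree [k] produces all
powers up to the [k]-th. *)
have low k (P : {poly K}) y : (size P <= k.+1)%N -> P`_k != 0 -> F y = horner_alg (F w) P ->
    forall j, (j <= k)%N -> T j.
  elim: k P y => [|k IH] P y sP Pk yE j.
    by rewrite leqn0 => /eqP->; exists o; rewrite oE expr0.
  have TT : forall j, (j <= k)%N -> T j.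
    apply: (IH P^`() (lie v y)).
    - have P0 : P != 0 by apply: contraNneq Pk => ->; rewrite coef0.
      by rewrite -ltnS (leq_trans (lt_size_deriv P0)).
    - by rewrite coef_deriv mulrn_eq0.
    - by rewrite F_lie yE horner_alg_deriv.
  rewrite leq_eqVlt => /predU1P[->|]; last exact: TT.
  have /choice[t tE] : forall i : nat, exists z : g, (i <= k)%N -> F z = F w ^+ i.
    move=> i; by have [/TT[z zE]|_] := leqP i k; [exists z | exists 0].
  exists ((P`_k.+1)^-1 *: (y - \sum_(i < k.+1) P`_i *: t i)).
  have PE : P = \poly_(i < k.+2) P`_i.
    by apply/polyP => i; rewrite coef_poly; case: ltnP => // h; rewrite nth_default // (leq_trans sP).
  have hP : horner_alg (F w) P = \sum_(i < k.+2) P`_i *: F w ^+ i by rewrite {1}PE horner_alg_sum.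
  rewrite linearZ linearB /= yE hP big_ord_recr /= linear_sum /=.
  rewrite [X in _ + _ - X](eq_bigr (fun i : 'I_k.+1 => P`_i *: F w ^+ i)).
    by rewrite addrAC subrr add0r scalerA mulVf // scale1r.
  by move=> i _; rewrite linearZ /= tE // -ltnS.
have Tlow k j : T k -> (j <= k)%N -> T j.
  move=> [y yE]; apply: (low k 'X^k y); rewrite ?size_polyXn ?coefXn ?eqxx ?oner_eq0 //.
  by rewrite rmorphXn /= horner_algX.
have powers k : T k -> exists t : nat -> g, forall j, (j <= k)%N -> F (t j) = F w ^+ j.
  move=> Tk; suff /choice[t tE] : forall i : nat, exists z : g, (i <= k)%N -> F z = F w ^+ i by exists t.
  by move=> i; have [/(Tlow _ _ Tk)[z zE]|_] := leqP i k; [exists z | exists 0].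
have poly0 (P : {poly K}) : horner_alg (F w) P = 0 -> P = 0.
  by move=> h; apply: contrapT => /eqP P0; apply: wns; exact: (algebraic_is_scalar dom P0 h).
have Tbound k : T k -> (k <= \dim {: g})%N.
  move=> /powers[t tE]; rewrite leqNgt; apply/negP => kd.
  have [||c [[i0 c0] s0]] := @linear_dependence K g 'I_k.+1 'I_(\dim {: g})
     (fun i => (vbasis {: g})`_i) (fun i => t i) (fun j s => coord (vbasis {: g}) s (t j)).
  - by move=> i; apply: coord_vbasis; rewrite memvf.
  - by rewrite !card_ord ltnW.
  have := poly0 (\poly_(i < k.+1) (if insub i is Some i' then c i' else 0)).
  rewrite horner_alg_sum (_ : \sum_(i < _) _ = F (\sum_i c i *: t i)).
    rewrite s0 linear0 => /(_ erefl) /(congr1 (fun P : {poly K} => P`_i0)) /eqP.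
    by rewrite coef_poly ltn_ord valK coef0 (negPf c0).
  by rewrite linear_sum; apply: eq_bigr => i _; rewrite valK linearZ /= tE // -ltnS.
have exT : exists k, `[< T k >] by exists 1%N; apply/asboolP; exists w; rewrite expr1.
(* [L] is the largest degree in the centralizer of [w]. *)
case: (ex_maxnP exT (fun k => fun h => Tbound k (asboolW h))) => L /asboolP TL Lmax.
have {}Lmax k : T k -> (k <= L)%N by move=> h; apply: Lmax; apply/asboolP.
have L0 : (0 < L)%N by apply: Lmax; exists w; rewrite expr1.
have [t tE] := powers L TL.
pose y j := j`!%:R^-1 *: t j.
have yE j : (j <= L)%N -> F (y j) = j`!%:R^-1 *: F w ^+ j by move=> jL; rewrite linearZ /= tE.
have [v_y v_y0 y_comm] := divided_power_brackets F_inj F_lie VW yE.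
set n := L.+1.
pose e := L_family (n := n) v y.
exists n; split; first by rewrite /n ltnS.
apply: (lie_isomorphic_basis (e := e)).
- exact: (L_family_lie (n := n) v_y v_y0 y_comm).
- move=> c s0.
  have c0 : c ord0 = 0.
    have := congr1 (fun z => lie z w) s0; rewrite lie0l big_ord_recl lieDl lieZl {1}/e /= vw.
    have -> : lie (\sum_(i < n) c (lift ord0 i) *: e (lift ord0 i)) w = 0.
      apply: (F_eq0 F_inj); rewrite F_lie linear_sum /= mulr_sumr mulr_suml -sumrB big1 // => i _.
      rewrite linearZ /= /e /L_family /= yE; last by rewrite /n /bump leq0n add1n subSS leq_subr.
      by rewrite -!scalerAl -!scalerAr -exprS -exprSr subrr.
    rewrite addr0 => /(congr1 F); rewrite linearZ /= oE linear0 => /eqP.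
    by rewrite scaler_eq0 oner_eq0 orbF => /eqP.
  have cS (i : 'I_n) : c (lift ord0 i) = 0.
    move: s0; rewrite big_ord_recl c0 scale0r add0r (reindex_inj rev_ord_inj) /=.
    move=> /(congr1 F); rewrite linear0 linear_sum /=.
    have := poly0 (\poly_(j < n) (if insub j is Some j' then c (lift ord0 (rev_ord j')) / j`!%:R else 0)).
    rewrite horner_alg_sum => h s0; have := h _ => {h}.
    rewrite -[X in (X = 0 -> _) -> _](_ : \sum_(j < n) F (c (lift ord0 (rev_ord j)) *: e (lift ord0 (rev_ord j))) = _).
      move=> /(_ s0) /(congr1 (fun P : {poly K} => P`_(rev_ord i))) /eqP.
      rewrite coef_poly ltn_ord valK coef0 rev_ordK mulf_eq0 invr_eq0 (negPf (fact_neq0 _)) orbF.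
      by move/eqP.
    apply: eq_bigr => j _; rewrite valK linearZ /= -scalerA -yE; last by rewrite -ltnS.
    congr (_ *: F _); rewrite /e /L_family /= /bump leq0n add1n; congr (y _).
    by have := ltn_ord j; rewrite /n; lia.
  by move=> i; case: (unliftP ord0 i) => [j|] ->.
move=> z; have [b [P zE]] := general z.
have zE' : F (z - b *: v) = horner_alg (F w) P.
  by rewrite linearB linearZ /= zE addrAC subrr add0r.
have sP : (size P <= n)%N.
  rewrite leqNgt; apply/negP => nP.
  have TP : T (size P).-1.
    apply: (low _ P _ (leqSpred _) _ zE') => //.
    by rewrite -lead_coefE lead_coef_eq0 -size_poly_eq0 -lt0n (leq_trans _ nP).
  by have := Lmax _ TP; rewrite leqNgt -ltnS prednK ?nP // (leq_trans _ nP).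
have PE : P = \poly_(i < n) P`_i.
  by apply/polyP => i; rewrite coef_poly; case: ltnP => // h; rewrite nth_default // (leq_trans sP).
have -> : z = b *: e ord0 + \sum_(i < n) (P`_i * i`!%:R) *: y i.
  apply: F_inj; rewrite zE linearD linearZ /=; congr (_ + _).
  rewrite {1}PE horner_alg_sum linear_sum; apply: eq_bigr => i _.
  by rewrite linearZ /= yE -1?ltnS // scalerA mulfK.
apply: in_span_lin; first exact: in_span_e.
apply: (big_ind (in_span e)) => [||i _]; first by exists (fun=> 0); rewrite big1 // => k _; rewrite scale0r.
  by move=> u u' hu hu'; rewrite -[u]scale1r; apply: in_span_lin.
have lt : (n - i < n.+1)%N by rewrite ltnS leq_subr.
have -> : y i = e (Ordinal lt).
  rewrite /e /L_family /=; have := ltn_ord i; case: ifP => [/eqP|_] h; first by lia.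
  by congr (y _); lia.
exact: in_spanZ.
Qed.

End Nilpotent.

(** * The models inside the Weyl algebra *)

Lemma lie_embeds_of_map (K : fieldType) (g h : lieAlgType K) (phi : {linear h -> g}) :
    (forall u, phi u = 0 -> u = 0) ->
    (forall u v, phi (lie u v) = lie (phi u) (phi v)) ->
  lie_embeds h g.
Proof.
move=> ker morph; exists phi; split=> // u v E; apply/eqP; rewrite -subr_eq0; apply/eqP/ker.
by rewrite linearB E subrr.
Qed.

Section WeylModels.
Variable K : numClosedFieldType.
Local Notation A := (weyl K).
Local Notation g := (weyl_lie K).
Local Notation p := (weyl_p K : weyl_lie K).
Local Notation q := (weyl_q K : weyl_lie K).

Let F : {linear g -> A} := (idfun : {linear A -> A}).

Let F_inj : injective F. Proof. by []. Qed.
Let F_lie (x y : g) : F (lie x y) = F x * F y - F y * F x. Proof. by []. Qed.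

(** The element whose adjoint action gives [q] and [p] the weights minus one and
one. *)
Definition weyl_euler : g := - ((weyl_q K) * (weyl_p K)).

Lemma weyl_lie_pq : F (lie p q) = 1.
Proof. exact: weyl_pq. Qed.

Lemma euler_p : lie weyl_euler p = p.
Proof.
rewrite /lie /= /commutator /weyl_euler mulNr mulrN opprK mulrA addrC -mulrBl weyl_pq.
by rewrite mul1r.
Qed.

Lemma euler_q : lie weyl_euler q = - q.
Proof.
rewrite /lie /= /commutator /weyl_euler mulNr mulrN opprK -mulrA addrC -mulrBr -opprB weyl_pq.
by rewrite mulrN1.
Qed.

Definition weyl_dpow j : g := j`!%:R^-1 *: (weyl_q K) ^+ j.

Let dpowE L j : (j <= L)%N -> F (weyl_dpow j) = j`!%:R^-1 *: F q ^+ j. Proof. by []. Qed.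

Lemma calLt_embeds n : (0 < n)%N -> lie_embeds (calLt K n) g.
Proof.
case: n => // L _; apply: (lie_embeds_basis (e := Lt_family (n := L.+1) weyl_euler p weyl_dpow)).
- exact: (divided_power_Lt_lie F_inj F_lie euler_p euler_q weyl_lie_pq (@dpowE L)).
- exact: (divided_power_Lt_free (@weyl_dom K) F_inj F_lie euler_p euler_q weyl_lie_pq (@dpowE L)).
Qed.

Lemma calL_embeds n : (0 < n)%N -> lie_embeds (calL K n) g.
Proof.
case: n => // L _.
have PQ : F p * F q - F q * F p = 1 by exact: weyl_pq.
have [p_y p_y0 y_comm] := divided_power_brackets F_inj F_lie PQ (@dpowE L).
apply: (lie_embeds_basis (e := L_family (n := L.+1) p weyl_dpow)).
- exact: (L_family_lie (n := L.+1) p_y p_y0 y_comm).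
move=> c s0 k.
pose c' (a : option 'I_L.+2) := if a is Some k then c k else 0.
suff: forall a, c' a = 0 by move/(_ (Some k)).
apply: (divided_power_Lt_free (@weyl_dom K) F_inj F_lie euler_p euler_q weyl_lie_pq (@dpowE L)).
rewrite -[RHS]s0 (bigD1 None) //= scale0r add0r (reindex_omap Some (fun a => a)) /=; last by case.
by apply: eq_bigl => k'; rewrite eqxx.
Qed.

Lemma calr_embeds n (i : 'I_n -> nat) : (forall j k : 'I_n, (j < k)%N -> (i j < i k)%N) ->
  lie_embeds (calr K i) g.
Proof.
move=> iS; pose e (k : option 'I_n) : g :=
  if k is Some k then (weyl_p K) ^+ i k else - weyl_euler.
have p0 : p != 0 by apply: contraTneq (oner_neq0 A) => p0; rewrite -weyl_lie_pq p0 lie0l linear0 eqxx.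
have eul m : lie weyl_euler ((weyl_p K) ^+ m : g) = m%:R *: ((weyl_p K) ^+ m : g).
  by apply: (power_weight F_inj F_lie (p := p) (a := 1)); rewrite ?scale1r ?euler_p.
have eul_ns : ~ is_scalar (F weyl_euler).
  apply: (nonscalar_of_weight F_inj F_lie (a := 1) _ p0); first exact: oner_neq0.
  by rewrite scale1r euler_p.
have [C0 CN C1] := lin_combE (LieRelations (@r_jacobi K _ i)) e.
apply: (lie_embeds_basis (e := e)).
- move=> [j|] [k|] /=; rewrite ?C0 ?CN ?subrr ?subr0 ?sub0r.
  + by rewrite /lie /= /commutator -!exprD addnC subrr.
  + by rewrite lieC lieNl eul opprK.
  + by rewrite lieNl eul.
  + by rewrite liexx.
- pose nu (k : option 'I_n) : K := if k is Some k then (i k)%:R else 0.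
  apply: (weights_free F_inj F_lie (X := weyl_euler) (nu := nu) (h := None)).
  + case=> [k|]; first exact: eul.
    by rewrite /= lieNr liexx oppr0 scale0r.
  + case=> [k|]; first exact: (dom_expr_neq0 (@weyl_dom K)).
    by rewrite /e oppr_eq0; apply: contra_notN eul_ns => /eqP ->; exists 0; rewrite scale0r.
  + case=> [j|//] [k|//] _ _ /eqP; rewrite eqr_nat => /eqP E; congr Some.
    by apply: val_inj; apply/eqP; case: ltngtP => // /iS; rewrite E ltnn.
  + by [].
  + have FN : F (e None) = - F weyl_euler := linearN F weyl_euler.
    by move=> [a aE]; apply: eul_ns; exists (- a); rewrite scaleNr -aE FN opprK.
  + case=> [k|//] _ /eqP; rewrite pnatr_eq0 => /eqP ik0; exists 1.
    by rewrite /e ik0 expr0 scale1r.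
Qed.

Let p2 : g := (weyl_p K) ^+ 2.
Let q2 : g := (weyl_q K) ^+ 2.

Lemma sl2_heisenberg_embeds : lie_embeds (sl2_heisenberg K) g.
Proof.
apply: (lie_embeds_of_map (phi := quad_map p q p2 q2)).
- exact: (quad_map_eq0 (@weyl_dom K) F_inj F_lie weyl_lie_pq (p2 := p2) (q2 := q2) erefl erefl).
- exact: (quad_map_lie F_inj F_lie weyl_lie_pq (p2 := p2) (q2 := q2) erefl erefl).
Qed.

Let sl2_part (B : sl2 K) (t : K) :
  sl2_map (quad_H p2 q2) (quad_E p2) (quad_F q2) B + t *: lie p q = 0 -> B = 0 /\ t = 0.
Proof.
rewrite /sl2_map => E0.
pose c (i : 'I_6) := nth 0 [:: B 0 0; B 0 1; B 1 0; 0; 0; t] i.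
have c0 : forall i, c i = 0.
  apply: (quad_free (@weyl_dom K) F_inj F_lie weyl_lie_pq (p2 := p2) (q2 := q2) erefl erefl).
  by rewrite -[RHS]E0 !big_ord_recr big_ord0 /= add0r !scale0r !addr0.
split; last exact: (c0 5%:R).
by apply: sl2_eq; rewrite /= mxE; [exact: (c0 0) | exact: (c0 1) | exact: (c0 2%:R)].
Qed.

Lemma sl2_C_embeds : lie_embeds (sl2_C K) g.
Proof.
have central := quad_central F_inj F_lie weyl_lie_pq.
have [HP HQ HE HF] := quad_weights F_inj F_lie weyl_lie_pq (p2 := p2) (q2 := q2) erefl erefl.
apply: (lie_embeds_of_map (phi := sl2_C_map (quad_H p2 q2) (quad_E p2) (quad_F q2) (lie p q))).
- by move=> [B t] /sl2_part [/= -> ->].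
- by apply: sl2_C_map_lie.
Qed.

Lemma sl2_embeds : lie_embeds (sl2 K) g.
Proof.
have [HP HQ HE HF] := quad_weights F_inj F_lie weyl_lie_pq (p2 := p2) (q2 := q2) erefl erefl.
apply: (lie_embeds_of_map (phi := sl2_map (quad_H p2 q2) (quad_E p2) (quad_F q2))).
- by move=> B B0; have [|//] := @sl2_part B 0; rewrite scale0r addr0.
- exact: sl2_map_lie.
Qed.
End WeylModels.

(** * The classification *)

Theorem theorem1p1 (R : realType) (g : finLieAlgType R[i])
    (g_nonabelian : ~ lie_abelian g) :
  lie_embeds g (weyl_lie R[i]) <->
  (lie_isomorphic g (sl2 R[i]) \/
   lie_isomorphic g (sl2_C R[i]) \/
   lie_isomorphic g (sl2_heisenberg R[i]) \/
   (exists n : nat, (2 <= n)%N /\ lie_isomorphic g (calL R[i] n)) \/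
   (exists n : nat, (2 <= n)%N /\ lie_isomorphic g (calLt R[i] n)) \/
   (exists (n : nat) (i : 'I_n -> nat),
      [/\ (1 <= n)%N,
          (forall j k : 'I_n, (j < k)%N -> (i j < i k)%N),
          (exists j : 'I_n, i j <> 0%N) &
          lie_isomorphic g (calr R[i] i)])).
Proof.
split; last first.
  case=> [h|[h|[h|[[n [n2 h]]|[[n [n2 h]]|[n [i [n1 iS _ h]]]]]]]];
    apply: (lie_embeds_trans (lie_embeds_iso h)).
  - exact: sl2_embeds.
  - exact: sl2_C_embeds.
  - exact: sl2_heisenberg_embeds.
  - exact/calL_embeds/ltnW.
  - exact/calLt_embeds/ltnW.
  - exact: calr_embeds.
case=> f [f_inj f_lie].
pose F : {linear g -> weyl R[i]} := f.
have F_inj : injective F := f_inj.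
have F_lie x y : F (lie x y) = F x * F y - F y * F x := f_lie x y.
have dom := @weyl_dom R[i]; have gk := @weyl_gk R[i].
have unit_central := @weyl_unit_central R[i].
have [[x [a [z [a0 z0 xz]]]]|nilp] :=
    pselect (exists x a (z : g), [/\ a != 0, z != 0 & lie_sub x a z = 0]).
  have [h|h|h|[[n h]|[n [i h]]]] :=
    non_nilpotent_classification dom gk unit_central F_inj F_lie a0 z0 xz.
  - by left.
  - by right; left.
  - by do 2!right; left.
  - by do 4!right; left; exists n.
  - by do 5!right; exists n, i.
do 3!right; left; apply: (nilpotent_classification dom gk F_inj F_lie).
  move=> x w; apply: nilpotent_of_no_eigenvalue => a y xy y0.
  by apply: contrapT => /eqP a0; apply: nilp; exists x, a, y.
apply: contrapT => ab; apply: g_nonabelian => x y; apply: contrapT => xy.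
by apply: ab; exists x, y.
Qed.
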